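(* Let $C\subset\mathbb{R}^3$ be a convex compact body. Assume that an open subset $\mathcal O\subset\partial C$ of its boundary is of class $C^2$ and has positive Gaussian curvature. Let $O\notin C$ be a point such that the closure of the set $\partial_-C=\partial C\cap\operatorname{int}(\operatorname{Conv}(C\cup\{O\}))$ is contained in $\mathcal O$ (and therefore $\partial_+C=\partial C\setminus\partial_-C$ contains $\partial C\setminus\mathcal O$). Then there exists a family of convex bodies $C(s)$, $s\in[-1,1]$, such that (a) $C(0)=C$; (b) $\partial_+C\subset\partial C(s)$ for all $s\in[-1,1]$; (c) for all $s\in[-1,1]$, $\nu_{C(s)}=\nu_C+s\,(\nu_{C(1)}-\nu_C)$. (d) Moreover, there exist a set $\Theta$ and families of convex bodies $C^{(\theta)}(s)$, $s\in[-1,1]$, indexed by $\theta\in\Theta$, each satisfying (a), (b), (c), such that $$\bigcup_{\theta\in\Theta}\{\lambda(\nu_{C^{(\theta)}(1)}-\nu_C):\lambda\in\mathbb{R}\}$$ is an infinite-dimensional subspace of the space of signed measures on $S^2$.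
   Context: A convex compact body is a compact convex set with nonempty interior. The surface measure $\nu_C$ of a convex compact body $C\subset\mathbb{R}^3$ is the Borel measure on $S^2$ that is the pushforward of the 2-dimensional Hausdorff measure on $\partial C$ under the map $\xi\mapsto n_\xi$ (outer unit normal), defined at the (full-measure set of) regular points $\xi$ of $\partial C$. *)

(* Defs.v *)
From HB Require Import structures.
From mathcomp Require Import all_boot all_order all_algebra.
From mathcomp Require Import all_classical all_reals all_analysis.

Set Implicit Arguments.
Unset Strict Implicit.
Unset Printing Implicit Defensive.

Import Order.TTheory GRing.Theory Num.Theory.
Import numFieldNormedType.Exports.

Local Open Scope classical_set_scope.
Local Open Scope ring_scope.

(* The norm that MathComp-Analysis puts on 'rV[R]_n is the sup norm; it is used
   below only through the topology it induces.  All metric notions (diameters,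
   unit vectors) go through [enorm]. *)
Definition dotp (R : realType) (n : nat) (u v : 'rV[R]_n) : R :=
  \sum_(i < n) u 0 i * v 0 i.

Definition enorm (R : realType) (n : nat) (u : 'rV[R]_n) : R :=
  Num.sqrt (dotp u u).

(* Indices are added in 'I_3, i.e. modulo 3. *)
Definition cross (R : realType) (u v : 'rV[R]_3) : 'rV[R]_3 :=
  \row_(k < 3) (u 0 (k + 1) * v 0 (k + 2) - u 0 (k + 2) * v 0 (k + 1)).

Definition boundary (T : topologicalType) (A : set T) : set T :=
  closure A `\` A°.

Definition rel_open (T : topologicalType) (B A : set T) : Prop :=
  exists2 W : set T, open W & A = B `&` W.

Definition convex_hull (R : realType) (A : set 'rV[R]_3) : set 'rV[R]_3 :=
  smallest (@convex_set R 'rV[R]_3) A.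

Definition convex_body (R : realType) (C : set 'rV[R]_3) : Prop :=
  [/\ convex_set C, compact C & C° !=set0].

Definition boundary_minus (R : realType) (C : set 'rV[R]_3) (o : 'rV[R]_3) :
    set 'rV[R]_3 :=
  boundary C `&` (convex_hull (C `|` [set o]))°.

Definition boundary_plus (R : realType) (C : set 'rV[R]_3) (o : 'rV[R]_3) :
    set 'rV[R]_3 :=
  boundary C `\` boundary_minus C o.

Definition partial (R : realType) (n m : nat) (i : 'I_n)
    (f : 'rV[R]_n -> 'rV[R]_m) : 'rV[R]_n -> 'rV[R]_m :=
  fun x => 'D_(delta_mx 0 i) f x.

Fixpoint class_C (R : realType) (n m k : nat) (U : set 'rV[R]_n)
    (f : 'rV[R]_n -> 'rV[R]_m) : Prop :=
  {in U, continuous f} /\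
  match k with
  | 0%N => True
  | k'.+1 => forall i : 'I_n,
      (forall x, U x -> derivable f x (delta_mx 0 i)) /\
      class_C k' U (partial i f)
  end.

(* [C2_patch S U r]: r is a regular C^2 parametrization, on the open set U of
   the plane, of a relatively open piece of S.  The last clause says that the
   inverse r @` U -> U is continuous as well. *)
Definition C2_patch (R : realType) (S : set 'rV[R]_3) (U : set 'rV[R]_2)
    (r : 'rV[R]_2 -> 'rV[R]_3) : Prop :=
  [/\ open U,
      class_C 2 U r,
      {in U &, injective r},
      forall x, U x -> cross (partial 0 r x) (partial 1 r x) != 0 &
      forall V, open V -> V `<=` U -> rel_open S (r @` V)].

Definition C2_surface (R : realType) (S : set 'rV[R]_3) : Prop :=
  forall xi, S xi -> exists U r, C2_patch S U r /\ (r @` U) xi.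

(* (L N - M^2) / (E G - F^2), from the two fundamental forms of r. *)
Definition gauss_curvature (R : realType) (r : 'rV[R]_2 -> 'rV[R]_3)
    (x : 'rV[R]_2) : R :=
  let ru := partial 0 r x in
  let rv := partial 1 r x in
  let nu := (enorm (cross ru rv))^-1 *: cross ru rv in
  let L := dotp (partial 0 (partial 0 r) x) nu in
  let M := dotp (partial 1 (partial 0 r) x) nu in
  let N := dotp (partial 1 (partial 1 r) x) nu in
  (L * N - M ^+ 2) / (dotp ru ru * dotp rv rv - dotp ru rv ^+ 2).

Definition positive_curvature (R : realType) (S : set 'rV[R]_3) : Prop :=
  forall U r, C2_patch S U r -> forall x, U x -> 0 < gauss_curvature r x.

(* The union with [set 0] gives the empty set diameter 0 (and not -oo). *)
Definition ediam (R : realType) (A : set 'rV[R]_3) : \bar R :=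
  ereal_sup ([set 0%E] `|`
    [set z | exists x y, [/\ A x, A y & z = (enorm (x - y))%:E]]).

Definition hausdorff2_pre (R : realType) (delta : R) (A : set 'rV[R]_3) :
    \bar R :=
  ereal_inf [set z | exists F : nat -> set 'rV[R]_3,
    [/\ A `<=` \bigcup_i F i,
        forall i, (ediam (F i) <= delta%:E)%E &
        z = (\sum_(0 <= i <oo) ((pi / 4)%:E * ediam (F i) ^+ 2))%E]].

(* The factor pi / 4 is the area of the planar disk of diameter 1, so that
   this measure is the area on planes.  The supremum over delta is the limit
   as delta tends to 0. *)
Definition hausdorff2 (R : realType) (A : set 'rV[R]_3) : \bar R :=
  ereal_sup [set hausdorff2_pre delta A | delta in [set e : R | 0 < e]].

Definition sphere (R : realType) : Type :=
  set_type [set u : 'rV[R]_3 | enorm u = 1].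

HB.instance Definition _ (R : realType) := Topological.on (sphere R).

Lemma enorm_pole (R : realType) :
  (delta_mx 0 0 : 'rV[R]_3) \in [set u : 'rV[R]_3 | enorm u = 1].
Proof.
rewrite inE /= /enorm /dotp big_ord_recl big1 => [|i _].
  by rewrite !mxE /= mulr1 addr0 sqrtr1.
by rewrite !mxE /= mul0r.
Qed.

HB.instance Definition _ (R : realType) :=
  isPointed.Build (sphere R) (SigSub (enorm_pole R)).

Notation borel_sphere R := (g_sigma_algebraType (@open (sphere R))).

Definition outer_normals (R : realType) (C : set 'rV[R]_3) (xi : 'rV[R]_3) :
    set (sphere R) :=
  [set n : sphere R | forall x, C x -> dotp (set_val n) (x - xi) <= 0].

(* A boundary point is regular when it has exactly one outer unit normal n_xi;
   the set below is the preimage of A under xi |-> n_xi, defined on the regular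
   points. *)
Definition surface_measure (R : realType) (C : set 'rV[R]_3)
    (A : set (borel_sphere R)) : \bar R :=
  hausdorff2 [set xi | boundary C xi /\
    exists2 n : sphere R, outer_normals C xi = [set n] & A n].

Definition family_abc (R : realType) (C : set 'rV[R]_3) (o : 'rV[R]_3)
    (Cs : R -> set 'rV[R]_3) : Prop :=
  [/\ forall s, s \in `[-1, 1] -> convex_body (Cs s),
      Cs 0 = C,
      forall s, s \in `[-1, 1] -> boundary_plus C o `<=` boundary (Cs s) &
      forall s, s \in `[-1, 1] -> forall A : set (borel_sphere R), measurable A ->
        (surface_measure (Cs s) A = surface_measure C A
           + s%:E * (surface_measure (Cs 1%R) A - surface_measure C A))%E].

Definition signed_measure (R : realType) : Type :=
  {charge set (borel_sphere R) -> \bar R}.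

(* A library charge is a function on all sets, with arbitrary values outside the
   sigma-algebra; two charges are the same signed measure when they agree on
   Borel sets. *)
Definition is_charge_of (R : realType) (f : set (borel_sphere R) -> \bar R)
    (m : signed_measure R) : Prop :=
  forall A, measurable A -> m A = f A.

Definition subspace_of_charges (R : realType) (V : set (signed_measure R)) :
    Prop :=
  [/\ V (czero : {charge set (borel_sphere R) -> \bar R}),
      forall m1 m2 : signed_measure R, V m1 -> V m2 ->
        V (cadd m1 m2 : {charge set (borel_sphere R) -> \bar R}) &
      forall (a : R) (m : signed_measure R), V m ->
        V (cscale a m : {charge set (borel_sphere R) -> \bar R})].

Definition finite_dimensional (R : realType) (V : set (signed_measure R)) :
    Prop :=
  exists (n : nat) (b : 'I_n -> signed_measure R),
    (forall i, V (b i)) /\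
    forall m, V m -> exists a : 'I_n -> R,
      is_charge_of (fun A => \sum_(i < n) ((a i)%:E * b i A))%E m.

(* Main.v *)
Require Import Defs.
From HB Require Import structures.
From mathcomp Require Import all_boot all_order all_algebra.
From mathcomp Require Import all_classical all_reals all_analysis.
From mathcomp Require Import ring lra.

Set Implicit Arguments.
Unset Strict Implicit.
Unset Printing Implicit Defensive.

Import Order.TTheory GRing.Theory Num.Theory.
Import numFieldNormedType.Exports.

Local Open Scope classical_set_scope.
Local Open Scope ring_scope.

(* Let r parametrize a small strictly convex cap of the boundary contained in
   its visible part, with normal field N, and let t(x) be the height at which
   the tangent plane at r x meets the normal line through the centre xi0 of the
   cap.  For a profile b supported near t = 0 put k = sqrt(1 + b) - 1 and let G be
   the primitive of -t k' vanishing near the rim.  The map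
   R_b x = r x + k(t) (r x - xi0) + G(t) N(x0) has dR_b . N = 0, because
   r x - xi0 - t N(x0) is tangent at r x: the tangent planes keep their
   directions, and the Jacobian of R_b relative to r is
   1 + b(t) + b'(t) w / 2, which is affine in b.  For small b, replacing the cap
   by the image of R_b gives a convex body, with the same Gauss map, whose surface
   measure is therefore affine in b; the family is C(s) = C_{s b}.  The
   differences of surface measures form the image of a linear map on profiles,
   and profiles that are constant on disjoint small disks show that its rank is
   infinite. *)

(** * Two-dimensional Hausdorff measure *)

(** The square root in k comes from the Jacobian. Relative to dr, the differential of R_b is 1 + k
    times the identity plus a rank-one map, k' dt tensored with the tangent vector r x - xi0 - t
    N(x0). Its determinant is (1 + k)^2 + (1 + k) k' w, where w is dt applied to that vector; with
    (1 + k)^2 = 1 + b the second term is b' w / 2.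

    Surface measures are Hausdorff measures, so a relation between Jacobians must become a relation
    between Hausdorff areas. Only linear relations between areas of patches over one domain are
    needed. Each patch is compared locally with a linear image of the plane; translation-invariant
    measures of the plane are proportional, so the normalisation of the measure cancels and only
    ratios of determinants remain.

    Convexity is not obtained by gluing. The new body is an intersection of half-spaces: those
    tangent to the moved patch and those supporting C away from it. A gap between the two families,
    found by compactness, keeps every moved point and every far boundary point on the new
    boundary. *)

Section euclidean.
Context {R : realType} {n : nat}.
Implicit Types u v w : 'rV[R]_n.

Lemma dotpC u v : dotp u v = dotp v u.
Proof. by rewrite /dotp; apply: eq_bigr => i _; rewrite mulrC. Qed.

Lemma dotpDl u v w : dotp (u + v) w = dotp u w + dotp v w.
Proof. by rewrite /dotp -big_split; apply: eq_bigr => i _; rewrite mxE mulrDl. Qed.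

Lemma dotpZl a u v : dotp (a *: u) v = a * dotp u v.
Proof. by rewrite /dotp mulr_sumr; apply: eq_bigr => i _; rewrite mxE mulrA. Qed.

Lemma dotpNl u v : dotp (- u) v = - dotp u v.
Proof. by rewrite -scaleN1r dotpZl mulN1r. Qed.

Lemma dotpBl u v w : dotp (u - v) w = dotp u w - dotp v w.
Proof. by rewrite dotpDl dotpNl. Qed.

Lemma dotpDr u v w : dotp w (u + v) = dotp w u + dotp w v.
Proof. by rewrite ![dotp w _]dotpC dotpDl. Qed.

Lemma dotpZr a u v : dotp u (a *: v) = a * dotp u v.
Proof. by rewrite dotpC dotpZl dotpC. Qed.

Lemma dotpNr u v : dotp u (- v) = - dotp u v.
Proof. by rewrite dotpC dotpNl dotpC. Qed.

Lemma dotpBr u v w : dotp w (u - v) = dotp w u - dotp w v.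
Proof. by rewrite dotpDr dotpNr. Qed.

Lemma dotp0l u : dotp 0 u = 0.
Proof. by rewrite -(scale0r 0) dotpZl mul0r. Qed.

Lemma dotp0r u : dotp u 0 = 0.
Proof. by rewrite dotpC dotp0l. Qed.

Lemma dotpp_ge0 u : 0 <= dotp u u.
Proof. by apply: sumr_ge0 => i _; rewrite -expr2 sqr_ge0. Qed.

Lemma enorm_ge0 u : 0 <= enorm u.
Proof. exact: sqrtr_ge0. Qed.

Lemma enorm_sqr u : enorm u ^+ 2 = dotp u u.
Proof. by rewrite sqr_sqrtr ?dotpp_ge0. Qed.

Lemma coord_le_enorm u i : `|u 0 i| <= enorm u.
Proof.
rewrite -sqrtr_sqr ler_sqrt ?dotpp_ge0// /dotp (bigD1 i)//= expr2 lerDl.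
by apply: sumr_ge0 => j _; rewrite -expr2 sqr_ge0.
Qed.

Lemma enorm_eq0 u : (enorm u == 0) = (u == 0).
Proof.
apply/eqP/eqP => [u0|->]; last by rewrite /enorm dotp0l sqrtr0.
apply/rowP => i; rewrite mxE; apply/eqP; rewrite -normr_le0 -u0.
exact: coord_le_enorm.
Qed.

Lemma enorm0 : enorm (0 : 'rV[R]_n) = 0.
Proof. by apply/eqP; rewrite enorm_eq0. Qed.

Lemma enorm_gt0 u : (0 < enorm u) = (u != 0).
Proof. by rewrite lt_neqAle enorm_ge0 andbT eq_sym enorm_eq0. Qed.

Lemma dotpp_eq0 u : (dotp u u == 0) = (u == 0).
Proof. by rewrite -enorm_sqr sqrf_eq0 enorm_eq0. Qed.

Lemma enormZ a u : enorm (a *: u) = `|a| * enorm u.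
Proof.
by rewrite /enorm dotpZl dotpZr mulrA -expr2 sqrtrM ?sqr_ge0// sqrtr_sqr.
Qed.

Lemma enormN u : enorm (- u) = enorm u.
Proof. by rewrite -scaleN1r enormZ normrN1 mul1r. Qed.

Lemma enormBC u v : enorm (u - v) = enorm (v - u).
Proof. by rewrite -enormN opprB. Qed.

Lemma dotp_le u v : dotp u v <= enorm u * enorm v.
Proof.
have [->|u0] := eqVneq u 0; first by rewrite dotp0l enorm0 mul0r.
(* The vector is [enorm u ^+ 2] times the component of v orthogonal to u; its nonnegative square
   norm is the Cauchy-Schwarz inequality. *)
have := dotpp_ge0 ((enorm u) ^+ 2 *: v - dotp u v *: u).
rewrite dotpBl !dotpBr !dotpZl !dotpZr -!enorm_sqr (dotpC v u).
set a := enorm u; set b := enorm v; set c := dotp u v => h.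
have a0 : 0 < a by rewrite enorm_gt0.
have b0 : 0 <= b by exact: enorm_ge0.
have {}h : 0 <= a ^+ 2 * (a ^+ 2 * b ^+ 2 - c ^+ 2) by nra.
rewrite pmulr_rge0 ?exprn_gt0// subr_ge0 -exprMn in h.
rewrite (le_trans (ler_norm _))// -ler_sqr ?nnegrE ?mulr_ge0// ?(ltW a0)//.
by rewrite real_normK ?num_real.
Qed.

Lemma dotp_abs u v : `|dotp u v| <= enorm u * enorm v.
Proof. by rewrite ler_norml dotp_le lerNl -dotpNl -(enormN u) dotp_le. Qed.

Lemma enormD u v : enorm (u + v) <= enorm u + enorm v.
Proof.
rewrite -ler_sqr ?nnegrE ?addr_ge0 ?enorm_ge0// enorm_sqr dotpDl !dotpDr.
rewrite -!enorm_sqr (dotpC v u); have := dotp_le u v; nra.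
Qed.

Lemma enormB u v : enorm (u - v) <= enorm u + enorm v.
Proof. by rewrite -(enormN v) enormD. Qed.

End euclidean.

Lemma norm_le_enorm {R : realType} n (u : 'rV[R]_n) : `|u| <= enorm u.
Proof.
rewrite [leLHS]/Num.norm/= mx_normrE; apply: bigmax_le => [|[i j] _ /=].
  exact: enorm_ge0.
by rewrite ord1 coord_le_enorm.
Qed.

Lemma coord_le_norm {R : realType} n (u : 'rV[R]_n) i : `|u 0 i| <= `|u|.
Proof.
rewrite [leRHS]/Num.norm/= mx_normrE.
exact: (le_bigmax _ (fun i => `|u i.1 i.2|) (0, i)).
Qed.

Lemma norm_rV_le {R : realType} n (u : 'rV[R]_n) e :
  0 <= e -> (forall i, `|u 0 i| <= e) -> `|u| <= e.
Proof.
move=> e0 ue; rewrite [leLHS]/Num.norm/= mx_normrE; apply: bigmax_le => //= -[i j] _ /=.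
by rewrite ord1.
Qed.

Lemma enorm_le_norm {R : realType} n (u : 'rV[R]_n) : enorm u <= n%:R * `|u|.
Proof.
rewrite -ler_sqr ?nnegrE ?mulr_ge0 ?enorm_ge0// enorm_sqr.
apply: (@le_trans _ _ (\sum_(i < n) `|u| ^+ 2)).
  apply: ler_sum => i _; rewrite -expr2 -real_normK ?num_real//.
  by rewrite lerXn2r ?nnegrE// coord_le_norm.
rewrite sumr_const card_ord exprMn -[leLHS]mulr_natl ler_wpM2r ?sqr_ge0//.
by case: n u => [|n] u; rewrite ?expr2 ?mul0r// ler_peMl ?ler0n// ler1n.
Qed.

Section hausdorff_outer.
Context {R : realType}.
Local Notation V := 'rV[R]_3.
Local Open Scope ereal_scope.

Lemma ediam_ge0 (A : set V) : 0 <= ediam A.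
Proof. by apply: ereal_sup_ubound; left. Qed.

Lemma ediam0 : ediam (set0 : set V) = 0.
Proof.
apply/eqP; rewrite eq_le ediam_ge0 andbT; apply: ge_ereal_sup => z [->//|].
by move=> [x [y [[]]]].
Qed.

Lemma le_ediam (A B : set V) : A `<=` B -> ediam A <= ediam B.
Proof.
move=> AB; apply: ge_ereal_sup => z [->|[x [y [Ax Ay ->]]]]; first exact: ediam_ge0.
by apply: ereal_sup_ubound; right; exists x, y; split => //; exact: AB.
Qed.

Lemma ediam_ge (A : set V) x y : A x -> A y -> (enorm (x - y))%:E <= ediam A.
Proof. by move=> Ax Ay; apply: ereal_sup_ubound; right; exists x, y. Qed.

Lemma ediam_le (A : set V) d : (0 <= d)%R ->
  (forall x y, A x -> A y -> enorm (x - y) <= d)%R -> ediam A <= d%:E.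
Proof.
move=> d0 h; apply: ge_ereal_sup => z [->|[x [y [Ax Ay ->]]]]; rewrite ?lee_fin//.
exact: h.
Qed.

(** The value +oo on sets of large diameter turns the constrained covers of [hausdorff2_pre] into
    arbitrary covers, as in the construction of an outer measure. *)
Let mass (delta : R) (A : set (g_sigma_algebraType [set: set V])) : \bar R :=
  if ediam A <= delta%:E then (pi / 4)%:E * ediam A ^+ 2 else +oo.

Let pi4_ge0 : 0 <= (pi / 4 : R)%:E.
Proof. by rewrite lee_fin divr_ge0// pi_ge0. Qed.

Let mass_ge0 delta A : 0 <= mass delta A.
Proof.
by rewrite /mass; case: ifP => // _; rewrite mule_ge0// expe_ge0// ediam_ge0.
Qed.

Let mass0 delta : (0 < delta)%R -> mass delta set0 = 0.
Proof. by move=> d0; rewrite /mass ediam0 lee_fin ltW// expe2 !mule0. Qed.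

(* Declaring every set measurable makes the library's outer measure
   construction range over covers by arbitrary sets. *)
Let hausdorff2_preE delta A : hausdorff2_pre delta A = mu_ext (mass delta) A.
Proof.
apply/eqP; rewrite eq_le; apply/andP; split; apply: le_ereal_inf_tmp => z.
- move=> [F [_ AF] <-]; have [[i Fi]|] := pselect (exists i, ~ ediam (F i) <= delta%:E).
    rewrite (eseries_pinfty _ _ (_ : mass delta (F i) = +oo)) ?leey//.
      by move=> n _; rewrite -ltNye (lt_le_trans _ (mass_ge0 _ _)).
    by rewrite /mass; case: ifP.
  move=> /forallNP h; apply: ereal_inf_lbound; exists F; split => //.
    by move=> i; apply: contrapT; exact: h.
  by apply: eq_eseriesr => i _; rewrite /mass; case: ifP => // /negP; have := h i.
- move=> [F [AF Fd ->]]; apply: ereal_inf_lbound; exists F.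
    by split => // i; exact: sub_sigma_algebra.
  by apply: eq_eseriesr => i _; rewrite /mass Fd.
Qed.

Lemma hausdorff2_pre_ge0 delta (A : set V) : 0 <= hausdorff2_pre delta A.
Proof. by rewrite hausdorff2_preE; apply: mu_ext_ge0. Qed.

Lemma hausdorff2_preS delta (A B : set V) : A `<=` B ->
  hausdorff2_pre delta A <= hausdorff2_pre delta B.
Proof. by rewrite !hausdorff2_preE => AB; exact: le_mu_ext. Qed.

Lemma hausdorff2_pre_le (delta : R) (A : set V) : (0 < delta)%R ->
  hausdorff2_pre delta A <= hausdorff2 A.
Proof. by move=> d0; apply: ereal_sup_ubound; exists delta. Qed.

Let hausdorff20 : hausdorff2 (set0 : set V) = 0.
Proof.
apply/eqP; rewrite eq_le; apply/andP; split.
  apply: ge_ereal_sup => _ [d /= d0 <-]; rewrite hausdorff2_preE mu_ext0//.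
  exact: mass0.
by rewrite (le_trans _ (hausdorff2_pre_le _ ltr01))// hausdorff2_pre_ge0.
Qed.

Let hausdorff2_ge0 (A : set V) : 0 <= hausdorff2 A.
Proof. by rewrite (le_trans _ (hausdorff2_pre_le _ ltr01))// hausdorff2_pre_ge0. Qed.

Let le_hausdorff2 : {homo (@hausdorff2 R) : A B / A `<=` B >-> A <= B}.
Proof.
move=> A B AB; apply: ge_ereal_sup => _ [d /= d0 <-].
by rewrite (le_trans _ (hausdorff2_pre_le _ d0))// hausdorff2_preS.
Qed.

Let hausdorff2_sigma_subadditive : sigma_subadditive (@hausdorff2 R).
Proof.
move=> F; apply: ge_ereal_sup => _ [d /= d0 <-]; rewrite hausdorff2_preE.
apply: (@le_trans _ _ (\sum_(i <oo) mu_ext (mass d) (F i))).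
  by apply: mu_ext_sigma_subadditive => //; exact: mass0.
apply: lee_nneseries => [i _ _|i _]; first by apply: mu_ext_ge0; exact: mass_ge0.
by rewrite -hausdorff2_preE hausdorff2_pre_le.
Qed.

HB.instance Definition _ := isOuterMeasure.Build R V (@hausdorff2 R)
  hausdorff20 hausdorff2_ge0 le_hausdorff2 hausdorff2_sigma_subadditive.

(* The relation between f and g makes g o f^-1 an L-Lipschitz map. *)
Lemma hausdorff2_lipschitz T (f g : T -> V) (E : set T) (L : R) : (0 < L)%R ->
  (forall x y, E x -> E y -> enorm (g x - g y) <= L * enorm (f x - f y))%R ->
  hausdorff2 (g @` E) <= (L ^+ 2)%:E * hausdorff2 (f @` E).
Proof.
move=> L0 gf; apply: ge_ereal_sup => _ [d /= d0 <-].
have d1 : (0 < d / L)%R by rewrite divr_gt0.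
have L2 : (0 < L ^+ 2)%R by rewrite exprn_gt0.
apply: (@le_trans _ _ ((L ^+ 2)%:E * hausdorff2_pre (d / L) (f @` E)));
  last by rewrite lee_pmul2l ?lte_fin// hausdorff2_pre_le.
rewrite -lee_pdivrMl//; apply: le_ereal_inf_tmp => _ [F [FE Fd ->]].
rewrite lee_pdivrMl// -nneseriesZl//; last first.
  by move=> i _; rewrite mule_ge0 ?expe_ge0 ?ediam_ge0.
pose G i := g @` (E `&` f @^-1` F i).
have GF i : ediam (G i) <= L%:E * ediam (F i).
  apply: ge_ereal_sup => _ [->|[_ [_ [[x [Ex Fx] <-] [y [Ey Fy] <-] ->]]]].
    by rewrite mule_ge0 ?ediam_ge0// lee_fin ltW.
  apply: (@le_trans _ _ (L * enorm (f x - f y))%:E); first by rewrite lee_fin gf.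
  by rewrite EFinM lee_pmul2l ?lte_fin// ediam_ge.
apply: (@le_trans _ _ (\sum_(0 <= i <oo) ((pi / 4)%:E * ediam (G i) ^+ 2))).
  apply: ereal_inf_lbound; exists G; split => //.
    move=> _ [x Ex <-]; have [i _ Fi] := FE (f x) (ex_intro2 _ _ x Ex erefl).
    by exists i => //; exists x.
  move=> i; rewrite (le_trans (GF i))// (le_trans (lee_wpmul2l _ (Fd i)))//.
    by rewrite lee_fin ltW.
  by rewrite -EFinM mulrCA mulfV ?gt_eqF// mulr1.
apply: lee_nneseries => [i _|i _].
  by rewrite mule_ge0 ?expe_ge0 ?ediam_ge0.
rewrite [leRHS]muleCA; apply: lee_wpmul2l => //.
have -> : (L ^+ 2)%:E * ediam (F i) ^+ 2 = (L%:E * ediam (F i)) ^+ 2.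
  by rewrite !expe2 expr2 EFinM muleACA.
by rewrite !expe2 lee_pmul ?ediam_ge0.
Qed.

Lemma hausdorff2_isometry T (f g : T -> V) (E : set T) :
  (forall x y, E x -> E y -> enorm (g x - g y) = enorm (f x - f y)) ->
  hausdorff2 (g @` E) = hausdorff2 (f @` E).
Proof.
move=> fg; apply/eqP; rewrite eq_le -[X in _ <= X]mul1e -[X in _ && (_ <= X)]mul1e.
by rewrite -(expr1n R 2) !hausdorff2_lipschitz// => x y Ex Ey; rewrite mul1r fg.
Qed.

Lemma hausdorff2_translate (a : V) (E : set V) :
  hausdorff2 [set (a + x)%R | x in E] = hausdorff2 E.
Proof.
rewrite -[in RHS](image_id E); apply: hausdorff2_isometry => x y _ _.
by rewrite opprD addrACA subrr add0r.
Qed.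

(* A cover by sets of diameter less than d splits into covers of A and of B. *)
Lemma hausdorff2_sep (A B : set V) (d : R) : (0 < d)%R ->
  (forall x y, A x -> B y -> d <= enorm (x - y))%R ->
  hausdorff2 A + hausdorff2 B <= hausdorff2 (A `|` B).
Proof.
move=> d0 AB.
have key e : (0 < e)%R -> (e < d)%R ->
    hausdorff2_pre e A + hausdorff2_pre e B <= hausdorff2_pre e (A `|` B).
  move=> e0 ed; apply: le_ereal_inf_tmp => _ [F [FE Fd ->]].
  pose G (C : set V) i := if pselect (exists x, C x /\ F i x) then F i else set0.
  have GF C i : G C i `<=` F i by rewrite /G; case: pselect => /= _ x.
  have GC C : C `<=` A `|` B -> hausdorff2_pre e C <=
      \sum_(0 <= i <oo) ((pi / 4)%:E * ediam (G C i) ^+ 2).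
    move=> CAB; apply: ereal_inf_lbound; exists (G C); split => //.
      move=> x Cx; have [i _ Fi] := FE _ (CAB _ Cx).
      by exists i => //; rewrite /G; case: pselect => // -[]; exists x.
    by move=> i; rewrite (le_trans _ (Fd i))// le_ediam.
  have le0 (X : set V) : 0 <= (pi / 4)%:E * ediam X ^+ 2.
    by rewrite mule_ge0 ?expe_ge0 ?ediam_ge0.
  rewrite (le_trans (leeD (GC A _) (GC B _)))//.
  rewrite -nneseriesD//; apply: lee_nneseries => [i _ _|i _]; first exact: adde_ge0.
  have m0 : (pi / 4)%:E * ediam (set0 : set V) ^+ 2 = 0.
    by rewrite ediam0 expe2 mule0 mule0.
  have GE C : (exists x, C x /\ F i x) \/ G C i = set0.
    by rewrite /G; case: pselect => /= [h|h]; [left|right].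
  have leG C : (pi / 4)%:E * ediam (G C i) ^+ 2 <= (pi / 4)%:E * ediam (F i) ^+ 2.
    by apply: lee_wpmul2l => //; rewrite !expe2 lee_pmul ?ediam_ge0 ?le_ediam.
  have [[x [Ax Fx]]|->] := GE A; last by rewrite m0 add0e.
  have [[y [By Fy]]|->] := GE B; last by rewrite m0 adde0.
  have := le_trans (ediam_ge Fx Fy) (Fd i); rewrite lee_fin leNgt.
  by rewrite (lt_le_trans ed)// AB.
have dd : (0 < d / 2)%R by rewrite divr_gt0.
have mon (e1 e2 : R) (X : set V) : (0 < e1)%R -> (e1 <= e2)%R ->
    hausdorff2_pre e2 X <= hausdorff2_pre e1 X.
  move=> e10 e12; apply: le_ereal_inf_tmp => _ [F [FE Fd ->]].
  apply: ereal_inf_lbound; exists F; split => // i.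
  by rewrite (le_trans (Fd i))// lee_fin.
have [oo|] := pselect (hausdorff2 (A `|` B) = +oo); first by rewrite oo leey.
move=> /eqP; rewrite -ltey => ABoo.
have fin (X : set V) : X `<=` A `|` B -> hausdorff2 X \is a fin_num.
  move=> XAB; rewrite ge0_fin_numE ?outer_measure_ge0//.
  exact: le_lt_trans (le_outer_measure _ _ _ XAB) ABoo.
have Bfin : hausdorff2 B \is a fin_num by apply: fin => x; right.
rewrite -leeBrDr ?Bfin//; apply: ge_ereal_sup => _ [e1 /= e10 <-].
rewrite leeBrDr ?Bfin// addeC -leeBrDr; last first.
  rewrite ge0_fin_numE ?hausdorff2_pre_ge0// (le_lt_trans (hausdorff2_pre_le _ e10))//.
  rewrite (le_lt_trans _ ABoo)// le_outer_measure//; exact: subsetUl.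
apply: ge_ereal_sup => _ [e2 /= e20 <-].
rewrite leeBrDr; last first.
  rewrite ge0_fin_numE ?hausdorff2_pre_ge0// (le_lt_trans (hausdorff2_pre_le _ e10))//.
  rewrite (le_lt_trans _ ABoo)// le_outer_measure//; exact: subsetUl.
(* A scale finer than both e1 and e2, and below d so that [key] applies. *)
pose e := Num.min (Num.min e1 e2) (d / 2)%R.
have e0 : (0 < e)%R by rewrite !lt_min e10 e20 dd.
rewrite addeC (le_trans _ (hausdorff2_pre_le (A `|` B) e0))//.
rewrite (le_trans _ (key e e0 _))//; last first.
  by rewrite (@le_lt_trans _ _ (d / 2)%R) ?ge_min ?lexx ?orbT//; lra.
by rewrite leeD// mon// !ge_min lexx ?orbT.
Qed.

End hausdorff_outer.

(** * Borel sets are measurable for the Hausdorff measure *)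

Section borel_caratheodory.
Context {R : realType}.
Local Notation V := 'rV[R]_3.
Local Notation H := (@hausdorff2 R).
Local Open Scope ereal_scope.

Let slab (f : V -> R) (X : set V) k :=
  X `&` [set x | k.+2%:R^-1 <= f x < k.+1%:R^-1]%R.

(** Slabs of the same parity are separated, because f is 1-Lipschitz and a whole slab lies between
    two of them; hence their measures add up by [hausdorff2_sep]. The number [p] selects the
    parity. *)
Let slab_sum (f : V -> R) (X : set V) p N :
  (forall x y, f x - f y <= enorm (x - y))%R ->
  \sum_(k < N) H (slab f X (k.*2 + p).+1) <=
    H (X `&` [set x | (N.*2 + p).+1%:R^-1 <= f x]%R).
Proof.
move=> f1; elim: N => [|N IH]; first by rewrite big_ord0 outer_measure_ge0.
rewrite big_ord_recr/=; apply: (le_trans (leeD IH (lexx _))).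
have ltV (m n : nat) : (m < n)%N -> (n.+1%:R^-1 < m.+1%:R^-1 :> R)%R.
  by move=> mn; rewrite ltf_pV2 ?posrE// ltr_nat ltnS.
rewrite (le_trans (@hausdorff2_sep _ _ _
    ((N.*2 + p).+1%:R^-1 - (N.*2 + p).+2%:R^-1)%R _ _))//.
- by rewrite subr_gt0 ltV.
- move=> x y [_ /= fx] [_ /= /andP[_ fy]]; by apply: le_trans (f1 x y); apply: lerB => //; exact: ltW.
- apply: le_outer_measure => x [[Xx /= fx]|[Xx /= /andP[fx _]]]; split => //=.
    by apply: le_trans fx; rewrite ltW// ltV// doubleS !addSn ltnS leqW.
Qed.

Let slab_cover (f : V -> R) (X : set V) N :
  X `&` [set x | 0 < f x]%R `<=`
  (X `&` [set x | N.+2%:R^-1 <= f x]%R) `|`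
  \bigcup_(k in ~` `I_N) slab f X k.+1.
Proof.
move=> x [Xx /= fx]; have [fN|fN] := leP (N.+2%:R^-1)%R (f x); first by left.
right; have /ex_minnP[m] : exists m, (m.+1%:R^-1 <= f x)%R.
  exists (Num.truncn (f x)^-1); rewrite invf_ple ?posrE//.
  by rewrite ltW// truncnS_gt.
move=> fm mmin; have Nm : (N.+1 < m)%N.
  rewrite ltnNge; apply/negP => mN; have := le_lt_trans fm fN.
  by rewrite ltNge lef_pV2 ?posrE// ler_nat ltnS mN.
case: m => [//|[//|m]] in fm mmin Nm *; exists m => /=.
  by apply/negP; rewrite -leqNgt -ltnS -ltnS.
split => //=; rewrite fm /= ltNge; apply/negP => /mmin.
by rewrite ltnn.
Qed.

Let sum_double (E : nat -> \bar R) N : \sum_(0 <= k < N.*2) E k =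
  \sum_(k < N) E (k.*2 + 0)%N + \sum_(k < N) E (k.*2 + 1)%N.
Proof.
elim: N => [|n IHn]; first by rewrite big_geq// !big_ord0 adde0.
by rewrite doubleS !big_nat_recr//= !big_ord_recr/= addn0 addn1 addeACA IHn addeA.
Qed.

(** The classical argument for metric outer measures. The slabs of each parity have total mass at
    most [H X], so the series of all slabs converges and its tails are small. A tail bounds the part
    of the region f > 0 that is close to the set f <= 0; the rest is at distance at least
    [N.+2%:R^-1] from that set, where additivity is known. *)
Lemma caratheodory_le (f : V -> R) :
  (forall x y, f x - f y <= enorm (x - y))%R ->
  H.-caratheodory [set x | f x <= 0]%R.
Proof.
move=> f1; apply: le_caratheodory_measurable => X.
have -> : X `&` ~` [set x | f x <= 0]%R = X `&` [set x | 0 < f x]%R.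
  by congr (_ `&` _); apply/seteqP; split => x /=; rewrite ltNge => /negP.
rewrite -[leLHS]/(H _ + H _) -[leRHS]/(H X).
have [->|/eqP] := pselect (H X = +oo); first exact: leey.
rewrite -ltey => Xoo.
pose E k := H (slab f X k.+1).
have E0 k : 0 <= E k by exact: outer_measure_ge0.
have sumE N : \sum_(0 <= k < N.*2) E k <= H X + H X.
  elim: N (slab_sum X 0 N f1) (slab_sum X 1 N f1) => [|N _] S0 S1.
    by rewrite big_geq// adde_ge0// outer_measure_ge0.
  rewrite sum_double; apply: leeD; [apply: (le_trans S0)|apply: (le_trans S1)];
    by apply: le_outer_measure => x [].
have sumEoo : \sum_(0 <= k <oo) E k < +oo.
  apply: (@le_lt_trans _ _ (H X + H X)); last by rewrite lte_add_pinfty.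
  apply: lime_le; first exact: is_cvg_nneseries.
  near=> n; apply: le_trans (sumE n).
  by apply: lee_sum_nneg_natr => //; rewrite -addnn leq_addr.
have tail := nneseries_tail_cvg sumEoo (fun k _ => E0 k).
apply/lee_addgt0Pr => e e0.
have /fine_cvgP[] := tail; move/fine_cvgP: tail => [tfin tcvg] _ _.
have [N [Nfin Ne]] : exists N, \sum_(N <= k <oo) E k \is a fin_num /\
    (`|fine (\sum_(N <= k <oo) E k)| < e)%R.
  have /cvgrPdist_lt/(_ _ e0) := tcvg => te.
  near \oo => N; exists N; split; first by near: N.
  by rewrite -normrN -[X in `|X|%R]add0r; near: N.
have EN : \sum_(N <= k <oo) E k <= e%:E.
  by rewrite -(fineK Nfin) lee_fin ltW// (le_lt_trans (ler_norm _)).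
rewrite (le_trans (leeD (lexx _) (le_outer_measure H _ _ (@slab_cover f X N))))//.
rewrite (le_trans (leeD (lexx _) (outer_measureU2 _ _ _)))//.
rewrite addeA leeD//; last first.
  by rewrite (le_trans _ EN)// outer_measure_sigma_subadditive_tail.
rewrite (le_trans (@hausdorff2_sep _ _ _ (N.+2%:R^-1)%R _ _))//.
  move=> x y [_ /= fx] [_ /= fy]; rewrite enormBC; apply: le_trans (f1 y x).
  by rewrite -[leLHS]subr0 lerB.
by apply: le_outer_measure => x [[]|[]].
Unshelve. all: by end_near. Qed.

End borel_caratheodory.

Section half_spaces.
Context {R : realType} {n : nat}.
Local Notation V := 'rV[R]_n.

Definition half_spaces : set (set V) :=
  [set A | exists i c, A = [set x : V | x 0 i <= c]].

(** Boxes with rational centre and half-width the inverse of a positive integer form a countable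
    family, and an open set is the union of those that it contains. *)
Lemma open_half_spaces (U : set V) : open U -> <<s half_spaces >> U.
Proof.
move=> oU; pose T := g_sigma_algebraType half_spaces.
pose box (q : {ffun 'I_n -> rat} * nat) : set V :=
  [set x | forall i, ratr (q.1 i) - q.2.+1%:R^-1 < x 0 i <= ratr (q.1 i) + q.2.+1%:R^-1].
have mle i c : measurable ([set x : V | x 0 i <= c] : set T).
  by apply: sub_sigma_algebra; exists i, c.
have mbox q : measurable (box q : set T).
  have -> : box q = \bigcap_(i : 'I_n) ([set x : V | x 0 i <= ratr (q.1 i) + q.2.+1%:R^-1]
      `\` [set x : V | x 0 i <= ratr (q.1 i) - q.2.+1%:R^-1]).
    apply/seteqP; split => x /=.
      by move=> h i _; have /andP[h1 h2] := h i; split => //=; apply/negP; rewrite -ltNge.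
    by move=> h i; have [/= -> /negP] := h i I; rewrite -ltNge => ->.
  by apply: (@fin_bigcap_measurable _ T) => // i _; apply: measurableD; exact: mle.
have -> : U = \bigcup_q (if pselect (box q `<=` U) then box q else set0).
  apply/seteqP; split => [x Ux|x [q _]]; last by case: pselect => //= qU /qU.
  have /nbhs_ballP[e /= e0 xe] := open_nbhs_nbhs (conj oU Ux).
  have [N] : exists N : nat, N.+1%:R^-1 < e / 2.
    by exists (Num.truncn (2 / e)); rewrite invf_plt ?posrE ?divr_gt0// invf_div truncnS_gt.
  have : 0 < N.+1%:R^-1 :> R by rewrite invr_gt0.
  pose w : R := N.+1%:R^-1; rewrite -/w => w0 we.
  have /choice[q qx] : forall i : 'I_n, exists q : rat,
      x 0 i - w < ratr q < x 0 i + w.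
    move=> i; have [|q qx] := @rat_in_itvoo R (x 0 i - w) (x 0 i + w).
      by rewrite ltrBlDr -addrA ltrDl addr_gt0.
    by exists q; rewrite in_itv in qx.
  exists (finfun q, N) => //; case: pselect => [_|[]] /=.
    by move=> i /=; rewrite ffunE -/w; have := qx i; move: w0; clear; lra.
  move=> y /= yb; apply: xe; rewrite -ball_normE /=.
  apply: (@le_lt_trans _ _ (2 * w)); last by move: we; clear; lra.
  apply: norm_rV_le => [|i]; first by move: w0; clear; lra.
  rewrite !mxE; have := yb i; rewrite ffunE -/w; have := qx i.
  by rewrite ler_norml; clear; lra.
apply: (@countable_bigcupT_measurable _ T) => [|q]; first exact: countableP.
by case: pselect => //= _; exact: (@measurable0 _ T).
Qed.

Lemma closed_le_coord i c : closed [set x : V | x 0 i <= c].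
Proof.
apply: (@closed_comp _ _ (fun x : V => x 0 i) [set y | y <= c]) => [x _|].
  exact: coord_continuous.
exact: closed_le.
Qed.

Lemma borel_half_spaces : <<s @open V >> = <<s half_spaces >>.
Proof.
apply/seteqP; split; apply: smallest_sub; try exact: smallest_sigma_algebra.
  by move=> U; exact: open_half_spaces.
move=> _ [i [c ->]]; rewrite -[X in <<s _ >> X]setCK.
apply: (@measurableC _ (g_sigma_algebraType (@open V))).
by apply: sub_sigma_algebra; exact/closed_openC/closed_le_coord.
Qed.

End half_spaces.

(** A coordinate is 1-Lipschitz for the Euclidean norm, so [caratheodory_le] applies to the
    coordinate half-spaces, which generate the Borel sets. *)
Lemma borel_caratheodory {R : realType} (A : set 'rV[R]_3) :
  <<s @open 'rV[R]_3 >> A -> (@hausdorff2 R).-caratheodory A.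
Proof.
rewrite borel_half_spaces; move: A; apply: smallest_sub.
  exact: (@sigma_algebra_measurable _ (caratheodory_type (@hausdorff2 R))).
move=> _ [i [c ->]].
have -> : [set x : 'rV[R]_3 | x 0 i <= c] = [set x | x 0 i - c <= 0].
  by apply/seteqP; split => x /=; rewrite subr_le0.
apply: caratheodory_le => x y; rewrite (le_trans _ (coord_le_enorm _ i))//.
by rewrite !mxE (le_trans _ (ler_norm _))//; lra.
Qed.

(** * Area measures of injective parametrizations *)

Section borel_images.
Context {R : realType}.
Local Notation U := 'rV[R]_2.
Local Notation V := 'rV[R]_3.
Implicit Types (f : U -> V) (P : set U).

Definition surface_map f P :=
  [/\ closed P, {within P, continuous f} & {in P &, injective f}].

(** The image of a closed part of P is a countable union of compact sets. Injectivity makes the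
    image commute with complements in P, so the property passes from closed sets to the generated
    sigma-algebra. *)
Lemma surface_map_image f P (E : set U) : surface_map f P ->
  <<s @open U >> E -> <<s @open V >> (f @` (E `&` P)).
Proof.
move=> [cP cf injf].
pose TV := g_sigma_algebraType (@open V).
have closedV (A : set V) : closed A -> <<s @open V >> A.
  move=> cA; rewrite -[X in <<s _ >> X]setCK; apply: (@measurableC _ TV).
  by apply: sub_sigma_algebra; exact: closed_openC.
have closedU (A : set U) : closed A -> <<s @open V >> (f @` (A `&` P)).
  move=> cA; have -> : f @` (A `&` P) = \bigcup_k f @` (A `&` P `&` [set x | `|x| <= k%:R]).
    rewrite -image_bigcup; congr (_ @` _); apply/seteqP; split => [x Ax|x [k _ []]//].
    exists (Num.truncn `|x|).+1 => //; split => //=.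
    by rewrite ltW// truncnS_gt.
  apply: (@bigcup_measurable _ TV) => k _; apply: closedV.
  apply: compact_closed; first exact: norm_hausdorff.
  apply: continuous_compact.
    by apply: continuous_subspaceW cf => x [[]].
  apply: bounded_closed_compact.
    exists k%:R; split => // x kx y [_ /= yk].
    by rewrite (le_trans yk)// ltW.
  apply: closedI; first exact: closedI.
  apply: (@closed_comp _ _ (fun x : U => `|x|) [set y | y <= k%:R]) => [x _|].
    exact: norm_continuous.
  exact: closed_le.
move: E; apply: smallest_sub => /=; last first.
  move=> E oE; have -> : f @` (E `&` P) = f @` (setT `&` P) `\` f @` (~` E `&` P).
    rewrite setTI; apply/seteqP; split => [_ [x [Ex Px] <-]|_ [[x Px <-] nEx]].
      split; first by exists x.
      by move=> [y [nEy Py]] /injf; rewrite !inE => /(_ Py Px) yx; rewrite yx in nEy.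
    exists x => //; split => //; apply: contrapT => nE; apply: nEx.
    by exists x.
  by apply: (@measurableD _ TV); apply: closedU => //; exact: open_closedC.
split => [|A mA|F mF].
- by rewrite set0I image_set0; exact: (@measurable0 _ TV).
- have -> : f @` ((setT `\` A) `&` P) = f @` (setT `&` P) `\` f @` (A `&` P).
    rewrite !setTI setTD; apply/seteqP; split => [_ [x [Ax Px] <-]|_ [[x Px <-] nAx]].
      split; first by exists x.
      by move=> [y [Ay Py]] /injf; rewrite !inE => /(_ Py Px) yx; rewrite yx in Ay.
    by exists x => //; split => // Ax; apply: nAx; exists x.
  by apply: (@measurableD _ TV) => //; apply: closedU; exact: closedT.
- rewrite setI_bigcupl image_bigcup.
  by apply: (@bigcup_measurable _ TV) => k _; exact: mF.
Qed.

(** The proof [fP] is an argument so that the measure structure declared below can be attached to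
    [area fP]: additivity rests on the injectivity and the Borel images that it provides. *)
Definition area f P (fP : surface_map f P) (E : set (g_sigma_algebraType (@open U))) :
  \bar R := hausdorff2 (f @` (E `&` P)).

Section area_measure.
Variables (f : U -> V) (P : set U) (fP : surface_map f P).
Local Open Scope ereal_scope.

Let area0 : area fP set0 = 0.
Proof. by rewrite /area set0I image_set0 outer_measure0. Qed.

Let area_ge0 E : 0 <= area fP E.
Proof. exact: outer_measure_ge0. Qed.

Let area_sigma_additive : semi_sigma_additive (area fP).
Proof.
move=> F mF tF mUF; rewrite /area setI_bigcupl image_bigcup.
have mfF i : (@hausdorff2 R).-caratheodory (f @` (F i `&` P)).
  by apply: borel_caratheodory; exact: (surface_map_image fP (mF i)).
apply: (@caratheodory_measure_sigma_additive _ _ (@hausdorff2 R)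
  (fun i => f @` (F i `&` P))) => //; last first.
  by apply: (@bigcupT_measurable _ (caratheodory_type (@hausdorff2 R))); exact: mfF.
move=> i j _ _ [_ [[x [Fx Px] <-] [y [Fy Py]]]].
case: fP => _ _ /(_ y x); rewrite !inE => /(_ Py Px) /[apply] yx.
by apply: tF => //; exists x; split => //; rewrite -yx.
Qed.

HB.instance Definition _ := isMeasure.Build _ _ _ (area fP)
  area0 area_ge0 area_sigma_additive.

End area_measure.

End borel_images.

(** * Translation-invariant Borel measures on the plane *)

Section plane_measure.
Context {R : realType}.
Local Notation U := 'rV[R]_2.
Local Notation BU := (g_sigma_algebraType (@open U)).

(** Half-open, so that cutting a box gives a disjoint union of boxes. *)
Definition box (a b c d : R) : set U :=
  [set x | a < x 0 0 <= b /\ c < x 0 1 <= d].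

Local Notation unit_box := (box 0 1 0 1).

Lemma measurable_box a b c d : measurable (box a b c d : set BU).
Proof.
rewrite /measurable/= borel_half_spaces.
pose T := g_sigma_algebraType (@half_spaces R 2).
have mle i e : measurable ([set x : U | x 0 i <= e] : set T).
  by apply: sub_sigma_algebra; exists i, e.
have -> : box a b c d = ([set x : U | x 0 0 <= b] `\` [set x : U | x 0 0 <= a]) `&`
    ([set x : U | x 0 1 <= d] `\` [set x : U | x 0 1 <= c]).
  apply/seteqP; split => x /=.
    by move=> [/andP[? ?] /andP[? ?]]; split; split => //; apply/negP; rewrite -ltNge.
  move=> [[xb /negP xa] [xd /negP xc]]; rewrite -!ltNge in xa xc.
  by rewrite /box /= xa xb xc xd.
by apply: (@measurableI _ T); apply: (@measurableD _ T); exact: mle.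
Qed.

Definition boxes : set (set U) :=
  [set A | exists a b c d, A = box a b c d].

Lemma centered_box (x : U) : exists k : nat, box (- k%:R) k%:R (- k%:R) k%:R x.
Proof.
exists (Num.truncn (`|x 0 0| + `|x 0 1|)).+1; rewrite /box /=.
have := truncnS_gt (`|x 0 0| + `|x 0 1|); move: (_.+1%:R) => w h.
have := ler_norm (x 0 0); have := ler_norm (x 0 1).
have := ler_norm (- x 0 0); have := ler_norm (- x 0 1); rewrite !normrN.
have := normr_ge0 (x 0 0); have := normr_ge0 (x 0 1); lra.
Qed.

Lemma borel_boxes : <<s @open U >> = <<s boxes >>.
Proof.
apply/seteqP; split; last first.
  apply: smallest_sub; first exact: smallest_sigma_algebra.
  by move=> _ [a [b [c [d ->]]]]; exact: measurable_box.
rewrite borel_half_spaces; apply: smallest_sub; first exact: smallest_sigma_algebra.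
pose T := g_sigma_algebraType boxes.
move=> _ [i [c ->]].
have [i0|i1] : i = 0 \/ i = 1.
  by case: i => -[|[|//]] ?; [left|right]; exact: val_inj.
- have -> : [set x : U | x 0 i <= c] = \bigcup_k box (- k%:R) c (- k%:R) k%:R.
    apply/seteqP; split => [x /= xc|x [k _] [/andP[_ +]]]; last by rewrite i0.
    have [k [/andP[h1 h2] h3]] := centered_box x.
    by exists k => //; split => //; rewrite h1 -i0.
  by apply: (@bigcup_measurable _ T) => k _; apply: sub_sigma_algebra; do 4 eexists.
- have -> : [set x : U | x 0 i <= c] = \bigcup_k box (- k%:R) k%:R (- k%:R) c.
    apply/seteqP; split => [x /= xc|x [k _] [_ /andP[_ +]]]; last by rewrite i1.
    have [k [h3 /andP[h1 h2]]] := centered_box x.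
    by exists k => //; split => //; rewrite h1 -i1.
  by apply: (@bigcup_measurable _ T) => k _; apply: sub_sigma_algebra; do 4 eexists.
Qed.

Lemma boxI a b c d a' b' c' d' : box a b c d `&` box a' b' c' d' =
  box (Num.max a a') (Num.min b b') (Num.max c c') (Num.min d d').
Proof.
apply/seteqP; split => x; rewrite /box /= !gt_max !le_min.
  by move=> [[/andP[-> ->] /andP[-> ->]] [/andP[-> ->] /andP[-> ->]]].
by move=> [/andP[/andP[-> ->] /andP[-> ->]] /andP[/andP[-> ->] /andP[-> ->]]].
Qed.

Lemma box_splitl (a b c d e : R) : (a <= e)%R -> (e <= b)%R ->
  box a b c d = box a e c d `|` box e b c d.
Proof.
move=> ae eb; apply/seteqP; split => x; rewrite /box /=.
  move=> [/andP[ax xb] ->]; case: (leP (x 0 0) e) => xe; first by left; rewrite ax.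
  by right; rewrite xb.
move=> [[/andP[ax xe] ->]|[/andP[ex xb] ->]]; split => //.
  by rewrite ax (le_trans xe).
by rewrite xb (le_lt_trans ae).
Qed.

Lemma box_splitr (a b c d e : R) : (c <= e)%R -> (e <= d)%R ->
  box a b c d = box a b c e `|` box a b e d.
Proof.
move=> ce ed; apply/seteqP; split => x; rewrite /box /=.
  move=> [-> /andP[cx xd]]; case: (leP (x 0 1) e) => xe; first by left; rewrite cx.
  by right; rewrite xd.
move=> [[-> /andP[cx xe]]|[-> /andP[ex xd]]]; split => //.
  by rewrite cx (le_trans xe).
by rewrite xd (le_lt_trans ce).
Qed.

Definition vec2 (a b : R) : U := \row_i (if i == 0 then a else b).

Lemma box_shift (a b c d u v : R) :
  box (u + a) (u + b) (v + c) (v + d) = [set (vec2 u v + x)%R | x in box a b c d].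
Proof.
apply/seteqP; split => [x [/andP[h1 h2] /andP[h3 h4]]|_ [x [/andP[h1 h2] /andP[h3 h4]] <-]].
  exists (x - vec2 u v)%R; last by rewrite addrC subrK.
  by rewrite /box /= !mxE /=; split; apply/andP; split; lra.
by rewrite /box /= !mxE /=; split; apply/andP; split; lra.
Qed.

Local Open Scope ereal_scope.

(** Cauchy's functional equation. Nonnegativity makes phi monotone; enclosing (n + 1) x between
    consecutive integers bounds (n + 1) times the defect at x by phi 1, for every n, so the defect
    vanishes. *)
Lemma additive_ge0_linear (phi : R -> \bar R) :
  (forall x, 0 <= phi x) ->
  (forall x y : R, (0 <= x)%R -> (0 <= y)%R -> phi (x + y)%R = phi x + phi y) ->
  phi 1%R < +oo ->
  forall x : R, (0 <= x)%R -> phi x = x%:E * phi 1%R.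
Proof.
move=> p0 pD p1 x x0.
have pM (n : nat) (y : R) : (0 <= y)%R -> phi (n.+1%:R * y)%R = n.+1%:R%:E * phi y.
  move=> y0; elim: n => [|n IH]; first by rewrite mul1r mul1e.
  rewrite -natr1 mulrDl mul1r pD ?IH ?mulr_ge0//.
  by rewrite EFinD ge0_muleDl ?lee_fin// mul1e.
have mono (y z : R) : (0 <= y)%R -> (y <= z)%R -> phi y <= phi z.
  move=> y0 yz; rewrite -(subrK y z) pD ?subr_ge0//; exact: leeDr.
have fin y : (0 <= y)%R -> phi y \is a fin_num.
  move=> y0; rewrite ge0_fin_numE//.
  apply: (@le_lt_trans _ _ (phi ((Num.truncn y).+1%:R * 1)%R)).
    by apply: mono => //; rewrite mulr1 ltW// truncnS_gt.
  by rewrite pM// lte_mul_pinfty// lee_fin.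
have f1 : phi 1%R \is a fin_num by exact: fin.
pose psi y := fine (phi y).
have psiE y : (0 <= y)%R -> phi y = (psi y)%:E by move=> /fin/fineK.
have psi0 y : (0 <= psi y)%R by rewrite fine_ge0.
rewrite !psiE// -EFinM; congr (_%:E).
have psiM n y : (0 <= y)%R -> psi (n.+1%:R * y)%R = (n.+1%:R * psi y)%R.
  move=> y0; have := pM n y y0; rewrite !psiE ?mulr_ge0// -EFinM.
  by move=> [].
have psi_mono (y z : R) : (0 <= y)%R -> (y <= z)%R -> (psi y <= psi z)%R.
  by move=> y0 yz; have := mono _ _ y0 yz; rewrite !psiE ?lee_fin// (le_trans y0).
have psi_0 : psi 0%R = 0%R.
  by have := psiM 1%N _ (lexx 0%R); rewrite mulr0; move: (psi 0%R); clear => ?; lra.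
have bound (n : nat) : (n.+1%:R * `|psi x - x * psi 1| <= psi 1)%R.
  pose k := Num.truncn (n.+1%:R * x).
  have nx0 : (0 <= n.+1%:R * x)%R by rewrite mulr_ge0.
  have /andP[k1 k2] : (k%:R <= n.+1%:R * x < k.+1%:R)%R by exact: truncn_itv.
  have h1 : (k%:R * psi 1 <= n.+1%:R * psi x)%R.
    rewrite -psiM//; move: k1; case: k {k2} => [|k] k1; first by rewrite mul0r.
    by rewrite -psiM// mulr1 psi_mono.
  have h2 : (n.+1%:R * psi x <= k.+1%:R * psi 1)%R.
    by rewrite -!psiM// mulr1 psi_mono// ltW.
  rewrite -[X in (X * _)%R]ger0_norm// -normrM mulrBr mulrA.
  have := psi0 1%R; move: k1 k2 h1 h2; rewrite -[k.+1%:R%R]natr1.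
  move: (n.+1%:R * x)%R (n.+1%:R * psi x)%R (k%:R : R)%R (psi 1)%R; clear.
  by move=> a b c p h1 h2 h3 h4 p0; rewrite ler_norml; apply/andP; split; nra.
apply/eqP; rewrite -subr_eq0 -normr_le0 leNgt; apply/negP => d0.
have := bound (Num.truncn (psi 1 / `|psi x - x * psi 1|))%R.
by rewrite leNgt -ltr_pdivrMr// truncnS_gt.
Qed.

Definition shift_invariant (m : set U -> \bar R) :=
  forall (a : U) E, <<s @open U >> E -> m [set (a + x)%R | x in E] = m E.

Section uniqueness.
Variable m : {measure set BU -> \bar R}.
Hypothesis mS : shift_invariant m.
Hypothesis moo : m unit_box < +oo.

Let mD (A B : set BU) : measurable A -> measurable B -> A `&` B = set0 ->
  m (A `|` B) = m A + m B.
Proof. by move=> mA mB AB; rewrite measureU. Qed.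

Let m_shift (a b c d u v : R) : m (box (u + a) (u + b) (v + c) (v + d)) = m (box a b c d).
Proof. by rewrite box_shift mS//; exact: measurable_box. Qed.

Lemma measure_boxE (a b c d : R) : (a <= b)%R -> (c <= d)%R ->
  m (box a b c d) = ((b - a) * (d - c))%:E * m unit_box.
Proof.
move=> ab cd.
have addl h (x y : R) : (0 <= x)%R -> (0 <= y)%R ->
    m (box 0 (x + y) 0 h) = m (box 0 x 0 h) + m (box 0 y 0 h).
  move=> x0 y0; rewrite (@box_splitl _ _ _ _ x) ?lerDl//.
  rewrite mD; [|exact: measurable_box..|]; last first.
    apply/seteqP; split => // z [[/andP[_ h1] _] [/andP[h2 _] _]].
    by move: h1; rewrite leNgt h2.
  by congr (_ + _); rewrite -(m_shift 0 y 0 h x 0) !addr0 add0r.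
have addr (x y : R) : (0 <= x)%R -> (0 <= y)%R ->
    m (box 0 1 0 (x + y)) = m (box 0 1 0 x) + m (box 0 1 0 y).
  move=> x0 y0; rewrite (@box_splitr _ _ _ _ x) ?lerDl//.
  rewrite mD; [|exact: measurable_box..|]; last first.
    apply/seteqP; split => // z [[_ /andP[_ h1]] [_ /andP[h2 _]]].
    by move: h1; rewrite leNgt h2.
  by congr (_ + _); rewrite -(m_shift 0 1 0 y 0 x) !addr0 add0r.
have hr (h : R) : (0 <= h)%R -> m (box 0 1 0 h) = h%:E * m unit_box.
  by move=> h0; rewrite (additive_ge0_linear (phi := fun h => m (box 0 1 0 h))).
have -> : m (box a b c d) = m (box 0 (b - a) 0 (d - c)).
  by rewrite -(m_shift 0 (b - a) 0 (d - c) a c) !addr0 ![(_ + (_ - _))%R]addrC !subrK.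
rewrite (additive_ge0_linear (phi := fun l => m (box 0 l 0 (d - c)))) ?subr_ge0//.
- by rewrite hr ?subr_ge0// muleA -EFinM.
- by move=> x y; exact: addl.
- by rewrite hr ?subr_ge0// lte_mul_pinfty// lee_fin subr_ge0.
Qed.

End uniqueness.

(** Uniqueness of Haar measure, written as a product so that no mass has to be inverted. Each
    measure is multiplied by the mass that the other gives to the unit box; the two results agree on
    boxes, which are stable under intersection and generate the Borel sets. *)
Lemma shift_invariant_unique (m1 m2 : {measure set BU -> \bar R}) E :
  shift_invariant m1 -> shift_invariant m2 ->
  m1 unit_box < +oo -> m2 unit_box < +oo -> <<s @open U >> E ->
  m2 unit_box * m1 E = m1 unit_box * m2 E.
Proof.
move=> s1 s2 f1 f2 mE.
have fin (m : {measure set BU -> \bar R}) : m unit_box < +oo -> m unit_box \is a fin_num.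
  by move=> mf; rewrite ge0_fin_numE.
have c0 (m : {measure set BU -> \bar R}) : (0 <= fine (m unit_box))%R by rewrite fine_ge0.
rewrite -(fineK (fin _ f1)) -(fineK (fin _ f2)).
have n1 := c0 m1; have n2 := c0 m2.
set c1 := fine (m1 unit_box) in n1 *; set c2 := fine (m2 unit_box) in n2 *.
pose M1 : {measure set BU -> \bar R} := mscale (NngNum n2) m1.
pose M2 : {measure set BU -> \bar R} := mscale (NngNum n1) m2.
rewrite -[LHS]/(M1 E) -[RHS]/(M2 E).
have e1 : m1 unit_box = c1%:E by rewrite fineK ?fin.
have e2 : m2 unit_box = c2%:E by rewrite fineK ?fin.
apply: (@measure_unique _ _ BU boxes (fun k => box (- k%:R) k%:R (- k%:R) k%:R)) => //.
- by rewrite /measurable/= borel_boxes.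
- move=> _ _ [a [b [c [d ->]]]] [a' [b' [c' [d' ->]]]]; rewrite boxI; do 4 eexists.
  by [].
- by move=> k; do 4 eexists.
- by apply/seteqP; split => // x _; have [k xk] := centered_box x; exists k.
- move=> _ [a [b [c [d ->]]]]; rewrite /M1 /M2 /= /mscale /=.
  have [ab|ba] := leP a b; last first.
    have -> : box a b c d = set0 by apply/seteqP; split => // x [/andP[]]; lra.
    by rewrite !measure0 !mule0.
  have [cd|dc] := leP c d; last first.
    have -> : box a b c d = set0 by apply/seteqP; split => // x [_ /andP[]]; lra.
    by rewrite !measure0 !mule0.
  rewrite (measure_boxE s1 f1 ab cd) (measure_boxE s2 f2 ab cd) e1 e2 -!EFinM.
  by rewrite mulrCA (mulrC c2) [in RHS]mulrCA.
- move=> k; rewrite /M1 /= /mscale /= measure_boxE//; last 2 first.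
  + by rewrite (@le_trans _ _ 0%R) ?oppr_le0.
  + by rewrite (@le_trans _ _ 0%R) ?oppr_le0.
  by rewrite e1 -!EFinM ltry.
Qed.

End plane_measure.

(** * Finiteness and positivity of areas *)

Section area_bounds.
Context {R : realType}.
Local Notation U := 'rV[R]_2.
Local Notation V := 'rV[R]_3.
Local Open Scope ereal_scope.

Definition unit_square : set U :=
  [set x : U | (0 <= x ord0 ord0 <= 1 /\ 0 <= x ord0 1%R <= 1)%R].

(** A grid of step 1 / N is carried to sets of diameter at most L / N. There are (N + 1)^2 of them
    and N >= 1, whence the factor 4. *)
Lemma area_finite (f : U -> V) (L : R) : (0 <= L)%R ->
  (forall x y, unit_square x -> unit_square y -> enorm (f x - f y) <= L * `|x - y|)%R ->
  hausdorff2 (f @` unit_square) < +oo.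
Proof.
move=> L0 fL.
apply: (@le_lt_trans _ _ (pi / 4 * (4 * L ^+ 2))%:E); last exact: ltry.
apply: ge_ereal_sup => _ [d /= d0 <-].
have [n nd] : exists n : nat, (L / n.+1%:R <= d)%R.
  exists (Num.truncn (L / d)); rewrite ler_pdivrMr// mulrC -ler_pdivrMr//.
  by rewrite ltW// truncnS_gt.
set N := n.+1 in nd.
have N0 : (0 < N%:R :> R)%R by [].
(* A coordinate equal to 1 has index N, so there are [N.+1] indices in each direction; quotient and
   remainder by [N.+1] decode the pair. *)
pose cell k : set U := unit_square `&`
  [set x : U | Num.truncn (N%:R * x ord0 ord0)%R = (k %/ N.+1)%N /\
        Num.truncn (N%:R * x ord0 1)%R = (k %% N.+1)%N].
pose F k := if (k < N.+1 * N.+1)%N then f @` cell k else set0.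
have near_trunc (a b : R) : (0 <= a)%R -> (0 <= b)%R ->
    Num.truncn (N%:R * a)%R = Num.truncn (N%:R * b)%R -> (`|a - b| <= N%:R^-1)%R.
  move=> a0 b0 ab.
  have /andP[a1 a2] := truncn_itv (mulr_ge0 (ltW N0) a0).
  have /andP[b1 b2] := truncn_itv (mulr_ge0 (ltW N0) b0).
  rewrite ab in a1 a2; rewrite -(@ler_pM2l _ N%:R)// mulfV ?gt_eqF//.
  rewrite -[X in (X * _)%R]ger0_norm ?ltW// -normrM mulrBr.
  move: a1 a2 b1 b2; rewrite -[_.+1%:R%R]natr1; move: (N%:R * a)%R (N%:R * b)%R; clear.
  move=> x y; move: (_%:R)%R => z h1 h2 h3 h4.
  by rewrite ltr_norml; lra.
have Fd k : ediam (F k) <= (L / N%:R)%:E.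
  rewrite /F; case: ifP => _; last by rewrite ediam0 lee_fin divr_ge0// ltW.
  apply: ediam_le; first by rewrite divr_ge0// ltW.
  move=> _ _ [x [Sx [x0 x1]] <-] [y [Sy [y0 y1]] <-].
  apply: (le_trans (fL _ _ Sx Sy)); rewrite ler_wpM2l//.
  have [/andP[sx0 _] /andP[sx1 _]] := Sx; have [/andP[sy0 _] /andP[sy1 _]] := Sy.
  apply: norm_rV_le => [|i]; first by rewrite invr_ge0 ltW.
  rewrite !mxE; have [->|->] : i = ord0 \/ i = 1%R.
    by case: i => -[|[|//]] ?; [left|right]; exact: val_inj.
    by apply: near_trunc => //; rewrite x0 y0.
  by apply: near_trunc => //; rewrite x1 y1.
have term0 k : 0 <= (pi / 4)%:E * ediam (F k) ^+ 2.
  by rewrite mule_ge0 ?expe_ge0 ?ediam_ge0// lee_fin divr_ge0// pi_ge0.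
apply: (@le_trans _ _ (\sum_(0 <= i <oo) ((pi / 4)%:E * ediam (F i) ^+ 2))).
  apply: ereal_inf_lbound; exists F; split => //.
    move=> _ [x Sx <-].
    have bnd i : (0 <= x ord0 i <= 1)%R -> (Num.truncn (N%:R * x ord0 i)%R < N.+1)%N.
      move=> /andP[x0 x1]; rewrite ltnS -(@ler_nat R).
      apply: (@le_trans _ _ (N%:R * x ord0 i)%R); last by rewrite ler_piMr// ltW.
      by rewrite truncn_le// mulr_ge0// ltW.
    have [Sx0 Sx1] := Sx; have b0 := bnd _ Sx0; have b1 := bnd _ Sx1.
    exists (Num.truncn (N%:R * x ord0 ord0)%R * N.+1 + Num.truncn (N%:R * x ord0 1)%R)%N => //.
    rewrite /F ifT.
      by exists x => //; split => //=; rewrite divnMDl// modnMDl divn_small// modn_small// addn0.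
    rewrite (@leq_trans ((Num.truncn (N%:R * x ord0 ord0)%R).+1 * N.+1))%N//.
      by rewrite mulSn addnC ltn_add2r.
    by rewrite leq_mul2r b0 orbT.
  by move=> k; rewrite (le_trans (Fd k))// lee_fin.
have Foo k : (N.+1 * N.+1 <= k)%N -> F k = set0.
  by move=> Nk; rewrite /F ltnNge Nk.
have := @nneseries_split _ (fun i => (pi / 4)%:E * ediam (F i) ^+ 2) 0 (N.+1 * N.+1) (fun k _ => term0 k).
rewrite add0n => ->.
rewrite [X in _ + X]eseries0 ?adde0; last first.
  by move=> k kN _; rewrite Foo// ediam0 expe2 !mule0.
apply: (@le_trans _ _ (\sum_(0 <= k < N.+1 * N.+1) (pi / 4 * (L / N%:R) ^+ 2)%:E)).
  apply: lee_sum => k _; rewrite [leRHS]EFinM; apply: lee_wpmul2l.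
    by rewrite lee_fin divr_ge0// pi_ge0.
  by rewrite expe2 expr2 EFinM lee_pmul// ?ediam_ge0.
rewrite sumEFin sumr_const_nat subn0 lee_fin -mulrnAr.
apply: ler_wpM2l; first by rewrite divr_ge0// pi_ge0.
rewrite -mulr_natl expr_div_n mulrCA natrM -expr2 [leRHS]mulrC ler_wpM2l ?sqr_ge0//.
rewrite -expr_div_n (_ : 4 = 2 ^+ 2)%R; last by rewrite -natrX.
rewrite lerXn2r ?nnegrE ?divr_ge0//.
by rewrite ler_pdivrMr// -natrM ler_nat mul2n -addnn -addn1 leq_add2l.
Qed.

(** A comparison with Lebesgue measure. A set of diameter d_i in a cover of the image pulls back
    into a square of side 2 d_i / b, since ['rV_2] carries the sup norm. These squares cover the
    unit box, so the sum of 4 d_i^2 / b^2 is at least 1. *)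
Lemma area_positive (f : U -> V) (b : R) : (0 < b)%R ->
  (forall x y, box 0 1 0 1 x -> box 0 1 0 1 y -> b * `|x - y| <= enorm (f x - f y))%R ->
  0 < hausdorff2 (f @` box 0 1 0 1).
Proof.
move=> b0 fb.
apply: (@lt_le_trans _ _ (pi / 4 * (b ^+ 2 / 4))%:E).
  by rewrite lte_fin mulr_gt0// divr_gt0 ?pi_gt0// exprn_gt0.
apply: (le_trans _ (hausdorff2_pre_le _ ltr01)).
apply: le_ereal_inf_tmp => _ [F [FE Fd ->]].
have Ffin i : ediam (F i) = (fine (ediam (F i)))%:E.
  rewrite fineK// ge0_fin_numE ?ediam_ge0//; exact: le_lt_trans (Fd i) (ltry _).
pose d i := fine (ediam (F i)).
have d0 i : (0 <= d i)%R by rewrite fine_ge0// ediam_ge0.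
pose mu := (@lebesgue_measure R \x @lebesgue_measure R)%E.
have /choice[p pP] : forall i, exists p : U, forall x,
    box 0 1 0 1 x -> F i (f x) -> (`|x - p| <= d i / b)%R.
  move=> i; have [[p [Qp Fp]]|/forallNP h] := pselect (exists p, box 0 1 0 1 p /\ F i (f p)).
    exists p => x Qx Fx; rewrite ler_pdivlMr// mulrC.
    apply: (le_trans (fb _ _ Qx Qp)); have := ediam_ge Fx Fp.
    by rewrite Ffin lee_fin.
  by exists 0%R => x Qx Fx; case: (h x).
pose I i := [set` `[p i ord0 ord0 - d i / b, p i ord0 ord0 + d i / b]%R].
pose J i := [set` `[p i ord0 1 - d i / b, p i ord0 1 + d i / b]%R].
have Ilen i : lebesgue_measure (I i) = (2 * (d i / b))%:E.
  rewrite /I lebesgue_measure_itv/= lte_fin; have := divr_ge0 (d0 i) (ltW b0).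
  move: (d i / b)%R => e e0; case: ltP => h; first by rewrite -EFinB; congr (_%:E); lra.
  by congr (_%:E); lra.
have Jlen i : lebesgue_measure (J i) = (2 * (d i / b))%:E.
  rewrite /J lebesgue_measure_itv/= lte_fin; have := divr_ge0 (d0 i) (ltW b0).
  move: (d i / b)%R => e e0; case: ltP => h; first by rewrite -EFinB; congr (_%:E); lra.
  by congr (_%:E); lra.
have cover : [set` `]0%R, 1%R]] `*` [set` `]0%R, 1%R]] `<=` \bigcup_i (I i `*` J i).
  move=> [x y] [/= ]; rewrite !in_itv /= => x01 y01.
  have Qx : box 0 1 0 1 (vec2 x y) by rewrite /box /= !mxE.
  have [i _ Fi] := FE (f (vec2 x y)) (ex_intro2 _ _ _ Qx erefl).
  exists i => //; have := pP i _ Qx Fi => h.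
  have := le_trans (coord_le_norm _ 0%R) h; have := le_trans (coord_le_norm _ 1%R) h.
  rewrite !mxE /= !ler_norml /I /J /= !in_itv /= => /andP[h1 h2] /andP[h3 h4].
  by split; apply/andP; split; lra.
have meas i : measurable (I i `*` J i) by apply: measurableX; exact: measurable_itv.
have mS : measurable ([set` `]0%R, 1%R]] : set R) by exact: measurable_itv.
have muS : mu ([set` `]0%R, 1%R]] `*` [set` `]0%R, 1%R]]) = 1.
  rewrite /mu product_measure1E//= !lebesgue_measure_itv/= lte_fin ltr01.
  by rewrite -EFinB subr0 mule1.
have muI i : mu (I i `*` J i) = (2 * (d i / b))%:E * (2 * (d i / b))%:E.
  by rewrite /mu product_measure1E/= ?Ilen ?Jlen//; exact: measurable_itv.
have := @measure_sigma_subadditive _ _ _ mu _ (fun i => I i `*` J i) meas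
  (measurableX mS mS) cover.
rewrite [X in X <= _ -> _]muS => h.
have {}h : 1 <= \sum_(0 <= i <oo) ((4 / b ^+ 2)%:E * (ediam (F i) ^+ 2)).
  apply: (le_trans h); apply: lee_nneseries => [i _ _|i _]; first exact: measure_ge0.
  rewrite [leLHS]muI Ffin expe2 -!EFinM lee_fin le_eqVlt; apply/orP; left; apply/eqP.
  by rewrite -/(d i); move: (d i) => di; field; rewrite gt_eqF.
have e0 i : 0 <= ediam (F i) ^+ 2 by rewrite expe_ge0 ?ediam_ge0.
rewrite nneseriesZl// in h; rewrite nneseriesZl//.
rewrite EFinM lee_pmul2l ?lte_fin ?divr_gt0 ?pi_gt0//.
rewrite -lee_pdivrMl ?divr_gt0 ?exprn_gt0// in h.
by rewrite mule1 invf_div in h.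
Qed.

End area_bounds.

Lemma lipschitz_within {R : realType} (S T : normedModType R) (f : S -> T) (K : R)
    (P : set S) : 0 < K ->
  (forall x y, P x -> P y -> `|f x - f y| <= K * `|x - y|) ->
  {within P, continuous f}.
Proof.
move=> K0 fK; apply/subspace_continuousP => x Px.
apply/cvgrPdist_lt => e e0; rewrite near_withinE.
apply/nbhs_ballP; exists (e / K); first exact: divr_gt0.
move=> y; rewrite -ball_normE /= => xy Py; apply: (le_lt_trans (fK _ _ Px Py)).
by rewrite mulrC -ltr_pdivlMr.
Qed.

(** * Areas of linear images of the plane *)

Section linear_images.
Context {R : realType}.
Local Notation U := 'rV[R]_2.
Local Notation V := 'rV[R]_3.
Implicit Types (B : 'M[R]_(2, 3)) (M : 'M[R]_2).

Lemma mulmx_bound m n (C : 'M[R]_(m, n)) :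
  exists2 K, 0 < K & forall u : 'rV[R]_m, `|u *m C| <= K * `|u|.
Proof.
exists (1 + \sum_i \sum_j `|C i j|).
  by rewrite ltr_wpDr// sumr_ge0// => i _; rewrite sumr_ge0.
move=> u; apply: norm_rV_le => [|j].
  by rewrite mulr_ge0// addr_ge0// sumr_ge0// => i _; rewrite sumr_ge0.
rewrite mxE (le_trans (ler_norm_sum _ _ _))//.
apply: (@le_trans _ _ (\sum_i `|C i j| * `|u|)).
  by apply: ler_sum => i _; rewrite normrM mulrC ler_wpM2l// coord_le_norm.
rewrite -mulr_suml ler_wpM2r//; apply: (@le_trans _ _ (\sum_i \sum_j `|C i j|)).
  by apply: ler_sum => i _; rewrite (bigD1 j)//= lerDl sumr_ge0.
by rewrite lerDr.
Qed.

Lemma linear_upper B : exists2 K, 0 < K & forall u : U, enorm (u *m B) <= K * `|u|.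
Proof.
have [K K0 h] := mulmx_bound B; exists (3%:R * K); first by rewrite mulr_gt0.
move=> u; rewrite (le_trans (enorm_le_norm _))// -mulrA ler_wpM2l//; exact: h.
Qed.

Lemma linear_lower B : row_free B ->
  exists2 b, 0 < b & forall u : U, b * `|u| <= enorm (u *m B).
Proof.
move=> /row_freeP[C BC]; have [K K0 h] := mulmx_bound C.
exists K^-1; first by rewrite invr_gt0.
move=> u; rewrite mulrC ler_pdivrMr// mulrC.
have := h (u *m B); rewrite -mulmxA BC mulmx1 => /le_trans; apply.
by rewrite ler_wpM2l ?(ltW K0)// norm_le_enorm.
Qed.

Lemma surface_map_linear B : row_free B -> surface_map (fun x : U => x *m B) setT.
Proof.
move=> rB; have [K K0 KB] := linear_upper B; split.
- exact: closedT.
- apply: (lipschitz_within K0) => x y _ _; rewrite -mulmxBl.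
  by rewrite (le_trans (norm_le_enorm _)).
- by move=> x y _ _; exact: (row_free_inj rB).
Qed.

Local Notation H := (@hausdorff2 R).
Local Open Scope ereal_scope.

Definition lin_area B (E : set U) : \bar R := H [set x *m B | x in E].

Lemma lin_area_box_fin B : lin_area B (box 0 1 0 1) < +oo.
Proof.
have [K K0 KB] := linear_upper B.
apply: (@le_lt_trans _ _ (lin_area B unit_square)).
  apply: le_outer_measure => _ [x [/andP[h1 h2] /andP[h3 h4]] <-]; exists x => //.
  by split; rewrite ltW.
apply: (@area_finite _ (fun x : U => x *m B) K); first exact: ltW.
by move=> x y _ _; rewrite -mulmxBl.
Qed.

Lemma lin_area_box_gt0 B : row_free B -> 0 < lin_area B (box 0 1 0 1).
Proof.
move=> rB; have [b b0 bB] := linear_lower rB.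
by apply: (@area_positive _ (fun x : U => x *m B) b) => // x y _ _; rewrite -mulmxBl.
Qed.

Lemma area_linear B (rB : row_free B) :
  (area (surface_map_linear rB) : set U -> _) = lin_area B.
Proof. by apply/funext => F; rewrite /area /lin_area setIT. Qed.

Lemma shift_invariant_lin_area B : shift_invariant (lin_area B).
Proof.
move=> a F _; rewrite /lin_area.
transitivity (H [set (a *m B + y)%R | y in [set x *m B | x in F]]).
  by rewrite !image_comp; congr (H (_ @` _)); apply/funext => x /=; exact: mulmxDl.
exact: hausdorff2_translate.
Qed.

(** As functions of E both areas are translation-invariant measures that are finite on the unit box,
    hence proportional. *)
Lemma lin_area_unique B C E : row_free B -> row_free C -> <<s @open U >> E ->
  lin_area C (box 0 1 0 1) * lin_area B E = lin_area B (box 0 1 0 1) * lin_area C E.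
Proof.
move=> rB rC mE.
have := @shift_invariant_unique _ (area (surface_map_linear rB)) (area (surface_map_linear rC)) E.
rewrite /= !area_linear; apply => //; try exact: shift_invariant_lin_area.
  exact: lin_area_box_fin.
exact: lin_area_box_fin.
Qed.

Lemma lin_area_box B a b : row_free B -> (0 <= a)%R -> (0 <= b)%R ->
  lin_area B (box 0 a 0 b) = (a * b)%:E * lin_area B (box 0 1 0 1).
Proof.
move=> rB a0 b0; have := @measure_boxE _ (area (surface_map_linear rB)).
rewrite /= !area_linear => /(_ (shift_invariant_lin_area B) (lin_area_box_fin B) 0 a 0 b)%R.
by rewrite !subr0; apply.
Qed.

Lemma lin_areaM B M (E : set U) : lin_area (M *m B) E = lin_area B [set x *m M | x in E].
Proof.
rewrite /lin_area image_comp; congr (H (_ @` _)); apply/funext => x /=.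
exact: mulmxA.
Qed.

End linear_images.

Lemma preimage_borel {S : ptopologicalType} {T : topologicalType} (g : S -> T) (D : set S) (E : set T) :
  <<s @open S >> D -> {within D, continuous g} -> <<s @open T >> E ->
  <<s @open S >> (D `&` g @^-1` E).
Proof.
move=> mD cg; pose BS := g_sigma_algebraType (@open S).
move: E; apply: smallest_sub => [|E oE] /=.
  split => [|A mA|F mF].
  - by rewrite preimage_set0 setI0; exact: (@measurable0 _ BS).
  - have -> : D `&` g @^-1` (setT `\` A) = D `\` (D `&` g @^-1` A).
      by apply/seteqP; split => x /=; [move=> [Dx [_ nA]]; split => // -[]|
        move=> [Dx nA]; split => //; split => // Ax; apply: nA].
    by apply: (@measurableD _ BS).
  - rewrite preimage_bigcup setI_bigcupr.
    by apply: (@bigcup_measurable _ BS) => k _; exact: mF.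
have /open_subspaceP[W oW WE] : open ((g : subspace D -> T) @^-1` E).
  by move/continuousP : cg; apply.
rewrite setIC (_ : _ `&` D = W `&` D); last first.
  by rewrite setIC (setIC W); move: WE; rewrite setIC (setIC _ D) => ->.
apply: (@measurableI _ BS) => //; exact: sub_sigma_algebra.
Qed.

Section area_scaling.
Context {R : realType}.
Local Notation U := 'rV[R]_2.
Local Notation Q := (box 0 1 0 1 : set U).

Definition mx2 (p q r s : R) : 'M[R]_2 :=
  \matrix_(i, j) (if i == 0 then if j == 0 then p else q else if j == 0 then r else s).

Lemma rV2P (u v : U) : u 0 0 = v 0 0 -> u 0 1 = v 0 1 -> u = v.
Proof.
move=> h0 h1; apply/rowP => i; have [->//|->//] : i = 0 \/ i = 1.
by case: i => -[|[|//]] ?; [left|right]; exact: val_inj.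
Qed.

Lemma mul_rV_mx2 (u : U) p q r s :
  u *m mx2 p q r s = vec2 (u 0 0 * p + u 0 1 * r) (u 0 0 * q + u 0 1 * s).
Proof.
by apply: rV2P; rewrite !mxE !big_ord_recl big_ord0 addr0 !mxE /=;
  congr (_ + u _ _ * _); exact: val_inj.
Qed.

Lemma mx2M p q r s p' q' r' s' : mx2 p q r s *m mx2 p' q' r' s' =
  mx2 (p * p' + q * r') (p * q' + q * s') (r * p' + s * r') (r * q' + s * s').
Proof.
apply/matrixP => i j; rewrite !mxE !big_ord_recl big_ord0 addr0 !mxE /=.
by case: i j => -[|[|//]] ? [] [|[|//]] ?.
Qed.

Lemma mx2_1 : mx2 1 0 0 1 = 1%:M.
Proof.
by apply/matrixP => i j; rewrite !mxE; case: i j => -[|[|//]] ? [] [|[|//]] ?.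
Qed.

Lemma unit_mx2 p q r s : p * s - q * r != 0 -> mx2 p q r s \in unitmx.
Proof.
move=> d0; pose d := p * s - q * r.
have /mulmx1_unit[] // : mx2 p q r s *m mx2 (s / d) (- q / d) (- r / d) (p / d) = 1%:M.
by rewrite mx2M -mx2_1; congr mx2; rewrite /d; field.
Qed.

Lemma row_free_unit_mul (M : 'M[R]_2) (B : 'M[R]_(2, 3)) :
  M \in unitmx -> row_free B -> row_free (M *m B).
Proof. by move=> uM rB; rewrite /row_free mxrankMfree// mxrank_unit. Qed.

Variables (B : 'M[R]_(2, 3)) (rB : row_free B).
Local Open Scope ereal_scope.

Let scale (M : 'M[R]_2) (c : R) := forall E, <<s @open U >> E ->
  lin_area (M *m B) E = c%:E * lin_area B E.

Let q := fine (lin_area B Q).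

Let q0 : (0 < q)%R.
Proof.
by rewrite fine_gt0// lin_area_box_gt0//= lin_area_box_fin.
Qed.

Let qE : lin_area B Q = q%:E.
Proof. by rewrite fineK// ge0_fin_numE ?outer_measure_ge0// lin_area_box_fin. Qed.

(** The area of [M *m B] is again translation invariant, hence a constant multiple of that of B. The
    constant is multiplicative in M and is computed below on diagonal matrices and on shears. *)
Let scale_ex M : M \in unitmx -> exists2 c, (0 < c)%R & scale M c.
Proof.
move=> uM; have rMB := row_free_unit_mul uM rB.
have fMB := lin_area_box_fin (M *m B).
have g0 := lin_area_box_gt0 rMB.
pose m := fine (lin_area (M *m B) Q).
have mE : lin_area (M *m B) Q = m%:E by rewrite fineK// ge0_fin_numE// ltW.
have m0 : (0 < m)%R by rewrite fine_gt0// g0.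
exists (m / q)%R; first exact: divr_gt0.
move=> E mEE; have := lin_area_unique rMB rB mEE.
rewrite qE mE => h; rewrite EFinM -muleA muleCA -h muleA -EFinM mulVf ?gt_eqF//.
by rewrite mul1e.
Qed.

Let measurable_Q : <<s @open U >> Q.
Proof. exact: measurable_box. Qed.

Let scale_inj M c d : scale M c -> scale M d -> c = d.
Proof.
move=> sc sd; have := sc _ measurable_Q; rewrite sd// qE -!EFinM => -[].
by move=> /(mulIf (negbT (gt_eqF q0))).
Qed.

Let scaleM M N c d : N \in unitmx -> scale M c -> scale N d -> scale (N *m M) (c * d)%R.
Proof.
move=> uN sM sN E mE; rewrite -mulmxA lin_areaM sM; last first.
  have -> : [set x *m N | x in E] = setT `&` (fun x => x *m invmx N) @^-1` E.
    rewrite setTI; apply/seteqP; split => [_ [x Ex <-]|x /= Ex].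
      by rewrite /preimage/= mulmxK.
    by exists (x *m invmx N) => //; rewrite mulmxKV.
  apply: preimage_borel => //; first exact: (@measurableT _ (g_sigma_algebraType (@open U))).
  have [K K0 h] := mulmx_bound (invmx N).
  by apply: (lipschitz_within K0) => x y _ _; rewrite -mulmxBl.
by rewrite -lin_areaM sN// muleA -EFinM.
Qed.

Let scale_diag a b : (0 < a)%R -> (0 < b)%R -> scale (mx2 a 0 0 b) (a * b)%R.
Proof.
move=> a0 b0; have [|c c0 sc] := @scale_ex (mx2 a 0 0 b).
  by apply: unit_mx2; rewrite mulr0 subr0 mulf_neq0// gt_eqF.
suff <- : c = (a * b)%R by [].
have := sc _ measurable_Q; rewrite lin_areaM.
have -> : [set (x : U) *m mx2 a 0 0 b | x in Q] = box 0 a 0 b.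
  apply/seteqP; split => [_ [x [/andP[h1 h2] /andP[h3 h4]] <-]|x [/andP[h1 h2] /andP[h3 h4]]].
    rewrite mul_rV_mx2 /box /= !mxE /= !mulr0 addr0 add0r.
    by rewrite !pmulr_lgt0// h1 h3/= !ler_piMl// ltW.
  exists (vec2 (x ord0 ord0 / a) (x ord0 1 / b))%R.
    by rewrite /box /= !mxE /= !divr_gt0// !ler_pdivrMr// !mul1r.
  rewrite mul_rV_mx2 !mxE /= !mulr0 addr0 add0r !divfK ?gt_eqF//.
  by apply: rV2P; rewrite !mxE.
rewrite lin_area_box ?(ltW a0) ?(ltW b0)// qE -!EFinM => -[].
by move=> /(mulIf (negbT (gt_eqF q0))).
Qed.

(* A shear is conjugate to its square by a diagonal matrix, so its factor c
   satisfies c = c ^+ 2. *)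
Let scale_shear_up t : scale (mx2 1 t 0 1) 1.
Proof.
have uU : mx2 1 t 0 1 \in unitmx by apply: unit_mx2; rewrite mulr0 subr0 mulr1 oner_eq0.
have uD : mx2 2 0 0 1 \in unitmx.
  by apply: unit_mx2; rewrite mulr0 subr0 mulr1 pnatr_eq0.
have [c c0 sc] := scale_ex uU.
have sD := scale_diag (ltr0n R 2) ltr01.
have e : mx2 2 0 0 1 *m mx2 1 t 0 1 = mx2 1 t 0 1 *m (mx2 1 t 0 1 *m mx2 2 0 0 1).
  by rewrite !mx2M; congr mx2; ring.
have s1 := scaleM uD sc sD; rewrite e in s1.
have := scale_inj s1 (scaleM uU (scaleM uU sD sc) sc).
rewrite !mulr1 => h; have c1 : c = 1%R by nra.
by rewrite c1 in sc.
Qed.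

Let scale_shear_low t : scale (mx2 1 0 t 1) 1.
Proof.
have uU : mx2 1 0 t 1 \in unitmx by apply: unit_mx2; rewrite mul0r subr0 mulr1 oner_eq0.
have uD : mx2 1 0 0 2 \in unitmx.
  by apply: unit_mx2; rewrite mulr0 subr0 mul1r pnatr_eq0.
have [c c0 sc] := scale_ex uU.
have sD := scale_diag ltr01 (ltr0n R 2).
have e : mx2 1 0 0 2 *m mx2 1 0 t 1 = mx2 1 0 t 1 *m (mx2 1 0 t 1 *m mx2 1 0 0 2).
  by rewrite !mx2M; congr mx2; ring.
have s1 := scaleM uD sc sD; rewrite e in s1.
have := scale_inj s1 (scaleM uU (scaleM uU sD sc) sc).
rewrite !mul1r => h; have c1 : c = 1%R by nra.
by rewrite c1 in sc.
Qed.

(** Gaussian elimination with pivot a > 0 writes the matrix as a shear, a positive diagonal matrix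
    and a shear, whose factors are 1, the determinant and 1. The area of a unit square is never
    computed. *)
Lemma lin_area_mx2 a b c d (E : set U) : (0 < a)%R -> (0 < a * d - b * c)%R ->
  <<s @open U >> E ->
  lin_area (mx2 a b c d *m B) E = (a * d - b * c)%:E * lin_area B E.
Proof.
move=> a0 D0 mE; set D := (a * d - b * c)%R.
have -> : mx2 a b c d = mx2 1 0 (c / a) 1 *m (mx2 a 0 0 (D / a) *m mx2 1 (b / a) 0 1).
  by rewrite !mx2M; congr mx2; rewrite /D; field; rewrite gt_eqF.
have Da : (0 < D / a)%R by rewrite divr_gt0.
have : scale (mx2 1 0 (c / a) 1 *m (mx2 a 0 0 (D / a) *m mx2 1 (b / a) 0 1))
    (1 * (a * (D / a)) * 1).
  apply: scaleM => //; first by apply: unit_mx2; rewrite mul0r subr0 mulr1 oner_eq0.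
  apply: scaleM => //; last exact: scale_diag.
  by apply: unit_mx2; rewrite mulr0 subr0 mulf_neq0// gt_eqF.
move=> /(_ E mE) ->; congr (_%:E * _).
by rewrite mulr1 mul1r mulrC divfK ?gt_eqF.
Qed.

End area_scaling.

(** * Strict differentiability and area *)

Section strict_derivative.
Context {R : realType}.

(* Strict differentiability: unlike the Frechet derivative it gives local
   Lipschitz bounds, and it follows from continuity of the partials. *)
Definition sdiff (V W : normedModType R) (f : V -> W) (x : V) (l : V -> W) :=
  (exists2 K, 0 < K & forall h, `|l h| <= K * `|h|) /\
  forall e, 0 < e -> \forall p \near (x, x),
    `|f p.1 - f p.2 - l (p.1 - p.2)| <= e * `|p.1 - p.2|.

Lemma near_pair (V : normedModType R) (x : V) (P : V * V -> Prop) :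
  (\forall p \near (x, x), P p) <->
  (exists2 d, 0 < d & forall y z, `|y - x| < d -> `|z - x| < d -> P (y, z)).
Proof.
split => [[[A B] /= [/nbhs_ballP[a /= a0 xA] /nbhs_ballP[b /= b0 xB] AB]]|[d d0 h]].
  exists (Num.min a b); first by rewrite lt_min a0.
  move=> y z; rewrite !lt_min => /andP[ya _] /andP[_ zb].
  apply: (AB (y, z)); split; [apply: xA|apply: xB]; rewrite -ball_normE /= distrC//.
exists (ball x d, ball x d) => /=; first by split; exact: nbhsx_ballx.
by move=> [y z] /= []; rewrite -!ball_normE /= distrC => yd; rewrite distrC; exact: h.
Qed.

Lemma near_both (V : normedModType R) (x : V) (P : V -> Prop) :
  (\forall y \near x, P y) -> \forall p \near (x, x), P p.1 /\ P p.2.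
Proof.
move=> /nbhs_ballP[d /= d0 xP]; apply/near_pair.
by exists d => // y z yd zd; split; apply: xP; rewrite -ball_normE /= distrC.
Qed.

Lemma continuous_near_both (V W : normedModType R) (f : V -> W) (x : V) (e : R) :
  0 < e -> {for x, continuous f} ->
  \forall p \near (x, x), `|f p.1 - f x| < e /\ `|f p.2 - f x| < e.
Proof.
move=> e0 /cvgrPdist_lt/(_ e e0) cf; apply: (near_both (P := fun y => `|f y - f x| < e)).
by near=> y; rewrite distrC; near: y.
Unshelve. all: by end_near. Qed.

Variables (V : normedModType R).

Lemma sdiff_ext (W : normedModType R) (f : V -> W) x l l' :
  sdiff f x l -> l =1 l' -> sdiff f x l'.
Proof. by move=> h /funext <-. Qed.

Lemma sdiff_lipschitz (W : normedModType R) (f : V -> W) x l : sdiff f x l ->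
  exists2 K, 0 < K & \forall p \near (x, x), `|f p.1 - f p.2| <= K * `|p.1 - p.2|.
Proof.
move=> [[K K0 lK] /(_ 1 ltr01) h]; exists (K + 1); first by rewrite addr_gt0.
near=> p; rewrite -(subrK (l (p.1 - p.2)) (f p.1 - f p.2)).
rewrite (le_trans (ler_normD _ _))// mulrDl addrC lerD//.
by near: p.
Unshelve. all: by end_near. Qed.

Lemma sdiff_continuous (W : normedModType R) (f : V -> W) x l : sdiff f x l ->
  {for x, continuous f}.
Proof.
move=> /sdiff_lipschitz[K K0 /near_pair[d d0 h]].
apply/cvgrPdist_lt => e e0; apply/nbhs_ballP.
exists (Num.min d (e / K)); first by rewrite /= lt_min d0 divr_gt0.
move=> y; rewrite -ball_normE /= lt_min => /andP[yd yK].
apply: (@le_lt_trans _ _ (K * `|x - y|)); last by rewrite mulrC -ltr_pdivlMr.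
by apply: (h x y); rewrite ?subrr ?normr0// distrC.
Qed.

Lemma sdiff_near (W : normedModType R) (f g : V -> W) x l :
  (\forall y \near x, f y = g y) -> sdiff f x l -> sdiff g x l.
Proof.
move=> fg [lK h]; split => // e e0.
have fg2 := near_both fg.
near=> p; have [<- <-] : f p.1 = g p.1 /\ f p.2 = g p.2 by near: p.
by near: p; exact: h.
Unshelve. all: by end_near. Qed.

Lemma sdiff_cst (W : normedModType R) (c : W) x : sdiff (fun _ : V => c) x (fun=> 0).
Proof.
split; first by exists 1 => // h; rewrite normr0 mul1r.
by move=> e e0; near=> p; rewrite subrr subr0 normr0 mulr_ge0// ltW.
Unshelve. all: by end_near. Qed.

Lemma sdiffD (W : normedModType R) (f g : V -> W) x lf lg :
  sdiff f x lf -> sdiff g x lg -> sdiff (fun y => f y + g y) x (fun h => lf h + lg h).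
Proof.
move=> [[K K0 lK] hf] [[L L0 lL] hg]; split.
  exists (K + L); first by rewrite addr_gt0.
  by move=> h; rewrite (le_trans (ler_normD _ _))// mulrDl lerD.
move=> e e0; have e2 : 0 < e / 2 by rewrite divr_gt0.
near=> p; rewrite [X in _ <= X](_ : _ = e / 2 * `|p.1 - p.2| + e / 2 * `|p.1 - p.2|);
  last by rewrite -mulrDl -splitr.
rewrite [X in X - (_ + _)](_ : _ = (f p.1 - f p.2) + (g p.1 - g p.2)); last first.
  by rewrite opprD addrACA.
rewrite opprD addrACA.
by rewrite (le_trans (ler_normD _ _))// lerD//; near: p; [exact: hf|exact: hg].
Unshelve. all: by end_near. Qed.

Lemma sdiffM (f g : V -> R) x lf lg : sdiff f x lf -> sdiff g x lg ->
  sdiff (fun y => f y * g y) x (fun h => f x * lg h + lf h * g x).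
Proof.
move=> sf sg; have [[kf kf0 lkf] hf] := sf; have [[kg kg0 lkg] hg] := sg.
split.
  exists (`|f x| * kg + kf * `|g x| + 1); first by rewrite ltr_wpDl// addr_ge0// mulr_ge0// ltW.
  move=> h; rewrite (le_trans (ler_normD _ _))// !normrM.
  have := lkf h; have := lkg h; have := normr_ge0 (f x); have := normr_ge0 (g x).
  have := normr_ge0 h; move: `|f x| `|g x| `|h| `|lf h| `|lg h| => a b c u v c0 b0 a0 h1 h2.
  have := ler_wpM2l a0 h1; have := ler_wpM2r b0 h2; nra.
have [Kf Kf0 Lf] := sdiff_lipschitz sf; have [Kg Kg0 Lg] := sdiff_lipschitz sg.
(* [S] adds up the coefficients of the four error terms of the product; [e1 <= 1] also keeps the
   values of f and g within 1 of those at x. *)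
move=> e e0; pose S := `|f x| + 1 + kg + (`|g x| + 1) + kf.
have S0 : 0 < S.
  by rewrite /S; have := normr_ge0 (f x); have := normr_ge0 (g x); lra.
pose e1 := Num.min 1 (e / S).
have e10 : 0 < e1 by rewrite lt_min ltr01 divr_gt0.
have e11 : e1 <= 1 by rewrite ge_min lexx.
have e1S : e1 * S <= e by rewrite -ler_pdivlMr// ge_min lexx orbT.
have cf := sdiff_continuous sf; have cg := sdiff_continuous sg.
near=> p.
have h1 : `|f p.1 - f p.2 - lf (p.1 - p.2)| <= e1 * `|p.1 - p.2| by near: p; exact: hf.
have h2 : `|g p.1 - g p.2 - lg (p.1 - p.2)| <= e1 * `|p.1 - p.2| by near: p; exact: hg.
have [/ltW h3 _] : `|f p.1 - f x| < e1 /\ `|f p.2 - f x| < e1.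
  by near: p; exact: continuous_near_both.
have [_ /ltW h4] : `|g p.1 - g x| < e1 /\ `|g p.2 - g x| < e1.
  by near: p; exact: continuous_near_both.
set dh := p.1 - p.2 in h1 h2 *.
have -> : f p.1 * g p.1 - f p.2 * g p.2 - (f x * lg dh + lf dh * g x) =
    f p.1 * (g p.1 - g p.2 - lg dh) + (f p.1 - f x) * lg dh +
    ((f p.1 - f p.2 - lf dh) * g p.2 + lf dh * (g p.2 - g x)) by ring.
have fb : `|f p.1| <= `|f x| + 1.
  by rewrite -lerBlDl (le_trans (lerB_dist _ _))// (le_trans h3).
have gb : `|g p.2| <= `|g x| + 1.
  by rewrite -lerBlDl (le_trans (lerB_dist _ _))// (le_trans h4).
apply: (@le_trans _ _ (e1 * S * `|dh|)); last by rewrite ler_wpM2r.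
rewrite (le_trans (ler_normD _ _))//.
have -> : e1 * S * `|dh| = ((`|f x| + 1) * (e1 * `|dh|) + e1 * (kg * `|dh|)) +
    ((e1 * `|dh|) * (`|g x| + 1) + (kf * `|dh|) * e1) by rewrite /S; ring.
rewrite lerD// (le_trans (ler_normD _ _))// !normrM lerD// ler_pM//;
  by rewrite addr_ge0.
Unshelve. all: by end_near. Qed.

Lemma sdiff_comp (W : normedModType R) (g : R -> W) (f : V -> R) x lf w :
  sdiff f x lf -> sdiff g (f x) (fun h => h *: w) ->
  sdiff (fun y => g (f y)) x (fun h => lf h *: w).
Proof.
move=> sf [_ hg]; have [[kf kf0 lkf] hf] := sf.
split.
  exists (kf * (`|w| + 1)); first by rewrite mulr_gt0// ltr_wpDl.
  move=> h; rewrite normrZ mulrAC ler_pM//; last by rewrite lerDl.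
have [Kf Kf0 Lf] := sdiff_lipschitz sf; have cf := sdiff_continuous sf.
move=> e e0; pose e1 := e / (2 * Kf); pose e2 := e / (2 * (`|w| + 1)).
have w1 : 0 < `|w| + 1 by rewrite ltr_wpDl.
have e10 : 0 < e1 by rewrite divr_gt0 ?mulr_gt0.
have e20 : 0 < e2 by rewrite divr_gt0 ?mulr_gt0.
have /near_pair[d d0 {}hg] := hg _ e10.
near=> p.
have h1 : `|f p.1 - f p.2 - lf (p.1 - p.2)| <= e2 * `|p.1 - p.2| by near: p; exact: hf.
have h2 : `|f p.1 - f p.2| <= Kf * `|p.1 - p.2| by near: p; exact: Lf.
have [h3 h4] : `|f p.1 - f x| < d /\ `|f p.2 - f x| < d.
  by near: p; exact: continuous_near_both.
have /= h5 := hg _ _ h3 h4.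
set dh := p.1 - p.2 in h1 h2 *.
have -> : g (f p.1) - g (f p.2) - lf dh *: w =
   (g (f p.1) - g (f p.2) - (f p.1 - f p.2) *: w) + (f p.1 - f p.2 - lf dh) *: w.
  by rewrite [X in _ = _ + X]scalerBl addrA subrK.
rewrite (le_trans (ler_normD _ _))// normrZ.
have -> : e * `|dh| = e1 * (Kf * `|dh|) + e2 * `|dh| * (`|w| + 1).
  by rewrite /e1 /e2; field; rewrite !gt_eqF.
rewrite lerD//; first by rewrite (le_trans h5)// ler_wpM2l// ltW.
by rewrite ler_pM// lerDl.
Unshelve. all: by end_near. Qed.

Lemma sdiffN (W : normedModType R) (f : V -> W) x lf :
  sdiff f x lf -> sdiff (fun y => - f y) x (fun h => - lf h).
Proof.
move=> [[K K0 lK] hf]; split; first by exists K => // h; rewrite normrN.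
move=> e e0; near=> p; rewrite -!opprD normrN; near: p; exact: hf.
Unshelve. all: by end_near. Qed.

Lemma sdiffB (W : normedModType R) (f g : V -> W) x lf lg :
  sdiff f x lf -> sdiff g x lg -> sdiff (fun y => f y - g y) x (fun h => lf h - lg h).
Proof. by move=> sf sg; apply: sdiffD => //; exact: sdiffN. Qed.

Lemma sdiff_coordP n (f : V -> 'rV[R]_n) x (l : V -> 'rV[R]_n) :
  sdiff f x l <-> forall i, sdiff (fun y => f y 0 i) x (fun h => l h 0 i).
Proof.
split => [[[K K0 lK] hf] i|h].
  split; first by exists K => // h; rewrite (le_trans (coord_le_norm _ _)).
  move=> e e0; near=> p; have : `|f p.1 - f p.2 - l (p.1 - p.2)| <= e * `|p.1 - p.2|.
    by near: p; exact: hf.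
  by apply: le_trans; rewrite (le_trans _ (coord_le_norm _ i))// !mxE.
split.
  have /choice[K hK] : forall i, exists K, 0 < K /\ forall h, `|l h 0 i| <= K * `|h|.
    by move=> i; have [[K K0 lK] _] := h i; exists K.
  exists (1 + \sum_i K i).
    by rewrite ltr_wpDr// sumr_ge0// => i _; rewrite ltW//; have [] := hK i.
  move=> u; apply: norm_rV_le => [|i].
    by rewrite mulr_ge0// addr_ge0// sumr_ge0// => i _; rewrite ltW//; have [] := hK i.
  have [_ /(_ u)/le_trans] := hK i; apply; rewrite ler_wpM2r//.
  rewrite (bigD1 i)//= addrCA lerDl addr_ge0// sumr_ge0// => j _.
  by rewrite ltW//; have [] := hK j.
move=> e e0; near=> p; apply: norm_rV_le; first by rewrite mulr_ge0// ltW.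
have : forall i, `|f p.1 0 i - f p.2 0 i - l (p.1 - p.2) 0 i| <= e * `|p.1 - p.2|.
  near: p; apply: filter_forall => i; have [_] := h i; exact.
by move=> H i; have := H i; rewrite !mxE.
Unshelve. all: by end_near. Qed.

Lemma sdiff_sum n (f : 'I_n -> V -> R) x (l : 'I_n -> V -> R) :
  (forall i, sdiff (f i) x (l i)) ->
  sdiff (fun y => \sum_i f i y) x (fun h => \sum_i l i h).
Proof.
elim: n f l => [|n IH] f l h.
  apply: (@sdiff_near _ (fun=> 0)); first by near=> y; rewrite big_ord0.
  by apply: sdiff_ext (sdiff_cst 0 x) _ => y; rewrite big_ord0.
have := sdiffD (h ord0) (IH (fun i => f (lift ord0 i)) (fun i => l (lift ord0 i)) _).
move=> /(_ (fun i => h _)) s.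
apply: (@sdiff_near _ (fun y => f ord0 y + \sum_i f (lift ord0 i) y)).
  by near=> y; rewrite big_ord_recl.
by apply: sdiff_ext s _ => y; rewrite big_ord_recl.
Unshelve. all: by end_near. Qed.

Lemma sdiff_dotp n (f g : V -> 'rV[R]_n) x lf lg : sdiff f x lf -> sdiff g x lg ->
  sdiff (fun y => dotp (f y) (g y)) x (fun h => dotp (f x) (lg h) + dotp (lf h) (g x)).
Proof.
move=> /sdiff_coordP sf /sdiff_coordP sg.
apply: sdiff_ext (sdiff_sum (fun i => sdiffM (sf i) (sg i))) _ => h.
by rewrite /dotp -big_split.
Qed.

Lemma sdiffZ n (a : V -> R) (f : V -> 'rV[R]_n) x la lf : sdiff a x la -> sdiff f x lf ->
  sdiff (fun y => a y *: f y) x (fun h => a x *: lf h + la h *: f x).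
Proof.
move=> sa /sdiff_coordP sf; apply/sdiff_coordP => i.
have s := sdiffM sa (sf i).
apply: (@sdiff_near _ (fun y => a y * f y 0 i)); first by near=> y; rewrite mxE.
by apply: sdiff_ext s _ => h; rewrite !mxE.
Unshelve. all: by end_near. Qed.

Lemma sdiff_cross (f g : V -> 'rV[R]_3) x lf lg : sdiff f x lf -> sdiff g x lg ->
  sdiff (fun y => cross (f y) (g y)) x
    (fun h => cross (f x) (lg h) + cross (lf h) (g x)).
Proof.
move=> /sdiff_coordP sf /sdiff_coordP sg; apply/sdiff_coordP => i.
have s := sdiffB (sdiffM (sf (i + 1)) (sg (i + 2))) (sdiffM (sf (i + 2)) (sg (i + 1))).
apply: (@sdiff_near _ (fun y => f y 0 (i + 1) * g y 0 (i + 2) - f y 0 (i + 2) * g y 0 (i + 1))).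
  by near=> y; rewrite mxE.
by apply: sdiff_ext s _ => h; rewrite !mxE; ring.
Unshelve. all: by end_near. Qed.

End strict_derivative.

Lemma norm_rV_lt {R : realType} n (u : 'rV[R]_n) e :
  0 < e -> (forall i, `|u 0 i| < e) -> `|u| < e.
Proof.
move=> e0 ue; rewrite [ltLHS]/Num.norm/= mx_normrE; apply: bigmax_lt => //= -[i j] _ /=.
by rewrite ord1.
Qed.

(** * Mean value theorem and symmetry of second derivatives *)

Section mean_value.
Context {R : realType}.
Local Notation U := 'rV[R]_2.

Lemma sdiff_is_derive (g : R -> R) t a :
  sdiff g t (fun h => h * a) -> is_derive t 1 g a.
Proof.
move=> [_ sg].
have lim : h^-1 *: ((g \o shift t) (h *: 1) - g t) @[h --> 0^'] --> a.
  apply/cvgrPdist_le => e e0; have /near_pair[d d0 h] := sg e e0.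
  near=> k; have k0 : k != 0 by near: k; exact: nbhs_dnbhs_neq.
  have kd : `|k| < d.
    near: k; apply/nbhs_ballP; exists d => // y; rewrite -ball_normE /= sub0r normrN.
    by [].
  have := h (k + t) t; rewrite /= addrK subrr normr0 => /(_ kd d0) hk.
  have -> : k *: 1 = k :> R by rewrite /GRing.scale /= mulr1.
  rewrite -normrN opprB -[X in _ - X](mulKf k0) -[_ *: _]/(k^-1 * _) -mulrBr normrM.
  by rewrite normfV mulrC ler_pdivrMr ?normr_gt0.
by apply: DeriveDef; [apply/cvg_ex; exists a|rewrite /derive; apply/cvg_lim].
Unshelve. all: by end_near. Qed.

(** The minimum and maximum with 0 let the increment a have either sign. *)
Lemma mvt_line (g g' : R -> R) (a : R) :
  (forall s : R, Num.min 0 a <= s <= Num.max 0 a -> is_derive s 1 g (g' s)) ->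
  exists2 s : R, Num.min 0 a <= s <= Num.max 0 a & g a - g 0 = a * g' s.
Proof.
have key (b c : R) : b <= c -> (forall s : R, b <= s <= c -> is_derive s 1 g (g' s)) ->
    exists2 s : R, b <= s <= c & g c - g b = (c - b) * g' s.
  move=> bc gg'; have [||s sab ->] := @MVT_segment R g g' b c bc.
  - by move=> s; rewrite in_itv /= => /andP[h1 h2]; apply: gg'; rewrite !ltW.
  - apply: derivable_within_continuous => s; rewrite in_itv /= => h.
    by have := gg' s h => -[].
  - by exists s; [move: sab; rewrite in_itv|rewrite mulrC].
have [a0|a0] := leP 0 a => gg'.
  by have [s sa] := key 0 a a0 gg'; rewrite subr0 => h; exists s.
have [s sa h] := key a 0 (ltW a0) gg'; exists s => //.
by rewrite -opprB h sub0r mulNr opprK.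
Qed.

Lemma sdiff_segment (f : U -> R) (x w : U) t (l : U -> R) :
  (forall c h, l (c *: h) = c * l h) -> sdiff f (x + t *: w) l ->
  is_derive t 1 (fun s => f (x + s *: w)) (l w).
Proof.
move=> lZ [[K K0 lK] sf]; apply: sdiff_is_derive; split.
  by exists (K * `|w| + 1); [rewrite ltr_wpDl// mulr_ge0// ltW|move=> h;
    rewrite -lZ (le_trans (lK _))// normrZ mulrCA mulrC ler_wpM2r// lerDl].
move=> e e0; have w1 : 0 < `|w| + 1 by rewrite ltr_wpDl.
have /near_pair[d d0 h] := sf (e / (`|w| + 1)) (divr_gt0 e0 w1).
have close s : `|s - t| < d / (`|w| + 1) -> `|x + s *: w - (x + t *: w)| < d.
  move=> st; rewrite opprD addrACA subrr add0r -scalerBl normrZ.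
  apply: (@le_lt_trans _ _ (`|s - t| * (`|w| + 1))); first by rewrite ler_wpM2l// lerDl.
  by rewrite -ltr_pdivlMr.
apply/near_pair; exists (d / (`|w| + 1)); first by rewrite divr_gt0.
move=> y z /close yd /close zd /=; have /= := h _ _ yd zd.
have -> : x + y *: w - (x + z *: w) = (y - z) *: w.
  by rewrite opprD addrACA subrr add0r -scalerBl.
rewrite lZ normrZ => /le_trans; apply.
rewrite -mulrA ler_wpM2l ?(ltW e0)// mulrCA -[leRHS]mulr1 ler_wpM2l//.
by rewrite mulrC ler_pdivrMr// mul1r lerDl.
Qed.

Lemma mvt_segment (f : U -> R) (Df : U -> U -> R) (x w : U) :
  (forall t, 0 <= t <= 1 -> sdiff f (x + t *: w) (Df (x + t *: w))) ->
  (forall z c h, Df z (c *: h) = c * Df z h) ->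
  exists2 t, 0 <= t <= 1 & f (x + w) - f x = Df (x + t *: w) w.
Proof.
move=> sf DZ.
have [|t] := @mvt_line (fun s => f (x + s *: w)) (fun s => Df (x + s *: w) w) 1.
  move=> s; rewrite min_l// max_r// => s01; apply: sdiff_segment => //; exact: sf.
by rewrite min_l// max_r// scale1r scale0r addr0 mul1r => t01 h; exists t.
Qed.

Lemma vec2E (u : U) : u = u 0 0 *: delta_mx 0 0 + u 0 1 *: delta_mx 0 1.
Proof. by apply: rV2P; rewrite !mxE /= ?mulr1 ?mulr0 ?addr0 ?add0r. Qed.

(** The increment from z to y is split along the axis-parallel path through the corner [m]. By the
    mean value theorem on each leg, the error is a coordinate of y - z times the oscillation of a
    partial derivative near x. *)
Lemma C1_sdiff_scalar (f p0 p1 : U -> R) (O : set U) x : open O -> O x ->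
  (forall z, O z -> is_derive z (delta_mx 0 0) f (p0 z)) ->
  (forall z, O z -> is_derive z (delta_mx 0 1) f (p1 z)) ->
  {for x, continuous p0} -> {for x, continuous p1} ->
  sdiff f x (fun h => h 0 0 * p0 x + h 0 1 * p1 x).
Proof.
move=> oO Ox d0f d1f c0 c1; split.
  exists (`|p0 x| + `|p1 x| + 1); first by rewrite ltr_wpDl// addr_ge0.
  move=> h; rewrite (le_trans (ler_normD _ _))// !normrM.
  have := coord_le_norm h 0; have := coord_le_norm h 1.
  have := normr_ge0 (p0 x); have := normr_ge0 (p1 x); have := normr_ge0 h.
  move: `|p0 x| `|p1 x| `|h| `|h 0 0| `|h 0 1| => a b c u v c0' b0 a0 h1 h2.
  have := ler_wpM2r a0 h2; have := ler_wpM2r b0 h1; nra.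
move=> e e0; have e2 : 0 < e / 2 by rewrite divr_gt0.
have /nbhs_ballP[d /= dp xd] : \forall y \near x, O y /\ `|p0 y - p0 x| < e / 2 /\ `|p1 y - p1 x| < e / 2.
  near=> y; split; first by near: y; exact: open_nbhs_nbhs.
  split; rewrite distrC; near: y; first by move/cvgrPdist_lt : c0; apply.
  by move/cvgrPdist_lt : c1; apply.
have inball (u : U) : (forall i, `|u 0 i - x 0 i| < d) -> ball x d u.
  move=> ud; rewrite -ball_normE /= distrC.
  by apply: norm_rV_lt => // i; rewrite !mxE.
have line i (u : U) (p : U -> R) s : is_derive (u + s *: delta_mx 0 i) (delta_mx 0 i) f (p (u + s *: delta_mx 0 i)) ->
    is_derive s 1 (fun s => f (u + s *: delta_mx 0 i)) (p (u + s *: delta_mx 0 i)).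
  set v : U := delta_mx 0 i => -[df dE]; split.
    move: df; rewrite /derivable; under [X in _ -> cvg (X @ _)]eq_fun do
      rewrite /= -[_ *: 1]/(_ * 1) mulr1 scalerDl addrCA.
    exact.
  rewrite -dE /derive; under eq_fun do
      rewrite /= -[_ *: 1]/(_ * 1) mulr1 scalerDl addrCA.
  by [].
apply/near_pair; exists d => // y z yd zd /=.
have yi i : `|y 0 i - x 0 i| < d.
  by apply: le_lt_trans yd; have := coord_le_norm (y - x) i; rewrite !mxE.
have zi i : `|z 0 i - x 0 i| < d.
  by apply: le_lt_trans zd; have := coord_le_norm (z - x) i; rewrite !mxE.
have between (a b c s : R) : `|a - c| < d -> `|b - c| < d ->
    Num.min 0 (a - b) <= s <= Num.max 0 (a - b) -> `|b + s - c| < d.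
  rewrite !ltr_norml => /andP[h1 h2] /andP[h3 h4].
  by case: (leP 0 (a - b)) => ab /andP[h5 h6]; lra.
pose m : U := vec2 (z 0 0) (y 0 1).
have ball0 s : Num.min 0 (y 0 0 - z 0 0) <= s <= Num.max 0 (y 0 0 - z 0 0) ->
    ball x d (m + s *: delta_mx 0 0).
  move=> sb; apply: inball => i; have [->|->] : i = 0 \/ i = 1.
    by case: i => -[|[|//]] ?; [left|right]; exact: val_inj.
    by rewrite !mxE /= mulr1; apply: between sb.
  by rewrite !mxE /= mulr0 addr0.
have ball1 s : Num.min 0 (y 0 1 - z 0 1) <= s <= Num.max 0 (y 0 1 - z 0 1) ->
    ball x d (z + s *: delta_mx 0 1).
  move=> sb; apply: inball => i; have [->|->] : i = 0 \/ i = 1.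
    by case: i => -[|[|//]] ?; [left|right]; exact: val_inj.
    by rewrite !mxE /= mulr0 addr0.
  by rewrite !mxE /= mulr1; apply: between sb.
have [s /ball0 /xd [_ [hp0 _]]] := @mvt_line (fun s => f (m + s *: delta_mx 0 0))
  (fun s => p0 (m + s *: delta_mx 0 0)) (y 0 0 - z 0 0)
  (fun s hs => line _ _ _ _ (d0f _ (xd _ (ball0 s hs)).1)).
have -> : m + (y 0 0 - z 0 0) *: delta_mx 0 0 = y.
  by apply: rV2P; rewrite !mxE /= ?mulr1 ?mulr0 ?addr0// addrC subrK.
rewrite scale0r addr0 => E0.
have [s' /ball1 /xd [_ [_ hp1]]] := @mvt_line (fun s => f (z + s *: delta_mx 0 1))
  (fun s => p1 (z + s *: delta_mx 0 1)) (y 0 1 - z 0 1)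
  (fun s hs => line _ _ _ _ (d1f _ (xd _ (ball1 s hs)).1)).
have -> : z + (y 0 1 - z 0 1) *: delta_mx 0 1 = m.
  by apply: rV2P; rewrite !mxE /= ?mulr1 ?mulr0 ?addr0// addrC subrK.
rewrite scale0r addr0 => E1.
have -> : f y - f z = (f y - f m) + (f m - f z) by rewrite addrA subrK.
rewrite E0 E1 !mxE.
have := coord_le_norm (y - z) 0; have := coord_le_norm (y - z) 1; rewrite !mxE.
move=> h1 h0.
rewrite (_ : _ - _ = (y 0 0 - z 0 0) * (p0 (m + s *: delta_mx 0 0) - p0 x) +
  (y 0 1 - z 0 1) * (p1 (z + s' *: delta_mx 0 1) - p1 x)); last ring.
rewrite (le_trans (ler_normD _ _))// !normrM [leRHS](_ : _ = `|y - z| * (e / 2) + `|y - z| * (e / 2)).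
  by rewrite lerD// ler_pM// ltW.
by rewrite mulrC -mulrDr -splitr.
Unshelve. all: by end_near. Qed.

Let coord_lin2 m (a b : R) (u v : 'rV[R]_m) j :
  (a *: u + b *: v) 0 j = a * u 0 j + b * v 0 j.
Proof. by rewrite !mxE. Qed.

Lemma C1_sdiff m (f : U -> 'rV[R]_m) (O : set U) x : open O -> O x ->
  (forall i z, O z -> derivable f z (delta_mx 0 i)) ->
  (forall i, {for x, continuous (partial i f)}) ->
  sdiff f x (fun h => h 0 0 *: partial 0 f x + h 0 1 *: partial 1 f x).
Proof.
move=> oO Ox df cf; apply/sdiff_coordP => j.
have dj i z : O z -> is_derive z (delta_mx 0 i) (fun y => f y 0 j) (partial i f z 0 j).
  move=> Oz; have := df i z Oz => dfz; split; first by move/derivable_mxP : (dfz); exact.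
  by rewrite /partial derive_mx// mxE.
have cj i : {for x, continuous (fun z => partial i f z 0 j)}.
  apply: (@continuous_comp _ _ _ (partial i f) (fun v : 'rV[R]_m => v 0 j)); first exact: cf.
  exact: coord_continuous.
apply: sdiff_ext (C1_sdiff_scalar oO Ox (dj 0) (dj 1) (cj 0) (cj 1)) _ => h.
by rewrite coord_lin2.
Qed.

(** The second difference of f over a square of side h at x is computed in both orders. By the mean
    value theorem it is h times an increment of [p 0] in direction 1, and also h times an increment
    of [p 1] in direction 0; strict differentiability at x evaluates these increments as h times
    [q 1 0] and h times [q 0 1], up to a small multiple of h. *)
Lemma young (f : U -> R) (p : 'I_2 -> U -> R) (q : 'I_2 -> 'I_2 -> R) (O : set U) x :
  open O -> O x ->
  (forall i z, O z -> is_derive z (delta_mx 0 i) f (p i z)) ->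
  (forall i, sdiff (p i) x (fun h => h 0 0 * q 0 i + h 0 1 * q 1 i)) ->
  q 0 1 = q 1 0.
Proof.
move=> oO Ox dj sj; set a := q 0 1; set b := q 1 0.
apply/eqP; rewrite -subr_eq0 -normr_le0; apply/ler_addgt0Pl => e e0; rewrite addr0.
have e4 : 0 < e / 4 by rewrite divr_gt0.
have [_ /(_ _ e4)/near_pair[d0 d00 s0]] := sj 0.
have [_ /(_ _ e4)/near_pair[d1 d10 s1]] := sj 1.
have /nbhs_ballP[d2 /= d20 xO] := open_nbhs_nbhs (conj oO Ox).
pose h := Num.min d0 (Num.min d1 d2) / 2.
have h0 : 0 < h by rewrite divr_gt0// !lt_min d00 d10.
have hd : h < Num.min d0 (Num.min d1 d2) by rewrite /h gtr_pMr ?invf_lt1 ?ltr1n// !lt_min d00 d10.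
rewrite !lt_min in hd; case/and3P : hd => hd0 hd1 hd2.
pose E (i : 'I_2) : U := delta_mx 0 i.
have norm_st s t : 0 <= s <= h -> 0 <= t <= h -> `|s *: E 0 + t *: E 1| <= h.
  move=> s01 t01; apply: norm_rV_le => [|i]; first exact: ltW.
  have [->|->] : i = 0 \/ i = 1.
    by case: i => -[|[|//]] ?; [left|right]; exact: val_inj.
    by rewrite !mxE /= mulr1 mulr0 addr0 ger0_norm; case/andP : s01.
  by rewrite !mxE /= mulr1 mulr0 add0r ger0_norm; case/andP : t01.
have inO s t : 0 <= s <= h -> 0 <= t <= h -> O (x + (s *: E 0 + t *: E 1)).
  move=> s01 t01; apply: xO; rewrite -ball_normE /= opprD addNKr normrN.
  exact: le_lt_trans (norm_st _ _ s01 t01) hd2.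
have h01 : 0 <= h <= h by rewrite lexx ltW.
have z01 : 0 <= (0 : R) <= h by rewrite lexx ltW.
have line i (u : U) (g : U -> R) s : is_derive (u + s *: E i) (E i) f (g (u + s *: E i)) ->
    is_derive s 1 (fun s => f (u + s *: E i)) (g (u + s *: E i)).
  set v := E i => -[df dE]; split.
    move: df; rewrite /derivable; under [X in _ -> cvg (X @ _)]eq_fun do
      rewrite /= -[_ *: 1]/(_ * 1) mulr1 scalerDl addrCA.
    exact.
  rewrite -dE /derive; under eq_fun do
      rewrite /= -[_ *: 1]/(_ * 1) mulr1 scalerDl addrCA.
  by [].
have step i u : (forall s, 0 <= s <= h -> O (u + s *: E i)) -> forall u',
   (forall s, 0 <= s <= h -> O (u' + s *: E i)) ->
   exists2 s, 0 <= s <= h & f (u + h *: E i) - f u - (f (u' + h *: E i) - f u') =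
     h * (p i (u + s *: E i) - p i (u' + s *: E i)).
  move=> uO u' u'O.
  have [|s] := @mvt_line (fun s => f (u + s *: E i) - f (u' + s *: E i))
    (fun s => p i (u + s *: E i) - p i (u' + s *: E i)) h.
    move=> s; rewrite min_l ?(ltW h0)// max_r ?(ltW h0)// => s01.
    by apply: is_deriveB; apply: (line _ _ (p i)); apply: dj;
      [exact: uO|exact: u'O].
  rewrite min_l ?(ltW h0)// max_r ?(ltW h0)// => s01 /= eqs.
  by exists s => //; rewrite -eqs !scale0r !addr0; ring.
have xE s t : x + (s *: E 0 + t *: E 1) = x + t *: E 1 + s *: E 0.
  by rewrite -addrA [_ + s *: _]addrC.
have [s s01 Es] := step 0 (x + h *: E 1) (fun s hs => ltac:(rewrite -xE; exact: inO))
  x (fun s hs => ltac:(have := inO s 0 hs z01; rewrite scale0r addr0; exact)).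
have [t t01 Et] := step 1 (x + h *: E 0) (fun s hs => ltac:(rewrite -addrA; exact: inO))
  x (fun s hs => ltac:(have := inO 0 s z01 hs; rewrite scale0r add0r; exact)).
have near0 u : `|u - x| <= h -> `|u - x| < d0 /\ `|u - x| < d1.
  by move=> uh; split; exact: le_lt_trans uh _.
have nst s' t' : 0 <= s' <= h -> 0 <= t' <= h ->
    `|x + (s' *: E 0 + t' *: E 1) - x| < d0 /\ `|x + (s' *: E 0 + t' *: E 1) - x| < d1.
  by move=> ? ?; apply: near0; rewrite addrC addKr; exact: norm_st.
have cancelD (X A B : U) : X + A + B - (X + B) = A.
  by rewrite -[X + A + B]addrA opprD addrACA subrr add0r addrK.
have nE i : `|h *: E i| <= h.
  apply: norm_rV_le => [|k]; first exact: ltW.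
  rewrite !mxE /= normrM ger0_norm ?(ltW h0)// ler_piMr ?(ltW h0)//.
  by case: (k == i); rewrite /= ?normr1 ?normr0.
have e4n i : e / 4 * `|h *: E i| <= h * (e / 4) by rewrite mulrC ler_wpM2r ?(ltW e4).
have hb : `|p 0 (x + h *: E 1 + s *: E 0) - p 0 (x + s *: E 0) - h * b| <= h * (e / 4).
  have := s0 _ _ (nst s h s01 h01).1 (nst s 0 s01 z01).1; rewrite /= xE scale0r addr0.
  have -> : x + h *: E 1 + s *: E 0 - (x + s *: E 0) = h *: E 1.
    exact: cancelD.
  by move=> /le_trans/(_ (e4n 1)); rewrite !mxE /= mulr0 mul0r add0r mulr1.
have ha : `|p 1 (x + h *: E 0 + t *: E 1) - p 1 (x + t *: E 1) - h * a| <= h * (e / 4).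
  have := s1 _ _ (nst h t h01 t01).2 (nst 0 t z01 t01).2; rewrite /= addrA scale0r add0r.
  have -> : x + h *: E 0 + t *: E 1 - (x + t *: E 1) = h *: E 0.
    exact: cancelD.
  by move=> /le_trans/(_ (e4n 0)); rewrite !mxE /= mulr0 mul0r addr0 mulr1.
have AB : p 0 (x + h *: E 1 + s *: E 0) - p 0 (x + s *: E 0) =
    p 1 (x + h *: E 0 + t *: E 1) - p 1 (x + t *: E 1).
  apply: (mulfI (negbT (gt_eqF h0))); rewrite -Es -Et.
  by rewrite (addrAC x (h *: E 1)); ring.
rewrite AB in hb; move: (_ - p 1 _) ha hb => c ha hb.
rewrite -(ler_pM2l h0) -[X in X * `|_|]gtr0_norm// -normrM.
rewrite (_ : h * (a - b) = (c - h * b) - (c - h * a)); last ring.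
rewrite (le_trans (ler_normB _ _))// (le_trans (lerD hb ha))//.
by rewrite -mulrDr ler_wpM2l ?(ltW h0)//; move: e0; clear; lra.
Qed.

End mean_value.

Lemma closed_borel {T : ptopologicalType} (A : set T) : closed A -> <<s @open T >> A.
Proof.
move=> cA; rewrite -[X in <<s _ >> X]setCK.
apply: (@measurableC _ (g_sigma_algebraType (@open T))).
by apply: sub_sigma_algebra; exact: closed_openC.
Qed.

(** * From relations between Jacobians to relations between areas *)

Section area_comparison.
Context {R : realType}.
Local Notation U := 'rV[R]_2.
Local Notation V := 'rV[R]_3.
Local Notation H := (@hausdorff2 R).

(** Near x, f and its derivative are lam-Lipschitz images of each other. The error of the derivative
    is at most q times the length of its value, and [q = 1 - lam^-1] gives both 1 + q <= lam and 1 -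
    q = 1 / lam. The 3 in the choice of the error passes from the sup norm to the Euclidean norm. *)
Lemma area_linear_approx (f : U -> V) (B : 'M[R]_(2, 3)) x lam : 1 < lam ->
  row_free B -> sdiff f x (fun h => h *m B) ->
  exists2 d, 0 < d & forall E, E `<=` [set y | `|y - x| < d] ->
    (H (f @` E) <= (lam ^+ 2)%:E * lin_area B E)%E /\
    (lin_area B E <= (lam ^+ 2)%:E * H (f @` E))%E.
Proof.
move=> lam1 rB [_ sf]; have lam0 : 0 < lam by rewrite (lt_trans ltr01).
have [b b0 lb] := linear_lower rB.
pose q := 1 - lam^-1.
have q0 : 0 < q by rewrite subr_gt0 invf_lt1.
have e0 : 0 < q * b / 3 by rewrite divr_gt0// mulr_gt0.
have /near_pair[d d0 h] := sf _ e0; exists d => // E Ed.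
have err y z : E y -> E z ->
    enorm (f y - f z - (y - z) *m B) <= q * enorm ((y - z) *m B).
  move=> Ey Ez; apply: (le_trans (enorm_le_norm _)).
  have /= := h _ _ (Ed _ Ey) (Ed _ Ez) => /(ler_wpM2l (ler0n R 3))/le_trans; apply.
  rewrite mulrA mulrCA mulfV ?pnatr_eq0// mulr1 -mulrA ler_wpM2l ?(ltW q0)//.
have qlam : 1 + q <= lam.
  rewrite /q -subr_ge0; have : 0 < lam^-1 by rewrite invr_gt0.
  have : lam * lam^-1 = 1 by rewrite mulfV// gt_eqF.
  by move: (lam^-1) => m hm m0; nra.
split; apply: (hausdorff2_lipschitz lam0) => y z Ey Ez.
  rewrite -mulmxBl -(subrK ((y - z) *m B) (f y - f z)) (le_trans (enormD _ _))//.
  rewrite (le_trans (lerD (err _ _ Ey Ez) (lexx _)))// -[X in _ + X]mul1r -mulrDl addrC.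
  by rewrite ler_wpM2r ?enorm_ge0.
rewrite -mulmxBl; have := err _ _ Ey Ez; set w := (y - z) *m B; set v := f y - f z => evw.
have : enorm w <= enorm v + q * enorm w.
  by rewrite -{1}(subKr v w) (le_trans (enormB _ _))// lerD2l.
rewrite /q mulrBl mul1r => h1; have : lam^-1 * enorm w <= enorm v by lra.
by rewrite mulrC ler_pdivrMr// mulrC.
Qed.

Lemma norm_ball_open (x : U) d : open [set y : U | `|y - x| < d].
Proof.
rewrite (_ : [set _ | _] = ball x d); last first.
  by apply/seteqP; split => y; rewrite -ball_normE /= distrC.
exact: ball_open.
Qed.

Variables (n : nat) (f : 'I_n -> U -> V) (g : U -> V) (c : 'I_n -> R) (P : set U).
Variables (B : U -> 'M[R]_(2, 3)) (M11 M12 M21 M22 : 'I_n -> U -> R).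
Let D i x := M11 i x * M22 i x - M12 i x * M21 i x.
Hypotheses (cP : compact P) (fP : forall i, surface_map (f i) P) (gP : surface_map g P).
Hypotheses (rB : forall x, P x -> row_free (B x))
  (gB : forall x, P x -> sdiff g x (fun h => h *m B x))
  (fB : forall i x, P x -> sdiff (f i) x
     (fun h => h *m (mx2 (M11 i x) (M12 i x) (M21 i x) (M22 i x) *m B x)))
  (M11_gt0 : forall i x, P x -> 0 < M11 i x) (D_gt0 : forall i x, P x -> 0 < D i x)
  (sumD : forall x, P x -> \sum_i c i * D i x = 0).
Hypothesis gfin : (H (g @` P) < +oo)%E.

Let mg (E : set U) := H (g @` (E `&` P)).
Let mf i (E : set U) := H (f i @` (E `&` P)).

Let mg_fin E : mg E \is a fin_num.
Proof.
rewrite ge0_fin_numE ?outer_measure_ge0//; apply: le_lt_trans gfin.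
by apply: le_outer_measure; apply: image_subset; apply: subIsetr.
Qed.

Let local_bound e : 0 < e -> forall x, P x -> exists2 d, 0 < d &
  forall E, <<s @open U >> E -> E `<=` [set y | `|y - x| < d] ->
    (forall i, mf i E \is a fin_num) /\
    `|\sum_i c i * fine (mf i E)| <= e * fine (mg E).
Proof.
move=> e0 x Px.
pose K := \sum_i `|c i| * D i x.
have K0 : 0 <= K by rewrite sumr_ge0// => i _; rewrite mulr_ge0// ltW// D_gt0.
(* Each area is compared with a linear area, and the linear area with that of g, at a cost of
   [lam ^+ 2] each time. For t <= 1 the total (1 + t)^4 is at most 1 + 15 t, by (1 + t)^2 <= 1 + 3 t
   used twice. *)
pose t := Num.min 1 (e / (15 * (K + 1))).
have t0 : 0 < t by rewrite lt_min ltr01 divr_gt0// mulr_gt0// ltr_wpDl.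
have t1 : t <= 1 by rewrite ge_min lexx.
have tK : 15 * t * K <= e.
  have : t * (15 * (K + 1)) <= e.
    by rewrite -ler_pdivlMr ?ge_min ?lexx ?orbT// mulr_gt0// ltr_wpDl.
  by apply: le_trans; nra.
pose lam := 1 + t; have lam1 : 1 < lam by rewrite ltrDl.
have lam4 : lam ^+ 2 * lam ^+ 2 <= 1 + 15 * t.
  have tt : t * t <= t by rewrite ler_piMr// ltW.
  have l2 : lam ^+ 2 <= 1 + 3 * t by rewrite /lam expr2; lra.
  apply: (@le_trans _ _ ((1 + 3 * t) * (1 + 3 * t))); last lra.
  by rewrite ler_pM// sqr_ge0.
have lam40 : 0 < lam ^+ 2 by rewrite exprn_gt0// (lt_trans ltr01).
have [d0 d00 hg] := area_linear_approx lam1 (rB Px) (gB Px).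
have rM i : row_free (mx2 (M11 i x) (M12 i x) (M21 i x) (M22 i x) *m B x).
  apply: row_free_unit_mul; last exact: rB.
  by apply: unit_mx2; rewrite gt_eqF//; exact: D_gt0.
have /choice[d' hf] : forall i, exists d', 0 < d' /\ forall E, E `<=` [set y | `|y - x| < d'] ->
    (H (f i @` E) <= (lam ^+ 2)%:E *
       lin_area (mx2 (M11 i x) (M12 i x) (M21 i x) (M22 i x) *m B x) E)%E /\
    (lin_area (mx2 (M11 i x) (M12 i x) (M21 i x) (M22 i x) *m B x) E <=
       (lam ^+ 2)%:E * H (f i @` E))%E.
  by move=> i; have [d' d'0 h] := area_linear_approx lam1 (rM i) (fB i Px); exists d'.
pose d := \big[Num.min/d0]_i d' i.
have d_gt0 : 0 < d by apply: lt_bigmin => // i _; have [] := hf i.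
have dd i : d <= d' i by apply: bigmin_le.
have dd0 : d <= d0 by exact: bigmin_le_id.
exists d => // E mE Ed.
have mEP : <<s @open U >> (E `&` P).
  apply: (@measurableI _ (g_sigma_algebraType (@open U))) => //.
  by apply: closed_borel; have [] := gP.
have [g1 g2] := hg (E `&` P) (fun y h => lt_le_trans (Ed _ h.1) dd0).
pose a := fine (mg E); have aE : mg E = a%:E by rewrite fineK.
have a0 : 0 <= a by rewrite fine_ge0// outer_measure_ge0.
have lfin : lin_area (B x) (E `&` P) \is a fin_num.
  rewrite ge0_fin_numE ?outer_measure_ge0// (le_lt_trans g2)//.
  by rewrite -/(mg E) aE -EFinM ltry.
pose l := fine (lin_area (B x) (E `&` P)).
have lE : lin_area (B x) (E `&` P) = l%:E by rewrite fineK.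
rewrite -/(mg E) aE lE -EFinM lee_fin in g1; rewrite -/(mg E) aE lE -EFinM lee_fin in g2.
have key i : mf i E \is a fin_num /\ `|fine (mf i E) - D i x * a| <= D i x * (15 * t) * a.
  have [_ /(_ (E `&` P) (fun y h => lt_le_trans (Ed _ h.1) (dd i)))] := hf i.
  rewrite lin_area_mx2//; [|exact: rB|exact: M11_gt0|exact: D_gt0].
  rewrite -/(D i x) lE -EFinM -EFinM => -[f1 f2].
  have ffin : mf i E \is a fin_num.
    by rewrite ge0_fin_numE ?outer_measure_ge0// (le_lt_trans f1)// ltry.
  split => //; move: f1 f2; rewrite -/(mf i E) -(fineK ffin) -EFinM !lee_fin.
  have := D_gt0 i Px; rewrite -/(D i x).
  move: (fine (mf i E)) (D i x) (lam ^+ 2) lam40 lam4 g1 g2 => m Di L L0 L4 g1 g2 Di0 f1 f2.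
  have u1 : m <= Di * a * (L * L).
    rewrite (le_trans f1)// [leRHS](_ : _ = L * (Di * (L * a))); last ring.
    by rewrite ler_wpM2l ?(ltW L0)// ler_wpM2l// ltW.
  have u2 : Di * a <= m * (L * L).
    rewrite [leRHS](_ : _ = L * (L * m)); last ring.
    rewrite (le_trans (ler_wpM2l (ltW Di0) g1))// [leLHS](_ : _ = L * (Di * l)); last ring.
    by rewrite ler_wpM2l// ltW.
  have Da : 0 <= Di * a by rewrite mulr_ge0// ltW.
  have m0 : 0 <= m.
    have : 0 < L * L by rewrite mulr_gt0.
    by move: u2 Da; move: (L * L) => q u2 Da q0; rewrite -(pmulr_lge0 _ q0) (le_trans Da).
  have u3 : Di * a * (L * L) <= Di * a * (1 + 15 * t) by rewrite ler_wpM2l.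
  have u4 : m * (L * L) <= m * (1 + 15 * t) by rewrite ler_wpM2l.
  rewrite /= ler_norml; apply/andP; split; last first.
    by move: u1 u3; rewrite mulrDr mulr1 mulrAC; lra.
  have t15 : 0 <= 15 * t by rewrite mulr_ge0// ltW.
  have u5 : Di * a <= m * (1 + 15 * t) by apply: le_trans u4.
  move: (15 * t) t15 u5 => s s0 u5; rewrite mulrAC.
  move: (Di * a) Da u5 => w w0 u5.
  case: (leP w m) => wm; first by have := mulr_ge0 w0 s0; lra.
  have : m * s <= w * s by rewrite ler_wpM2r// ltW.
  by move: u5; rewrite mulrDr mulr1; lra.
split; first by move=> i; have [] := key i.
have -> : \sum_i c i * fine (mf i E) = \sum_i c i * (fine (mf i E) - D i x * a).
  rewrite [RHS](eq_bigr (fun i => c i * fine (mf i E) - (c i * D i x) * a)).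
    by rewrite sumrB -mulr_suml sumD// mul0r subr0.
  by move=> i _; ring.
rewrite (le_trans (ler_norm_sum _ _ _))//.
apply: (@le_trans _ _ (\sum_i `|c i| * D i x * (15 * t * a))).
  apply: ler_sum => i _; rewrite normrM -mulrA ler_wpM2l//.
  by rewrite mulrA; have [] := key i.
by rewrite -mulr_suml -/K mulrA ler_wpM2r// mulrC.
Qed.

(** This takes the place of the area formula: a linear relation that holds pointwise between
    Jacobian determinants passes to the areas. The local bounds add up over a finite cover of the
    compact P, so the combination is at most e times the area of g for every e > 0. *)
Lemma area_combination E : <<s @open U >> E ->
  (forall i, H (f i @` (E `&` P)) \is a fin_num) /\
  \sum_i c i * fine (H (f i @` (E `&` P))) = 0.
Proof.
(* Quantifying over all Borel subsets of N lets the bound survive when a finite cover is made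
   disjoint. *)
pose good e (N : set U) := forall E, <<s @open U >> E -> E `<=` N ->
    (forall i, mf i E \is a fin_num) /\
    `|\sum_i c i * fine (mf i E)| <= e * fine (mg E).
pose T := g_sigma_algebraType (@open U).
have good0 e : 0 < e -> good e set0.
  move=> e0 F mF; rewrite subset0 => ->.
  have mf0 i : mf i set0 = 0%E by rewrite /mf set0I image_set0 outer_measure0.
  split; first by move=> i; rewrite mf0.
  rewrite big1 => [|i _]; last by rewrite mf0 mulr0.
  by rewrite normr0 mulr_ge0 ?(ltW e0)// fine_ge0// outer_measure_ge0.
have goodU e N1 N2 : 0 < e -> <<s @open U >> N1 -> good e N1 -> good e N2 -> good e (N1 `|` N2).
  move=> e0 mN1 g1 g2 F mF FN.
  have mF1 : <<s @open U >> (F `&` N1) by exact: (@measurableI _ T).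
  have mF2 : <<s @open U >> (F `\` N1) by exact: (@measurableD _ T).
  have [f1 h1] := g1 _ mF1 (@subIsetr _ _ _).
  have [|f2 h2] := g2 _ mF2; first by move=> y [/FN[]].
  have split_area (h : U -> V) (hP : surface_map h P) :
      H (h @` (F `&` P)) = (H (h @` (F `&` N1 `&` P)) + H (h @` ((F `\` N1) `&` P)))%E.
    rewrite -[LHS]/(area hP F) -[X in _ = (X + _)%E]/(area hP (F `&` N1)).
    rewrite -[X in _ = (_ + X)%E]/(area hP (F `\` N1)).
    rewrite -measureU//; last first.
      by apply/seteqP; split => // y [[_ yN1] [_]].
    by rewrite setUIDK.
  have sf i : mf i F = (mf i (F `&` N1) + mf i (F `\` N1))%E by exact: split_area.
  have sg : mg F = (mg (F `&` N1) + mg (F `\` N1))%E by exact: split_area.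
  split; first by move=> i; rewrite sf fin_numD f1 f2.
  rewrite sg fineD ?mg_fin// mulrDr.
  rewrite (eq_bigr (fun i => c i * fine (mf i (F `&` N1)) + c i * fine (mf i (F `\` N1)))).
    by rewrite big_split/= (le_trans (ler_normD _ _))// lerD.
  by move=> i _; rewrite sf fineD// mulrDr.
have goodP e : 0 < e -> good e P.
  move=> e0.
  have /choice[d hd] : forall x, exists d, 0 < d /\ (P x -> good e [set y | `|y - x| < d]).
    move=> x; have [Px|nPx] := pselect (P x); last by exists 1.
    by have [d d0 h] := local_bound e0 Px; exists d.
  have := cP; rewrite compact_cover => /(_ _ P (fun x => [set y | `|y - x| < d x])).
  case=> [x _|x Px|D' D'P PD']; first exact: norm_ball_open.
    by exists x => //=; rewrite subrr normr0; have [] := hd x.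
  have : forall s : seq U, (forall x, x \in s -> P x) ->
      good e (\bigcup_(x in [set` s]) [set y | `|y - x| < d x]).
    elim=> [|x s IH] xsP; first by rewrite set_nil bigcup_set0; exact: good0.
    have -> : \bigcup_(z in [set` x :: s]) [set y | `|y - z| < d z] =
        [set y | `|y - x| < d x] `|` \bigcup_(z in [set` s]) [set y | `|y - z| < d z].
      apply/seteqP; split => y [].
      - move=> z /=; rewrite inE => /predU1P[->|zs] yz; first by left.
        by right; exists z.
      - by move=> yx; exists x => //=; rewrite inE eqxx.
      - by move=> [z /= zs yz]; exists z => //=; rewrite inE zs orbT.
    apply: goodU => //.
    - by apply: sub_sigma_algebra; exact: norm_ball_open.
    - by have [_] := hd x; apply; apply: xsP; rewrite inE eqxx.
    - by apply: IH => y ys; apply: xsP; rewrite inE ys orbT.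
  move=> /(_ (finmap.enum_fset D') (fun x xD => set_mem (D'P x xD))) gD F mF FP.
  by apply: gD => //; exact: subset_trans PD'.
move=> mE; have mEP : <<s @open U >> (E `&` P).
  apply: (@measurableI _ T) => //.
  by apply: closed_borel; have [] := gP.
have gE e : 0 < e -> (forall i, mf i E \is a fin_num) /\
    `|\sum_i c i * fine (mf i E)| <= e * fine (mg E).
  move=> e0; have := goodP e e0 _ mEP (@subIsetr _ _ _).
  have mfE i : mf i (E `&` P) = mf i E by rewrite /mf -setIA setIid.
  rewrite (_ : mg (E `&` P) = mg E); last by rewrite /mg -setIA setIid.
  move=> [h1 h2]; split; first by move=> i; rewrite -mfE.
  by move: h2; under eq_bigr do rewrite mfE.
split; first by have [] := gE 1 ltr01.
apply/eqP; rewrite -normr_le0; apply/ler_addgt0Pl => e e0; rewrite addr0.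
have a0 : 0 <= fine (mg E) by rewrite fine_ge0// outer_measure_ge0.
have [_] := gE (e / (fine (mg E) + 1)) (divr_gt0 e0 (ltr_wpDl a0 ltr01)).
move=> /le_trans; apply; rewrite mulrAC ler_pdivrMr ?ltr_wpDl// ler_wpM2l ?(ltW e0)//.
by rewrite lerDl.
Qed.

End area_comparison.

Lemma lipschitz_continuous {R : realType} (S T : normedModType R) (f : S -> T) (K : R) :
  0 < K -> (forall x y, `|f x - f y| <= K * `|x - y|) -> continuous f.
Proof.
move=> K0 fK x; apply/cvgrPdist_lt => e e0; apply/nbhs_ballP.
exists (e / K) => [|y]; first by rewrite /= divr_gt0.
by rewrite -ball_normE /= ltr_pdivlMr// mulrC; exact: le_lt_trans.
Qed.

(** * Convex bodies *)

Section convex_bodies.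
Context {R : realType}.
Local Notation V := 'rV[R]_3.
Implicit Types (C : set V).

Lemma enorm_dist_le n (u v : 'rV[R]_n) : `|enorm u - enorm v| <= enorm (u - v).
Proof.
have h (a b : 'rV[R]_n) : enorm a - enorm b <= enorm (a - b).
  by rewrite lerBlDr -{1}(subrK b a) enormD.
by rewrite ler_norml h andbT lerNl opprB enormBC h.
Qed.

Lemma continuous_dotp n (T : topologicalType) (f g : T -> 'rV[R]_n) x :
  {for x, continuous f} -> {for x, continuous g} ->
  {for x, continuous (fun y => dotp (f y) (g y))}.
Proof.
move=> cf cg; rewrite /dotp.
have ci i : {for x, continuous (fun y => f y 0 i * g y 0 i)}.
  apply: (@cvgM _ _ (nbhs x)).
    by apply: (@continuous_comp _ _ _ f (fun v => v 0 i)) => //; exact: coord_continuous.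
  by apply: (@continuous_comp _ _ _ g (fun v => v 0 i)) => //; exact: coord_continuous.
by apply: (cvg_big (op := +%R)) => [|i _]; [exact: add_continuous|exact: ci].
Qed.

Lemma continuous_enorm n : continuous (@enorm R n).
Proof.
apply: (@lipschitz_continuous _ _ _ _ (n%:R + 1)) => [|x y]; first by rewrite ltr_wpDl.
rewrite (le_trans (enorm_dist_le _ _))// (le_trans (enorm_le_norm _))//.
by rewrite ler_wpM2r// lerDl.
Qed.

Lemma compact_slack (T : topologicalType) (A : set T) (f : T -> R) :
  compact A -> {within A, continuous f} -> (forall a, A a -> f a < 0) ->
  exists2 d, 0 < d & forall a, A a -> f a <= - d.
Proof.
move=> cA cf neg; have [A0|/set0P/negP/negPn/eqP A0] := pselect (A !=set0); last first.
  by exists 1 => // a; rewrite A0.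
have [a /set_mem Aa amax] := compact_EVT_max A0 cA cf.
exists (- f a); first by rewrite oppr_gt0 neg.
by move=> b Ab; rewrite opprK amax// inE.
Qed.

Lemma convexP C x y t : convex_set C -> C x -> C y -> 0 <= t <= 1 ->
  C (x + t *: (y - x)).
Proof.
move=> cC Cx Cy /andP[t0 t1].
have := cC y x (Itv01 t0 t1); rewrite !inE => /(_ Cy Cx).
suff -> : x + t *: (y - x) = conv (Itv01 t0 t1) (y : convex_lmodType V) x by [].
rewrite -[RHS]/(t *: y + (1 - t) *: x).
by rewrite scalerBl scale1r scalerBr addrCA addrA.
Qed.

Lemma convexI (C : set V) :
  (forall x y t, C x -> C y -> 0 <= t <= 1 -> C (x + t *: (y - x))) -> convex_set C.
Proof.
move=> h x y l; rewrite !inE => Cx Cy.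
have := h y x l%:num Cy Cx; rewrite ge0 le1 => /(_ isT).
suff -> : conv l x y = (y : V) + l%:num *: ((x : V) - y) by [].
rewrite -[LHS]/(l%:num *: (x : V) + (1 - l%:num) *: (y : V)).
by rewrite scalerBl scale1r scalerBr addrCA addrA.
Qed.

(** The unit normal bundle of C. Its compactness is what makes the later estimates uniform, also at
    boundary points with several normals. *)
Definition contact C (m x : V) :=
  [/\ enorm m = 1, C x & forall z, C z -> dotp m (z - x) <= 0].

Lemma enorm_unit (v : V) : v != 0 -> enorm ((enorm v)^-1 *: v) = 1.
Proof.
by move=> v0; rewrite enormZ ger0_norm ?invr_ge0 ?enorm_ge0// mulVf// enorm_eq0.
Qed.

Section body.
Variable C : set V.
Hypothesis bodyC : convex_body C.

Let convC : convex_set C. Proof. by have [] := bodyC. Qed.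
Let compC : compact C. Proof. by have [] := bodyC. Qed.

Lemma body_closed : closed C.
Proof. by apply: compact_closed => //; exact: norm_hausdorff. Qed.

(** The metric projection, recorded by its variational inequality: if that failed at x, a short step
    from p towards x would come closer to z. *)
Lemma nearest z : exists2 p, C p & forall x, C x -> dotp (z - p) (x - p) <= 0.
Proof.
have C0 : C !=set0.
  by have [_ _ [c ci]] := bodyC; exists c; exact: interior_subset ci.
have cf : {within C, continuous (fun x => dotp (x - z) (x - z))}.
  apply: continuous_subspaceT => x.
  have cB : {for x, continuous (fun y : V => y - z)}.
    by apply: (@continuousB _ _ _ id (fun=> z)) => //; exact: cst_continuous.
  exact: (continuous_dotp cB cB).
have [p /set_mem Cp pmin] := compact_EVT_min C0 compC cf.
exists p => // x Cx; rewrite leNgt; apply/negP => h.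
move aE : (dotp (z - p) (x - p)) h => a h.
have [b bE b0] : exists2 b, dotp (x - p) (x - p) = b & 0 <= b.
  by exists (dotp (x - p) (x - p)) => //; exact: dotpp_ge0.
have key t : 0 <= t <= 1 -> 0 <= t * (t * b - 2 * a).
  move=> t01; have := pmin _ (mem_set (convexP convC Cp Cx t01)).
  have -> : p + t *: (x - p) - z = t *: (x - p) - (z - p).
    by rewrite opprB [p + _]addrC addrA.
  rewrite -[p - z]opprB dotpNl dotpNr opprK -aE -bE.
  move: (z - p) (x - p) => w v.
  by rewrite dotpBl !dotpBr !dotpZl !dotpZr (dotpC v w); lra.
pose t := Num.min 1 (a / (b + 1)).
have b1 : 0 < b + 1 by rewrite ltr_wpDl.
have t0 : 0 < t by rewrite lt_min ltr01 divr_gt0.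
have t1 : t <= 1 by rewrite ge_min lexx.
have tb : t * (b + 1) <= a by rewrite -ler_pdivlMr// ge_min lexx orbT.
have := key t; rewrite (ltW t0) t1 => /(_ isT); rewrite pmulr_rge0//.
by move: tb; rewrite mulrDr mulr1; lra.
Qed.

Lemma contact_nearest z p : ~ C z -> C p ->
  (forall x, C x -> dotp (z - p) (x - p) <= 0) ->
  [/\ 0 < enorm (z - p), contact C ((enorm (z - p))^-1 *: (z - p)) p &
    dotp ((enorm (z - p))^-1 *: (z - p)) (z - p) = enorm (z - p)].
Proof.
move=> nCz Cp h; have zp : z - p != 0.
  by apply: contra_notN nCz; rewrite subr_eq0 => /eqP ->.
have e0 : 0 < enorm (z - p) by rewrite enorm_gt0.
split => //; last by rewrite dotpZl -enorm_sqr expr2 mulKf// gt_eqF.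
split => //; first exact: enorm_unit.
by move=> x Cx; rewrite dotpZl pmulr_rle0 ?invr_gt0// h.
Qed.

(** A convex body is the intersection of its supporting half-spaces: projecting a point outside C
    onto C produces a contact that separates it. *)
Lemma mem_contact z : (forall m x, contact C m x -> dotp m (z - x) <= 0) -> C z.
Proof.
move=> h; apply: contrapT => nCz; have [p Cp ph] := nearest z.
have [e0 /h + e] := contact_nearest nCz Cp ph.
by rewrite e leNgt e0.
Qed.

Lemma closed_contact : closed [set p : V * V | contact C p.1 p.2].
Proof.
have -> : [set p : V * V | contact C p.1 p.2] =
  [set p : V * V | enorm p.1 = 1] `&` ((fun p : V * V => p.2) @^-1` C) `&`
  \bigcap_(z in C) [set p : V * V | dotp p.1 (z - p.2) <= 0].
  apply/seteqP; split => [p [? ? ?]|p [[? ?] ?]]; first by split.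
  by split => // z Cz; apply: (_ : (\bigcap_(z in C) _) p).
apply: closedI; first apply: closedI.
- apply: (@closed_comp _ _ (fun p : V * V => enorm p.1) [set 1]) => [p _|].
    by apply: continuous_comp; [exact: cvg_fst|exact: continuous_enorm].
  exact: closed_eq.
- apply: closed_comp; last exact: body_closed.
  by move=> p _; exact: cvg_snd.
- apply: closed_bigI => z _.
  apply: (@closed_comp _ _ (fun p : V * V => dotp p.1 (z - p.2)) [set y | y <= 0]) => [p _|].
    apply: continuous_dotp; first exact: cvg_fst.
    by apply: (@continuousB _ _ _ (fun=> z) snd); [exact: cst_continuous|exact: cvg_snd].
  exact: closed_le.
Qed.

Lemma compact_contact : compact [set p : V * V | contact C p.1 p.2].
Proof.
apply: (subclosed_compact closed_contact (B := [set u : V | `|u| <= 1] `*` C)).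
  apply: compact_setX => //; apply: bounded_closed_compact.
    exists 1; split => // x x1 y /= y1; exact: le_trans y1 (ltW x1).
  apply: (@closed_comp _ _ (fun u : V => `|u|) [set y | y <= 1]) => [u _|].
    exact: norm_continuous.
  exact: closed_le.
by move=> [m x] [/= m1 Cx _]; split => //=; rewrite -m1 norm_le_enorm.
Qed.

Lemma contact_trans m x y : contact C m x -> C y -> dotp m (y - x) = 0 -> contact C m y.
Proof.
move=> [m1 Cx h] Cy e; split => // z Cz.
by rewrite -(subrK x z) -addrA dotpDr -[x - y]opprB dotpNr e subr0 h.
Qed.

Lemma continuous_dotp_pair z : continuous (fun p : V * V => dotp p.1 (z - p.2)).
Proof.
move=> p; apply: continuous_dotp; first exact: cvg_fst.
by apply: (@continuousB _ _ _ (fun=> z) snd); [exact: cst_continuous|exact: cvg_snd].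
Qed.

(** A point of C without contact satisfies every supporting inequality strictly. Compactness of the
    normal bundle makes this uniform, so a ball around the point stays in C. Conversely, moving from
    x along a contact normal leaves C at once. *)
Lemma boundary_contact x : boundary C x <-> exists m, contact C m x.
Proof.
split => [[Cx nix]|[m [m1 Cx h]]].
  have {}Cx : C x by rewrite ((closure_id C).1 body_closed).
  apply: contrapT => /forallNP nm; apply: nix.
  have [|d d0 hd] := @compact_slack _ _ (fun p : V * V => dotp p.1 (x - p.2))
      compact_contact (continuous_subspaceT (@continuous_dotp_pair x)).
    move=> [m y] /= my; have [m1 Cy h] := my; rewrite lt_neqAle h// andbT.
    by apply/eqP => e; apply: (nm m); exact: contact_trans my Cx e.
  apply/nbhs_ballP; exists (d / 3); first by rewrite /= divr_gt0.
  move=> z; rewrite -ball_normE /= => xz; apply: mem_contact => m y my.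
  have := hd (m, y) my; rewrite /= => hy.
  rewrite -(subrK x z) -addrA dotpDr.
  have : dotp m (z - x) <= d.
    have [m1 _ _] := my; rewrite (le_trans (dotp_le _ _))// m1 mul1r.
    rewrite (le_trans (enorm_le_norm _))// distrC mulrC -ler_pdivlMr//.
    exact: ltW.
  by move=> hzx; rewrite (le_trans (lerD hzx hy))// subrr.
split; first exact: subset_closure.
move=> /nbhs_ballP[e /= e0 xe].
have : C (x + (e / 2) *: m).
  apply: xe; rewrite -ball_normE /= opprD addNKr normrN normrZ.
  rewrite gtr0_norm ?divr_gt0//; apply: (@le_lt_trans _ _ (e / 2)).
    by rewrite ler_piMr ?divr_ge0 ?(ltW e0)// -m1 norm_le_enorm.
  by rewrite gtr_pMr// invf_lt1// ltr1n.
move/h; rewrite addrC addKr dotpZr -enorm_sqr m1 expr1n mulr1.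
by rewrite leNgt divr_gt0.
Qed.

Lemma boundary_sub x : boundary C x -> C x.
Proof. by move=> /boundary_contact[m []]. Qed.

Lemma interior_slack c : C° c -> exists2 d, 0 < d &
  forall m x, contact C m x -> dotp m (c - x) <= - d.
Proof.
move=> /nbhs_ballP[e /= e0 ce]; exists (e / 2); first by rewrite divr_gt0.
move=> m x [m1 Cx h].
have : C (c + (e / 2) *: m).
  apply: ce; rewrite -ball_normE /= opprD addNKr normrN normrZ.
  rewrite gtr0_norm ?divr_gt0//; apply: (@le_lt_trans _ _ (e / 2)).
    by rewrite ler_piMr ?divr_ge0 ?(ltW e0)// -m1 norm_le_enorm.
  by rewrite gtr_pMr// invf_lt1// ltr1n.
move/h; rewrite addrAC (dotpDr (c - x)) dotpZr -enorm_sqr m1 expr1n mulr1.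
by rewrite -lerBrDr sub0r.
Qed.

Lemma body_bounded : exists2 L, 0 < L & forall x, C x -> `|x| < L.
Proof.
have /compact_bounded[M [_ h]] := compC.
exists (`|M| + 2) => [|x Cx]; first by rewrite ltr_wpDl.
have := h (`|M| + 1); rewrite ltr_pwDr ?ler_norm// => /(_ isT x Cx)/le_lt_trans; apply.
by rewrite ltrD2l ltr1n.
Qed.

Lemma nearest_unique z p q : C p -> C q ->
  (forall x, C x -> dotp (z - p) (x - p) <= 0) ->
  (forall x, C x -> dotp (z - q) (x - q) <= 0) -> p = q.
Proof.
move=> Cp Cq hp hq; apply/eqP; rewrite -subr_eq0 -dotpp_eq0 eq_le dotpp_ge0 andbT.
have := hp _ Cq; have := hq _ Cp; rewrite !dotpBl !dotpBr (dotpC q p).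
by move: (dotp z p) (dotp z q) (dotp p p) (dotp q q) (dotp p q); move=> *; lra.
Qed.

Lemma nearest_lipschitz z z' p q : C p -> C q ->
  (forall x, C x -> dotp (z - p) (x - p) <= 0) ->
  (forall x, C x -> dotp (z' - q) (x - q) <= 0) -> enorm (p - q) <= enorm (z - z').
Proof.
move=> Cp Cq hp hq; have [->|pq] := eqVneq p q; first by rewrite subrr enorm0 enorm_ge0.
have pq0 : 0 < enorm (p - q) by rewrite enorm_gt0 subr_eq0.
rewrite -(ler_pM2r pq0); apply: le_trans (dotp_le _ _).
rewrite -expr2 enorm_sqr; have := hp _ Cq; have := hq _ Cp.
rewrite !dotpBl !dotpBr (dotpC q p).
move: (dotp z p) (dotp z q) (dotp z' p) (dotp z' q) (dotp p p) (dotp q q) (dotp p q).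
by move=> *; lra.
Qed.

Let cube_face (L s : R) (i : 'I_3) (u : 'rV[R]_2) : V :=
  \row_k (if k == i then s else if k == i + 1 then L * (2 * u 0 0 - 1) else L * (2 * u 0 1 - 1)).

Let cube_face_lipschitz (L s : R) i u v : 0 < L ->
  enorm (cube_face L s i u - cube_face L s i v) <= 6 * L * `|u - v|.
Proof.
move=> L0; rewrite (le_trans (enorm_le_norm _))//.
rewrite (_ : 6 * L * `|u - v| = 3 * (2 * L * `|u - v|)); last ring.
rewrite ler_wpM2l//; apply: norm_rV_le => [|k]; first by rewrite !mulr_ge0// ltW.
have h j : `|L * (2 * u 0 j - 1) - L * (2 * v 0 j - 1)| <= 2 * L * `|u - v|.
  rewrite (_ : _ - _ = 2 * L * (u 0 j - v 0 j)); last ring.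
  rewrite normrM ger0_norm ?mulr_ge0 ?(ltW L0)// ler_wpM2l ?mulr_ge0 ?(ltW L0)//.
  by have := coord_le_norm (u - v) j; rewrite !mxE.
rewrite !mxE; case: ifP => _; last by case: ifP => _; exact: h.
by rewrite subrr normr0 !mulr_ge0// ltW.
Qed.

Let cube_face_surj (L : R) (z : V) : 0 < L -> `|z| = L -> exists i s u,
  (s = L \/ s = - L) /\ unit_square u /\ z = cube_face L s i u.
Proof.
move=> L0 zL.
have z0 : `|z| != 0 by rewrite zL gt_eqF.
have [[a i] /= zi] := mx_norm_neq0 z0; rewrite ord1 {a} in zi.
have zc k : - L <= z 0 k <= L by rewrite -ler_norml -zL coord_le_norm.
exists i, (z 0 i), (vec2 ((z 0 (i + 1) / L + 1) / 2) ((z 0 (i + 2) / L + 1) / 2)).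
split.
  have : `|z 0 i| = L by rewrite -zi -zL.
  by case: (ger0P (z 0 i)) => _ <-; [left|right; rewrite opprK].
have bnd k : 0 <= (z 0 k / L + 1) / 2 <= 1.
  have /andP[h1 h2] := zc k.
  have h3 : z 0 k / L <= 1 by rewrite ler_pdivrMr// mul1r.
  have h4 : - 1 <= z 0 k / L by rewrite ler_pdivlMr// mulN1r.
  by move: h3 h4; move: (z 0 k / L); move=> *; lra.
split; first by split; rewrite mxE /=; exact: bnd.
have val_in k : L * (2 * ((z 0 k / L + 1) / 2) - 1) = z 0 k.
  by field; rewrite gt_eqF.
apply/rowP => k; rewrite !mxE /= !val_in.
case: eqP => [->//|ki]; case: eqP => [->//|ki1].
by congr (z 0 _); case: i k ki ki1 {zi} => -[|[|[|//]]] ? [] [|[|[|//]]] ? ki ki1;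
  apply/val_inj => //=; exfalso; (apply: ki + apply: ki1); exact: val_inj.
Qed.

(** C lies inside a cube, and its boundary is covered by the projections of the six faces. The
    projection is 1-Lipschitz, so each piece is a Lipschitz image of the unit square. *)
Lemma boundary_area_fin : (hausdorff2 (boundary C) < +oo)%E.
Proof.
have [L L0 CL] := body_bounded.
have /choice[pr prP] : forall z, exists p, C p /\ forall x, C x -> dotp (z - p) (x - p) <= 0.
  by move=> z; have [p Cp h] := nearest z; exists p.
pose A i s := [set pr (cube_face L s i u) | u in unit_square].
have Afin i s : (hausdorff2 (A i s) < +oo)%E.
  apply: (@area_finite _ (fun u => pr (cube_face L s i u)) (6 * L)).
    by rewrite mulr_ge0// ltW.
  move=> u v _ _; apply: (le_trans _ (cube_face_lipschitz _ _ _ _ L0)).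
  have [Cu hu] := prP (cube_face L s i u); have [Cv hv] := prP (cube_face L s i v).
  exact: nearest_lipschitz Cu Cv hu hv.
have cover : boundary C `<=` \bigcup_(k in `I_3)
    (A (inord k) L `|` A (inord k) (- L)).
  move=> x /boundary_contact[m [m1 Cx h]].
  (* The ray from x along the normal m meets the surface of the cube, and x is the nearest point of
     C to the point reached. At parameter 6 L the ray has left the cube, since the sup norm of m is
     at least 1/3. *)
  have [t [t0 tL]] : exists t, 0 <= t /\ `|x + t *: m| = L.
    pose g (t : R) := `|x + t *: m|.
    have gc : continuous g.
      apply: (@lipschitz_continuous _ _ _ _ 1) => // s t; rewrite mul1r.
      rewrite (le_trans (ler_dist_dist _ _))// opprD addrACA subrr add0r -scalerBl.
      by rewrite normrZ ler_piMr// -m1 norm_le_enorm.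
    have T0 : 0 <= 6 * L by rewrite mulr_ge0// ltW.
    have gT : L <= g (6 * L).
      rewrite /g; have := enorm_le_norm m; rewrite m1.
      have : `|(6 * L) *: m| <= `|x + (6 * L) *: m| + `|x|.
        by rewrite -{1}(addKr x ((6 * L) *: m)) addrC (le_trans (ler_normB _ _)).
      rewrite normrZ ger0_norm//; have := CL _ Cx; have := normr_ge0 m.
      by move: `|m| `|x| `|_ + _| L0 => a b c L0 *; nra.
    have := @IVT R g 0 (6 * L) L T0 (continuous_subspaceT gc).
    have g0 : g 0 <= L by rewrite /g scale0r addr0 ltW// CL.
    rewrite (min_l (le_trans g0 gT)) (max_r (le_trans g0 gT)) g0 gT => /(_ isT)[t].
    by rewrite in_itv /= => /andP[t0 _] gt; exists t.
  have [i [s [u [sL [Su zE]]]]] := cube_face_surj L0 tL.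
  have xE : pr (cube_face L s i u) = x.
    rewrite -zE; have [Cp hp] := prP (x + t *: m).
    apply: nearest_unique Cp Cx hp _ => y Cy.
    by rewrite addrC addKr dotpZl mulr_ge0_le0// h.
  exists (val i) => /=; first exact: ltn_ord.
  by rewrite inord_val; case: sL => sE; rewrite sE in xE; [left|right]; exists u.
apply: (le_lt_trans (le_outer_measure _ _ _ cover)).
rewrite bigcup_mkord !big_ord_recr big_ord0 /= set0U.
have fin2 (X Y : set V) : (hausdorff2 X < +oo -> hausdorff2 Y < +oo ->
    hausdorff2 (X `|` Y) < +oo)%E.
  move=> hX hY; apply: (le_lt_trans (outer_measureU2 _ _ _)).
  exact: lte_add_pinfty.
by apply: (fin2); [apply: (fin2)|]; (apply: fin2; exact: Afin).
Qed.

(** The last point of C on the segment from an interior point c to o belongs to it: it lies on the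
    boundary of C, and the homothety with centre o that sends c to this point sends a ball of C
    around c into the hull. *)
Lemma boundary_minus_nonempty o : ~ C o -> boundary_minus C o !=set0.
Proof.
move=> nCo; have [_ _ [c ci]] := bodyC.
have Cc : C c by exact: interior_subset ci.
pose g (t : R) := c + t *: (o - c).
have gc : continuous g.
  apply: (@lipschitz_continuous _ _ _ _ (`|o - c| + 1)) => [|s t].
    by rewrite ltr_wpDl.
  rewrite /g opprD addrACA subrr add0r -scalerBl normrZ mulrC.
  by rewrite ler_wpM2r// lerDl.
pose I := [set t : R | 0 <= t <= 1] `&` g @^-1` C.
have cI : compact I.
  apply: (subclosed_compact _ (@segment_compact _ 0 1)); last first.
    by move=> t [t01 _]; rewrite /= in_itv.
  apply: closedI.
    rewrite (_ : [set t : R | _] = [set` `[0, 1]]); first exact: itv_closed.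
    by apply/seteqP; split => t; rewrite /= in_itv.
  by apply: closed_comp; [move=> t _; exact: gc|exact: body_closed].
have I0 : I !=set0 by exists 0; split; rewrite /= ?lexx ?ler01// /g scale0r addr0.
have [t /set_mem[/andP[t0 t1] Ct] tmax] := compact_EVT_max I0 cI (continuous_subspaceT (fun x => @cvg_id _ (nbhs x))).
have t11 : t < 1.
  rewrite lt_neqAle t1 andbT; apply: contra_notN nCo => /eqP t_1.
  by move: Ct; rewrite t_1 /= /g scale1r addrC subrK.
exists (g t); split.
  split; first exact: subset_closure.
  move=> /nbhs_ballP[e /= e0 ge].
  pose s := Num.min (1 - t) (e / (2 * (`|o - c| + 1))).
  have oc1 : 0 < `|o - c| + 1 by rewrite ltr_wpDl.
  have s0 : 0 < s by rewrite lt_min subr_gt0 t11 divr_gt0// mulr_gt0.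
  have s1 : s <= 1 - t by rewrite ge_min lexx.
  have se : s * (2 * (`|o - c| + 1)) <= e.
    by rewrite -ler_pdivlMr ?ge_min ?lexx ?orbT// mulr_gt0.
  have : I (t + s).
    split; first by apply/andP; split; [rewrite addr_ge0// ltW|rewrite -lerBrDl].
    apply: ge; rewrite -ball_normE /= /g scalerDl addrA opprD addNKr normrN normrZ.
    rewrite gtr0_norm//; move: se s0 e0 (normr_ge0 (o - c)).
    by move: `|o - c|; move=> *; nra.
  by move=> /mem_set/tmax; rewrite gerDl leNgt s0.
have /nbhs_ballP[e /= e0 ce] : nbhs c C by [].
apply/nbhs_ballP; exists ((1 - t) * e); first by rewrite /= mulr_gt0// subr_gt0.
have t1' : 0 < 1 - t by rewrite subr_gt0.
move=> y; rewrite -ball_normE /= => gy X [cX CX].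
have [v vE] : exists v, (1 - t) *: v = y - g t.
  by exists ((1 - t)^-1 *: (y - g t)); rewrite scalerA mulfV ?gt_eqF// scale1r.
have Cv : C (c + v).
  apply: ce; rewrite -ball_normE /= opprD addNKr normrN -(ltr_pM2l t1').
  by rewrite -[X in X * `|v|]gtr0_norm// -normrZ vE distrC.
have -> : y = (c + v) + t *: (o - (c + v)).
  apply/rowP => k; have := congr1 (fun w : V => w 0 k) vE.
  by rewrite /g !mxE; lra.
apply: (convexP cX) => //; rewrite ?t0//; apply: CX; [by left|by right].
Qed.

End body.

End convex_bodies.

(** * Charts of strictly convex caps *)

Section cross_product.
Context {R : realType}.
Local Notation V := 'rV[R]_3.
Implicit Types a b c d : V.

Let ord3 : [/\ (1 + 1 = 2 :> 'I_3), (1 + 2 = 0 :> 'I_3), (2 + 1 = 0 :> 'I_3) & (2 + 2 = 1 :> 'I_3)].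
Proof. by split; exact: val_inj. Qed.

Lemma dotp3E a b : dotp a b = a 0 0 * b 0 0 + a 0 1 * b 0 1 + a 0 2 * b 0 2.
Proof.
rewrite /dotp !big_ord_recl big_ord0 addr0 addrA.
by congr (_ * _ + _ * _ + _ * _); congr (_ 0 _); exact: val_inj.
Qed.

Lemma crossE a b : ((cross a b 0 0 = a 0 1 * b 0 2 - a 0 2 * b 0 1) *
  (cross a b 0 1 = a 0 2 * b 0 0 - a 0 0 * b 0 2) *
  (cross a b 0 2 = a 0 0 * b 0 1 - a 0 1 * b 0 0))%type.
Proof. by have [e1 e2 e3 e4] := ord3; rewrite !mxE !add0r e1 e2 e3 e4. Qed.

Lemma rV3P a b : a 0 0 = b 0 0 -> a 0 1 = b 0 1 -> a 0 2 = b 0 2 -> a = b.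
Proof.
move=> h0 h1 h2; apply/rowP => -[[|[|[|//]]] i].
- by rewrite (_ : Ordinal i = 0)//; exact: val_inj.
- by rewrite (_ : Ordinal i = 1)//; exact: val_inj.
- by rewrite (_ : Ordinal i = 2)//; exact: val_inj.
Qed.

Lemma dotp_crossl a b : dotp (cross a b) a = 0.
Proof. by rewrite dotp3E !crossE; ring. Qed.

Lemma dotp_crossr a b : dotp (cross a b) b = 0.
Proof. by rewrite dotp3E !crossE; ring. Qed.

Lemma lagrange a b : dotp (cross a b) (cross a b) =
  dotp a a * dotp b b - dotp a b ^+ 2.
Proof. by rewrite !dotp3E !crossE; ring. Qed.

(** Cramer's rule in the plane spanned by a and b, cleared of its denominator. *)
Lemma cross_span a b c : dotp (cross a b) c = 0 ->
  dotp (cross a b) (cross a b) *: c =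
  dotp (cross c b) (cross a b) *: a + dotp (cross a c) (cross a b) *: b.
Proof.
rewrite dotp3E => h.
have e i : (cross a b) 0 i * (cross a b 0 0 * c 0 0 + cross a b 0 1 * c 0 1 + cross a b 0 2 * c 0 2) = 0.
  by rewrite h mulr0.
move: (e 0) (e 1) (e 2); rewrite !dotp3E !crossE => e0 e1 e2.
by apply: rV3P; rewrite !mxE;
  [rewrite -[LHS]subr0 -e0|rewrite -[LHS]subr0 -e1|rewrite -[LHS]subr0 -e2]; ring.
Qed.

Lemma rVD n (u v : 'rV[R]_n) i : (u + v) 0 i = u 0 i + v 0 i.
Proof. by rewrite mxE. Qed.

Lemma rVZ n (u : 'rV[R]_n) s i : (s *: u) 0 i = s * u 0 i.
Proof. by rewrite mxE. Qed.

Lemma rVlin n (u v : 'rV[R]_n) s t i : (s *: u + t *: v) 0 i = s * u 0 i + t * v 0 i.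
Proof. by rewrite rVD !rVZ. Qed.

(* The second fundamental form as the differential of the normal cross a b. *)
Lemma weingarten (a b q0 q1 q2 : V) s x y :
  dotp (x *: (s *: (cross a q1 + cross q0 b)) + y *: (s *: (cross a q2 + cross q1 b)))
    (x *: a + y *: b) =
  - dotp (s *: cross a b) q0 * x ^+ 2 + 2 * - dotp (s *: cross a b) q1 * x * y +
  - dotp (s *: cross a b) q2 * y ^+ 2.
Proof. by rewrite !dotp3E !(rVD, rVZ) !crossE; ring. Qed.

Lemma sqr_norm_le (u : 'rV[R]_2) : `|u| ^+ 2 <= u 0 0 ^+ 2 + u 0 1 ^+ 2.
Proof.
have h : `|u| <= Num.sqrt (u 0 0 ^+ 2 + u 0 1 ^+ 2).
  apply: norm_rV_le => [|i]; first exact: sqrtr_ge0.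
  rewrite -sqrtr_sqr ler_sqrt ?addr_ge0 ?sqr_ge0//.
  have [->|->] : i = 0 \/ i = 1.
    by case: i => -[|[|//]] ?; [left|right]; exact: val_inj.
  - by rewrite lerDl sqr_ge0.
  - by rewrite lerDr sqr_ge0.
by rewrite -ler_sqrt ?addr_ge0 ?sqr_ge0// sqrtr_sqr normr_id.
Qed.

Lemma ball_segment n (x y z : 'rV[R]_n) rho t : `|x - z| < rho -> `|y - z| < rho ->
  0 <= t <= 1 -> `|x + t *: (y - x) - z| < rho.
Proof.
move=> xr yr /andP[t0 t1].
have -> : x + t *: (y - x) - z = (1 - t) *: (x - z) + t *: (y - z).
  by apply/rowP => i; rewrite !mxE; ring.
rewrite (le_lt_trans (ler_normD _ _))// !normrZ !ger0_norm ?subr_ge0//.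
have [->|tpos] := eqVneq t 0; first by rewrite subr0 mul1r mul0r addr0.
have : t * `|y - z| < t * rho by rewrite ltr_pM2l// lt_neqAle eq_sym tpos.
have : (1 - t) * `|x - z| <= (1 - t) * rho by rewrite ler_wpM2l ?subr_ge0// ltW.
lra.
Qed.

End cross_product.

Section charts.
Context {R : realType}.
Local Notation U := 'rV[R]_2.
Local Notation V := 'rV[R]_3.

Definition rows2 (a b : V) : 'M[R]_(2, 3) := \matrix_(i, j) (if i == 0 then a 0 j else b 0 j).

Lemma mul_rows2 (h : U) a b : h *m rows2 a b = h 0 0 *: a + h 0 1 *: b.
Proof. by apply/rowP => j; rewrite !mxE !big_ord_recl big_ord0 addr0 !mxE /=; congr (_ + _ * _); congr (h 0 _); exact: val_inj. Qed.

(* A regular parametrization r of a strictly convex cap of the boundary of C,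
   with (unnormalized) outer normal N; B and A are the matrices of dr and dN. *)
Record cap_chart (C : set V) (r N : U -> V) (B A : U -> 'M[R]_(2, 3)) (x0 : U)
    (rho c K : R) : Prop := CapChart {
  cap_rho : 0 < rho;
  cap_c : 0 < c;
  cap_K : 0 < K;
  cap_r : forall x, `|x - x0| < rho -> sdiff r x (fun h => h *m B x);
  cap_N : forall x, `|x - x0| < rho -> sdiff N x (fun h => h *m A x);
  cap_ortho : forall x h, `|x - x0| < rho -> dotp (N x) (h *m B x) = 0;
  cap_span : forall x k, `|x - x0| < rho -> dotp (N x) k = 0 ->
    exists h, k = h *m B x;
  cap_quad : forall x y, `|x - x0| < rho -> `|y - x0| < rho ->
    dotp (N x) (r y - r x) <= - c * `|y - x| ^+ 2;
  cap_contact : forall x, `|x - x0| < rho ->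
    contact C ((enorm (N x))^-1 *: N x) (r x);
  cap_open : forall O, open O -> O `<=` [set x | `|x - x0| < rho] ->
    rel_open (boundary C) (r @` O);
  cap_lipr : forall x y, `|x - x0| < rho -> `|y - x0| < rho ->
    `|r y - r x| <= K * `|y - x|;
  cap_lipN : forall x y, `|x - x0| < rho -> `|y - x0| < rho ->
    `|N y - N x| <= K * `|y - x|;
  cap_boundN : forall x, `|x - x0| < rho -> `|N x| <= K;
  cap_pos : forall x, `|x - x0| < rho -> K^-1 <= dotp (N x) (N x0) }.

Lemma dotp_norm_le (u v : V) : `|dotp u v| <= 3 * (`|u| * `|v|).
Proof.
rewrite dotp3E (le_trans (ler_normD _ _))// (le_trans (lerD (ler_normD _ _) (lexx _)))//.
have h i : `|u 0 i * v 0 i| <= `|u| * `|v| by rewrite normrM ler_pM// coord_le_norm.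
have := h 0; have := h 1; have := h 2; lra.
Qed.

(* At a point where a C^1 map takes its values in the half-space below its
   value there, the normal of the half-space annihilates the derivative. *)
Lemma sdiff_max (f : U -> R) (l : U -> R) x : sdiff f x l ->
  (forall a h, l (a *: h) = a * l h) -> (\forall y \near x, f y <= f x) ->
  forall h, l h = 0.
Proof.
move=> [_ sf] lZ fx.
suff le h : l h <= 0.
  move=> h; apply/eqP; rewrite eq_le le /=.
  by have := le (-1 *: h); rewrite lZ mulN1r oppr_le0.
apply/ler_addgt0Pl => e e0; rewrite addr0.
have h1 : 0 < `|h| + 1 by rewrite ltr_wpDl.
have e1 : 0 < e / (`|h| + 1) by rewrite divr_gt0.
have /near_pair[d d0 {}sf] := sf _ e1.
have /nbhs_ballP[d' /= d'0 {}fx] := fx.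
pose s := Num.min d d' / (`|h| + 1) / 2.
have m0 : 0 < Num.min d d' by rewrite lt_min d0.
have s0 : 0 < s by rewrite !divr_gt0.
have sh : `|s *: h| < Num.min d d'.
  rewrite normrZ gtr0_norm// /s -mulrA mulrAC -mulrA gtr_pMr//.
  by rewrite mulrA ltr_pdivrMr// mul1r ltr_pdivrMr//; have := normr_ge0 h; lra.
move: sh; rewrite lt_min => /andP[shd shd'].
have := sf (x + s *: h) x; rewrite subrr normr0 addrAC subrr add0r /= => /(_ shd d0).
have : f (x + s *: h) <= f x.
  by apply: fx; rewrite -ball_normE /= opprD addNKr normrN.
rewrite lZ ler_norml normrZ (gtr0_norm s0) => h2 /andP[h3 _].
have : s * l h <= s * (e / (`|h| + 1) * `|h|) by lra.
rewrite ler_pM2l// => /le_trans; apply.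
by rewrite mulrAC ler_pdivrMr// ler_wpM2l ?(ltW e0)// lerDl.
Qed.

Lemma sdiff_unit_normal (f : U -> V) (B : 'M[R]_(2, 3)) (m : V) x :
  sdiff f x (fun h => h *m B) -> (\forall y \near x, dotp m (f y - f x) <= 0) ->
  forall h, dotp m (h *m B) = 0.
Proof.
move=> sf fm.
have := @sdiff_max (fun y => dotp m (f y)) (fun h => dotp m (h *m B) + dotp 0 (f x)) x.
move=> H h; rewrite -[LHS]addr0 -[X in _ + X](dotp0l (f x)); move: h; apply: H.
- exact: sdiff_dotp (sdiff_cst _ _) sf.
- by move=> a h; rewrite !dotp0l !addr0 -scalemxAl dotpZr.
- by near=> y; rewrite -subr_le0 -dotpBr; near: y.
Unshelve. all: by end_near. Qed.

(** The vector m is proportional to n because it vanishes on the orthogonal complement of n; the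
    point z decides the sign. *)
Lemma unit_collinear (n m z : V) : enorm m = 1 -> dotp n z < 0 -> dotp m z <= 0 ->
  (forall k, dotp n k = 0 -> dotp m k = 0) -> m = (enorm n)^-1 *: n.
Proof.
move=> m1 nz mz mk; have n0 : n != 0.
  by apply: contraTneq nz => ->; rewrite dotp0l ltxx.
have nn : dotp n n != 0 by rewrite dotpp_eq0.
pose a := dotp m n / dotp n n.
have mE : m = a *: n.
  apply/eqP; rewrite -subr_eq0 -dotpp_eq0; set k := m - _.
  have nk : dotp n k = 0.
    by rewrite dotpBr dotpZr /a (dotpC m) divfK// subrr.
  by rewrite {1}/k dotpBl dotpZl (mk _ nk) nk mulr0 subr0.
have a0 : 0 <= a by move: mz; rewrite mE dotpZl nmulr_lle0.
have : a * enorm n = 1 by rewrite -[a]ger0_norm// -enormZ -mE.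
by move=> an; rewrite mE; congr (_ *: _); rewrite -[RHS]mul1r -an mulfK// enorm_eq0.
Qed.

(** The determinant over the trace bounds the smaller eigenvalue from below. The difference of the
    two sides, times the trace, is (a x + b y)^2 + (b x + d y)^2. *)
Lemma quadratic_lower (a b d x y : R) : 0 < a -> 0 < d -> 0 < a * d - b ^+ 2 ->
  (a * d - b ^+ 2) / (a + d) * (x ^+ 2 + y ^+ 2) <=
  a * x ^+ 2 + 2 * b * x * y + d * y ^+ 2.
Proof.
move=> a0 d0 D0; rewrite mulrAC ler_pdivrMr ?addr_gt0//.
have := addr_ge0 (sqr_ge0 (a * x + b * y)) (sqr_ge0 (b * x + d * y)); lra.
Qed.

Lemma second_order (g g' : R -> R) (a s : R) : 0 <= s ->
  (forall t : R, 0 <= t <= s -> is_derive t 1 g (g' t)) ->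
  (forall t, 0 <= t <= s -> a * t <= g' t) -> a * (s ^+ 2 / 2) <= g s - g 0.
Proof.
move=> s0 dg ag.
have [|t] := @mvt_line _ (fun t => g t - (a / 2) *: (t * t)) (fun t => g' t - (a / 2) *: (t + t)) s.
  move=> t; rewrite min_l// max_r// => /dg d.
  apply: is_deriveB; apply: is_deriveZ.
  apply: is_derive_eq (is_deriveM (is_derive_id _ _) (is_derive_id _ _)) _.
  by rewrite -[LHS]/(t * 1 + t * 1) mulr1.
rewrite min_l// max_r// => /ag h e.
suff : g s - a / 2 * (s * s) - (g 0 - a / 2 * (0 * 0)) >= 0 by lra.
rewrite [leRHS]e mulr_ge0// subr_ge0 (le_trans _ h)//.
by rewrite -[leLHS]/(a / 2 * (t + t)); lra.
Qed.

Let chart_arith (e K c t W d1 d2 d3 : R) :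
  - (3 * (e * t * W * (K * W))) <= d1 ->
  e * (9 * K) * (t * (W * W)) <= 2 * c * (t * (W * W)) ->
  t * (4 * c * (W * W)) <= t * d3 -> t * - (3 * (K * W * (2 * (e * W)))) <= t * d2 ->
  2 * c * (W * W) * t <= d1 + t * d3 + t * d2.
Proof. by move=> *; lra. Qed.

Section chart_at.
Variables (C : set V) (bodyC : convex_body C) (O : set U) (r : U -> V) (x1 : U).
Variables (p : 'I_2 -> U -> V) (q : 'I_2 -> 'I_2 -> U -> V).
Hypotheses (oO : open O) (Ox1 : O x1).
Hypothesis sr : forall x, O x -> sdiff r x (fun h => h 0 0 *: p 0 x + h 0 1 *: p 1 x).
Hypothesis sp : forall i x, O x ->
  sdiff (p i) x (fun h => h 0 0 *: q i 0 x + h 0 1 *: q i 1 x).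
Hypothesis sym : q 0 1 x1 = q 1 0 x1.
Hypothesis reg : forall x, O x -> cross (p 0 x) (p 1 x) != 0.
Hypothesis relO : forall W, open W -> W `<=` O -> rel_open (boundary C) (r @` W).
Let n x := cross (p 0 x) (p 1 x).
Hypothesis curv : dotp (q 0 1 x1) (n x1) ^+ 2 < dotp (q 0 0 x1) (n x1) * dotp (q 1 1 x1) (n x1).

Let B x := rows2 (p 0 x) (p 1 x).
Let A sigma x := rows2 (sigma *: (cross (p 0 x) (q 1 0 x) + cross (q 0 0 x) (p 1 x)))
                       (sigma *: (cross (p 0 x) (q 1 1 x) + cross (q 0 1 x) (p 1 x))).

Let srB x : O x -> sdiff r x (fun h => h *m B x).
Proof. by move=> Ox; apply: sdiff_ext (sr Ox) _ => h; rewrite mul_rows2. Qed.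

Let sN sigma x : O x -> sdiff (fun x => sigma *: n x) x (fun h => h *m A sigma x).
Proof.
move=> Ox; have s := sdiffZ (sdiff_cst sigma x) (sdiff_cross (sp 0 Ox) (sp 1 Ox)).
apply: sdiff_ext s _ => h; rewrite mul_rows2.
by apply: rV3P; rewrite !mxE /=; ring.
Qed.

Let nB x h : dotp (n x) (h *m B x) = 0.
Proof. by rewrite mul_rows2 dotpDr !dotpZr dotp_crossl dotp_crossr !mulr0 addr0. Qed.

Let spanB x k : O x -> dotp (n x) k = 0 -> exists h, k = h *m B x.
Proof.
move=> Ox /cross_span e; have nn : dotp (n x) (n x) != 0 by rewrite dotpp_eq0 reg.
exists (vec2 (dotp (cross k (p 1 x)) (n x) / dotp (n x) (n x))
             (dotp (cross (p 0 x) k) (n x) / dotp (n x) (n x))).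
apply: (scalerI nn); rewrite mul_rows2 e !mxE /= scalerDr !scalerA.
by rewrite !(mulrC (dotp (n x) (n x))) !divfK.
Qed.

Let Br x : O x -> boundary C (r x).
Proof.
move=> Ox; have [//|W _ e] := relO oO.
by have : (r @` O) (r x); [exists x|rewrite e => -[]].
Qed.

Let contactB m x : O x -> contact C m (r x) -> forall k, dotp (n x) k = 0 -> dotp m k = 0.
Proof.
move=> Ox [_ _ mC] k /(spanB Ox)[h ->].
apply: (sdiff_unit_normal (srB Ox)).
have : \forall y \near x, O y by exact: open_nbhs_nbhs.
by apply: filterS => y /Br/(boundary_sub bodyC)/mC.
Qed.

(** Along the first coordinate line the function [dotp m (r _)] is maximal at x1. Its derivative
    vanishes there and grows at the rate [dotp m (q 0 0 x1)], which therefore cannot be positive.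
    One diagonal entry suffices to fix the sign of a definite form. *)
Lemma second_form_le0 : forall m, contact C m (r x1) -> dotp m (q 0 0 x1) <= 0.
Proof.
move=> m mx; have [m1 _ mC] := mx.
apply/ler_addgt0Pl => e e0; rewrite addr0.
have sf x : O x -> sdiff (fun y => dotp m (r y)) x (fun h => h 0 0 * dotp m (p 0 x) + h 0 1 * dotp m (p 1 x)).
  move=> Ox; apply: sdiff_ext (sdiff_dotp (sdiff_cst m x) (sr Ox)) _ => h.
  by rewrite dotp0l addr0 dotpDr !dotpZr.
have [_ /(_ _ e0)/near_pair[d d0 sg]] := sdiff_dotp (sdiff_cst m x1) (sp 0 Ox1).
have /nbhs_ballP[d' /= d'0 xO] := open_nbhs_nbhs (conj oO Ox1).
pose s := Num.min d d' / 2.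
have m0 : 0 < Num.min d d' by rewrite lt_min d0.
have s0 : 0 < s by rewrite divr_gt0.
have : s < Num.min d d' by rewrite gtr_pMr// invf_lt1// ltr1n.
rewrite lt_min => /andP[sd sd'].
pose w : U := delta_mx 0 0.
have wt t : 0 <= t <= s -> `|x1 + t *: w - x1| <= s.
  move=> /andP[t0 ts]; rewrite addrAC subrr add0r normrZ ger0_norm//.
  by apply: le_trans ts; rewrite ler_piMr// norm_rV_le// => i; rewrite mxE /=; case: (i == 0); rewrite ?normr0 ?normr1.
have wO t : 0 <= t <= s -> O (x1 + t *: w).
  by move=> /wt h; apply: xO; rewrite -ball_normE /= distrC (le_lt_trans h).
have p0 : dotp m (p 0 x1) = 0.
  by apply: (contactB Ox1 mx); rewrite dotp_crossl.
have s0' : 0 <= s <= s by rewrite lexx ltW.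
have ss : 0 < s ^+ 2 / 2 by rewrite divr_gt0// exprn_gt0.
rewrite -subr_le0 -(pmulr_lle0 _ ss).
apply: (@le_trans _ _ (dotp m (r (x1 + s *: w)) - dotp m (r (x1 + 0 *: w)))); last first.
  rewrite scale0r addr0 -dotpBr mC//.
  by apply: (boundary_sub bodyC); apply: Br; apply: wO.
apply: (second_order (g := fun t => dotp m (r (x1 + t *: w)))
  (g' := fun t => dotp m (p 0 (x1 + t *: w)))) => [|t ts|t ts].
- exact: ltW.
- have := sdiff_segment _ (sf _ (wO _ ts)).
  rewrite (_ : w 0 0 * _ + _ = dotp m (p 0 (x1 + t *: w))) => [|].
    by apply => a h; rewrite !mxE; ring.
  by rewrite !mxE /=; ring.
have /= := sg (x1 + t *: w) x1 (le_lt_trans (wt _ ts) sd).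
have -> : x1 + t *: w - x1 = t *: w by rewrite addrAC subrr add0r.
rewrite subrr normr0 p0 subr0 dotp0l addr0 => /(_ d0).
rewrite !mxE /= mulr1 mulr0 scale0r addr0 dotpZr normrZ => h.
have t0 : 0 <= t by case/andP : ts.
have w1 : `|w| <= 1.
  by rewrite norm_rV_le// => i; rewrite mxE /=; case: (i == 0); rewrite ?normr0 ?normr1.
have : e * (`|t| * `|w|) <= e * t.
  by rewrite ler_wpM2l ?(ltW e0)// ger0_norm// ler_piMr.
by move: h; rewrite ler_norml => /andP[]; lra.
Qed.

(** Positive curvature makes the second fundamental form definite, and convexity of C fixes its
    sign. To carry the quadratic estimate from x1 to a ball, differentiate
    [- dotp (N x) (r (x + t *: w))] in t: the tangent vector is orthogonal to the normal at the
    moving point z, so the derivative is the product of N z - N x with [w *m B z], which is close to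
    t times the form at x1. *)
Lemma cap_chart_at : exists N A' rho c K,
  cap_chart C r N B A' x1 rho c K /\ forall x, `|x - x1| < rho -> O x.
Proof.
have [_ _ [c0 c0i]] := bodyC.
have [m1 m1x] : exists m, contact C m (r x1) by apply/(boundary_contact bodyC); exact: Br.
have nn x : O x -> 0 < dotp (n x) (n x) by move=> Ox; rewrite lt_neqAle eq_sym dotpp_eq0 reg// dotpp_ge0.
(* The sign that turns the cross product outward: a supporting normal at r x1 is a multiple of
   [n x1] and has a negative product with c0 - r x1, since c0 is interior. *)
have [sigma [s2 sc]] : exists sigma : R, sigma ^+ 2 = 1 /\ dotp (sigma *: n x1) (c0 - r x1) < 0.
  have [d d0 /(_ _ _ m1x) hd] := interior_slack c0i.
  have [a aE] : exists a, m1 = a *: n x1.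
    exists (dotp m1 (n x1) / dotp (n x1) (n x1)); apply/eqP; rewrite -subr_eq0 -dotpp_eq0.
    set k := m1 - _; have nk : dotp (n x1) k = 0.
      by rewrite dotpBr dotpZr (dotpC m1) divfK ?subrr// gt_eqF// nn.
    by rewrite {1}/k dotpBl dotpZl (contactB Ox1 m1x nk) nk mulr0 subr0.
  have hd0 : a * dotp (n x1) (c0 - r x1) < 0 by rewrite -dotpZl -aE; lra.
  have [a0|a0] := ltP 0 a.
    by exists 1; rewrite expr1n scale1r; split => //; rewrite -(pmulr_rlt0 _ a0).
  exists (-1); rewrite sqrrN expr1n scaleN1r dotpNl oppr_lt0; split => //.
  by rewrite ltNge; apply/negP => h; have := mulr_le0 a0 h; lra.
pose N x := sigma *: n x.
have NN x : dotp (N x) (N x) = dotp (n x) (n x) by rewrite dotpZl dotpZr mulrA -expr2 s2 mul1r.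
have NN1 : 0 < dotp (N x1) (N x1) by rewrite NN nn.
have s0 : sigma != 0 by apply: contra_eq_neq s2 => ->; rewrite expr0n eq_sym oner_eq0.
have dNk x k : (dotp (N x) k = 0) <-> (dotp (n x) k = 0).
  by rewrite dotpZl; split => [/eqP|->]; rewrite ?mulr0// mulf_eq0 (negPf s0) => /eqP.
have contactN x : O x -> dotp (N x) (c0 - r x) < 0 -> contact C ((enorm (N x))^-1 *: N x) (r x).
  move=> Ox hx; have [m mx] : exists m, contact C m (r x) by apply/(boundary_contact bodyC); exact: Br.
  have [m1' _ mC] := mx.
  rewrite -(unit_collinear m1' hx)//; first exact: mC (interior_subset c0i).
  by move=> k /dNk; exact: contactB.
have contactN1 := contactN _ Ox1 sc.
pose L := - dotp (N x1) (q 0 0 x1); pose M := - dotp (N x1) (q 0 1 x1).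
pose P := - dotp (N x1) (q 1 1 x1).
have LP : 0 < L * P - M ^+ 2.
  rewrite /L /P /M mulrNN sqrrN !dotpZl mulrACA exprMn -expr2 s2 !mul1r subr_gt0.
  by rewrite !(dotpC (n x1)).
have L0 : 0 < L.
  have := second_form_le0 contactN1.
  rewrite dotpZl pmulr_rle0 ?invr_gt0 ?enorm_gt0; last by rewrite -dotpp_eq0 gt_eqF.
  rewrite -oppr_ge0 le_eqVlt => /orP[/eqP L0|//].
  by move: LP; rewrite /L -L0 mul0r sub0r oppr_gt0 ltNge sqr_ge0.
have P0 : 0 < P.
  by rewrite -(pmulr_rgt0 _ L0) (lt_le_trans LP)// gerBl sqr_ge0.
(* A quarter of the eigenvalue bound: one factor 2 is lost in replacing derivatives at nearby points
   by those at x1, the other in integrating t over the unit interval. *)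
pose c := (L * P - M ^+ 2) / (L + P) / 4.
have cpos : 0 < c by rewrite !divr_gt0// addr_gt0.
have DND h : 4 * c * `|h| ^+ 2 <= dotp (h *m A sigma x1) (h *m B x1).
  have -> : dotp (h *m A sigma x1) (h *m B x1) =
      L * h 0 0 ^+ 2 + 2 * M * h 0 0 * h 0 1 + P * h 0 1 ^+ 2.
    by rewrite !mul_rows2 /L /M /P /N sym weingarten -sym.
  apply: le_trans (quadratic_lower _ _ L0 P0 LP).
  rewrite (mulrC 4) divfK ?pnatr_eq0// ler_wpM2l ?sqr_norm_le//.
  by rewrite ltW// divr_gt0// addr_gt0.
have NB x h : dotp (N x) (h *m B x) = 0 by apply/dNk; exact: nB.
have spanN x k : O x -> dotp (N x) k = 0 -> exists h, k = h *m B x.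
  by move=> Ox /dNk; exact: spanB.
have sNA x : O x -> sdiff N x (fun h => h *m A sigma x) by exact: sN.
have scN : dotp (N x1) (c0 - r x1) < 0 by [].
clearbody c; clear LP L0 P0 L M P dNk NN; clearbody N.
have sN1 := sNA _ Ox1; have sr1 := srB Ox1.
have [[KA KA0 hA] sNe] := sN1; have [[KB KB0 hB] _] := sr1.
have [Kr Kr0 lr] := sdiff_lipschitz sr1; have [KN KN0 lN] := sdiff_lipschitz sN1.
pose K := KA + (KB + 2) + Kr + KN + (`|N x1| + 1) + 2 / dotp (N x1) (N x1).
have inv0 : 0 < 2 / dotp (N x1) (N x1) by rewrite divr_gt0.
have Nx0 := normr_ge0 (N x1).
have K0 : 0 < K by rewrite /K; lra.
have KKr : Kr <= K by rewrite /K; lra.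
have KKN : KN <= K by rewrite /K; lra.
have KKA : KA <= K by rewrite /K; lra.
have KKB : KB + 2 <= K by rewrite /K; lra.
have KN1 : `|N x1| + 1 <= K by rewrite /K; lra.
have Kinv : 2 / dotp (N x1) (N x1) <= K by rewrite /K; lra.
clearbody K.
(* The two error terms of the derivative are at most 3 e K and 6 e K times t |w|^2. *)
pose e := Num.min 1 (2 * c / (9 * K)).
have e0 : 0 < e by rewrite lt_min ltr01 divr_gt0 // mulr_gt0.
have e1 : e <= 1 by rewrite ge_min lexx.
have eK : e * (9 * K) <= 2 * c by rewrite -ler_pdivlMr ?mulr_gt0// ge_min lexx orbT.
clearbody e.
have cN : {for x1, continuous N} by exact: sdiff_continuous sN1.
have cr : {for x1, continuous r} by exact: sdiff_continuous sr1.
have cp i : {for x1, continuous (p i)} by exact: sdiff_continuous (sp i Ox1).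
have near1 : \forall x \near x1, O x /\ dotp (N x) (c0 - r x) < 0.
  apply: filterI; first exact: open_nbhs_nbhs.
  have h : {for x1, continuous (fun x => dotp (N x) (c0 - r x))}.
    apply: continuous_dotp => //; apply: (@continuousB _ _ _ (fun=> c0) r) => //.
    exact: cst_continuous.
  by apply: (cvgr_lt _ h).
have near2 : \forall x \near x1, K^-1 <= dotp (N x) (N x1).
  have h : {for x1, continuous (fun x => dotp (N x) (N x1))}.
    apply: (@continuous_dotp _ _ _ N (fun=> N x1)); first exact: cN.
    exact: (@cst_continuous _ _ (N x1)).
  apply: (cvgr_ge _ h).
  rewrite invf_plt ?posrE//.
  apply: (@lt_le_trans _ _ (2 / dotp (N x1) (N x1)))=> //.
  by rewrite ltr_pdivlMr// mulVf ?gt_eqF// ltr1n.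
have [rho rho0 H] : exists2 rho, 0 < rho & forall y z, `|y - x1| < rho -> `|z - x1| < rho ->
   [/\ O y, dotp (N y) (c0 - r y) < 0, K^-1 <= dotp (N y) (N x1), `|N y - N x1| < 1 &
     [/\ `|r y - r z| <= Kr * `|y - z|, `|N y - N z| <= KN * `|y - z|,
     `|N y - N z - (y - z) *m A sigma x1| <= e * `|y - z| &
       `|p 0 y - p 0 x1| < e /\ `|p 1 y - p 1 x1| < e]].
  have {}near1 := near_both near1; have {}near2 := near_both near2.
  have c1 := continuous_near_both ltr01 cN.
  have cp0 := continuous_near_both e0 (cp 0); have cp1 := continuous_near_both e0 (cp 1).
  have {}sNe := sNe _ e0.
  have : \forall w \near (x1, x1), [/\ O w.1, dotp (N w.1) (c0 - r w.1) < 0,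
     K^-1 <= dotp (N w.1) (N x1), `|N w.1 - N x1| < 1 &
     [/\ `|r w.1 - r w.2| <= Kr * `|w.1 - w.2|, `|N w.1 - N w.2| <= KN * `|w.1 - w.2|,
     `|N w.1 - N w.2 - (w.1 - w.2) *m A sigma x1| <= e * `|w.1 - w.2| &
       `|p 0 w.1 - p 0 x1| < e /\ `|p 1 w.1 - p 1 x1| < e]].
    near=> w.
    have [[h1 h2] _] : (O w.1 /\ dotp (N w.1) (c0 - r w.1) < 0) /\
      (O w.2 /\ dotp (N w.2) (c0 - r w.2) < 0) by near: w.
    have [h3 _] : K^-1 <= dotp (N w.1) (N x1) /\ K^-1 <= dotp (N w.2) (N x1) by near: w.
    have [h4 _] : `|N w.1 - N x1| < 1 /\ `|N w.2 - N x1| < 1 by near: w.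
    have [h5 _] : `|p 0 w.1 - p 0 x1| < e /\ `|p 0 w.2 - p 0 x1| < e by near: w.
    have [h6 _] : `|p 1 w.1 - p 1 x1| < e /\ `|p 1 w.2 - p 1 x1| < e by near: w.
    have h7 : `|r w.1 - r w.2| <= Kr * `|w.1 - w.2| by near: w; exact: lr.
    have h8 : `|N w.1 - N w.2| <= KN * `|w.1 - w.2| by near: w; exact: lN.
    have h9 : `|N w.1 - N w.2 - (w.1 - w.2) *m A sigma x1| <= e * `|w.1 - w.2|.
      by near: w; exact: sNe.
    by [].
  by move=> /near_pair.
have DO x : `|x - x1| < rho -> O x by move=> h; have [] := H x x h h.
exists N, (A sigma), rho, c, K; split; last exact: DO.
clear near1 near2 cN cr cp sNe lr lN sN1 sr1.
split.
- exact: rho0.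
- exact: cpos.
- exact: K0.
- by move=> x /DO; exact: srB.
- by move=> x /DO; exact: sNA.
- by move=> x h _; exact: NB.
- by move=> x k /DO; exact: spanN.
- move=> x y xr yr; pose w := y - x; have W0 : 0 <= `|w| by [].
  have zr t : 0 <= t <= 1 -> `|x + t *: w - x1| < rho by exact: ball_segment.
  have nx t : dotp (N x) (w *m B t) = dotp (N x - N t) (w *m B t).
    by rewrite dotpBl [X in _ - X](_ : _ = 0) ?subr0.
  have : 2 * c * `|w| ^+ 2 * (1 ^+ 2 / 2) <=
      - dotp (N x) (r (x + 1 *: w)) - - dotp (N x) (r (x + 0 *: w)).
    apply: (second_order (g := fun t => - dotp (N x) (r (x + t *: w)))
      (g' := fun t => - dotp (N x) (w *m B (x + t *: w)))) => [|t ts|t ts].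
    - exact: ler01.
    - apply: (sdiff_segment (f := fun z => - dotp (N x) (r z))
        (l := fun h => - dotp (N x) (h *m B (x + t *: w)))) => [a h|].
        by rewrite -scalemxAl dotpZr mulrN.
      apply: sdiffN.
      apply: sdiff_ext (sdiff_dotp (sdiff_cst (N x) _) (srB (DO _ (zr _ ts)))) _ => h.
      by rewrite dotp0l addr0.
    - set z := x + t *: w; have [_ _ _ _ [_ _ hE [p0e p1e]]] := H _ _ (zr _ ts) xr.
      rewrite -/z in hE p0e p1e; have t0 : 0 <= t by case/andP : ts.
      have zx : z - x = t *: w by rewrite /z addrAC subrr add0r.
      rewrite zx -scalemxAl normrZ ger0_norm// in hE.
      set E := (X in `|X|) in hE; pose E' := w *m B z - w *m B x1.
      have hE' : `|E'| <= 2 * (e * `|w|).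
        rewrite /E' !mul_rows2 opprD addrACA -!scalerBr (le_trans (ler_normD _ _))// !normrZ.
        have w01 i : `|w 0 i| <= `|w| by exact: coord_le_norm.
        have := ler_pM (normr_ge0 _) (normr_ge0 _) (w01 0) (ltW p0e).
        have := ler_pM (normr_ge0 _) (normr_ge0 _) (w01 1) (ltW p1e); lra.
      have hBz : `|w *m B z| <= K * `|w|.
        rewrite -(subrK (w *m B x1) (w *m B z)) (le_trans (ler_normD _ _))//.
        have := hB w; have := ler_wpM2r W0 KKB; have := ler_wpM2r W0 e1.
        by move: hE'; rewrite /E'; lra.
      have hAw : `|w *m A sigma x1| <= K * `|w| by rewrite (le_trans (hA _))// ler_wpM2r.
      have dec : - dotp (N x) (w *m B z) = dotp E (w *m B z) +
          t * dotp (w *m A sigma x1) (w *m B x1) + t * dotp (w *m A sigma x1) E'.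
        rewrite nx -dotpNl opprB -addrA -mulrDr -dotpDr addrC subrKC -dotpZl -dotpDl.
        by rewrite subrKC.
      have b1 : - (3 * (e * t * `|w| * (K * `|w|))) <= dotp E (w *m B z).
        have := dotp_norm_le E (w *m B z); rewrite ler_norml => /andP[+ _].
        apply: le_trans; rewrite lerN2 ler_wpM2l// ler_pM//.
        by rewrite -mulrA.
      have b2 : - (3 * (K * `|w| * (2 * (e * `|w|)))) <= dotp (w *m A sigma x1) E'.
        have := dotp_norm_le (w *m A sigma x1) E'; rewrite ler_norml => /andP[+ _].
        by apply: le_trans; rewrite lerN2 ler_wpM2l// ler_pM.
      have b3 := DND w.
      rewrite dec; have := ler_wpM2l t0 b2; have := ler_wpM2l t0 b3.
      have := ler_wpM2r (mulr_ge0 t0 (sqr_ge0 `|w|)) eK.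
      move: b1; rewrite expr2.
      exact: chart_arith.
  rewrite scale1r scale0r addr0 expr1n /w subrKC => h.
  by rewrite dotpBr; move: h; rewrite opprK mul1r; lra.
- by move=> x xr; apply: contactN; [exact: DO|have [] := H x x xr xr].
- by move=> W oW WO; apply: relO => // x /WO/DO.
- move=> x y xr yr; have [_ _ _ _ [h _ _ _]] := H y x yr xr.
  by rewrite (le_trans h)// ler_wpM2r.
- move=> x y xr yr; have [_ _ _ _ [_ h _ _]] := H y x yr xr.
  by rewrite (le_trans h)// ler_wpM2r.
- move=> x xr; have [_ _ _ h _] := H x x xr xr.
  have := ler_normD (N x - N x1) (N x1); rewrite subrK; lra.
- by move=> x xr; have [] := H x x xr xr.
Unshelve. all: by end_near. Qed.

End chart_at.

(** By [lagrange] the denominator of the curvature is the square norm of the cross product, and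
    normalising the normal multiplies the numerator by a positive square. The sign can thus be read
    off the unnormalised normal. *)
Lemma gauss_sign (a b q0 q1 q2 : V) : cross a b != 0 ->
  let nu := (enorm (cross a b))^-1 *: cross a b in
  0 < (dotp q0 nu * dotp q2 nu - dotp q1 nu ^+ 2) / (dotp a a * dotp b b - dotp a b ^+ 2) ->
  dotp q1 (cross a b) ^+ 2 < dotp q0 (cross a b) * dotp q2 (cross a b).
Proof.
move=> ab0 /=; rewrite -lagrange !dotpZr mulrACA exprMn -expr2 -mulrBr => h.
have ab1 : 0 < dotp (cross a b) (cross a b) by rewrite lt_neqAle eq_sym dotpp_eq0 ab0 dotpp_ge0.
have e2 : 0 < (enorm (cross a b))^-1 ^+ 2 by rewrite exprn_gt0// invr_gt0 enorm_gt0.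
by move: h; rewrite pmulr_lgt0 ?invr_gt0// pmulr_rgt0// subr_gt0.
Qed.

Lemma young_vec m (f : U -> 'rV[R]_m) (p : 'I_2 -> U -> 'rV[R]_m) (q : 'I_2 -> 'I_2 -> 'rV[R]_m)
    (O : set U) x : open O -> O x ->
  (forall i z, O z -> is_derive z (delta_mx 0 i) f (p i z)) ->
  (forall i, sdiff (p i) x (fun h => h 0 0 *: q i 0 + h 0 1 *: q i 1)) ->
  q 0 1 = q 1 0.
Proof.
move=> oO Ox df sp; apply/rowP => k; symmetry.
apply: (@young _ (fun z => f z 0 k) (fun i z => p i z 0 k) (fun i j => q j i 0 k) O x oO Ox)
  => [i z Oz|i].
  have [dfz <-] := df i z Oz; split; first by move/derivable_mxP : (dfz); exact.
  by rewrite derive_mx// mxE.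
have /sdiff_coordP/(_ k) s := sp i.
by apply: sdiff_ext s _ => z; rewrite rVlin.
Qed.

Lemma C2_sdiff (O : set U) (r : U -> V) : open O -> class_C 2 O r ->
  exists p q, [/\ p = (fun i => partial i r),
    q = (fun i j => partial j (partial i r)),
    forall x, O x -> sdiff r x (fun h => h 0 0 *: p 0 x + h 0 1 *: p 1 x),
    forall i x, O x -> sdiff (p i) x (fun h => h 0 0 *: q i 0 x + h 0 1 *: q i 1 x) &
    forall x, O x -> q 0 1 x = q 1 0 x].
Proof.
move=> oO [cr h].
have dr i x : O x -> derivable r x (delta_mx 0 i) by have [+ _] := h i; exact.
have cp i x : O x -> {for x, continuous (partial i r)}.
  by move=> Ox; have [_ [+ _]] := h i; apply; rewrite inE.
have dp i j x : O x -> derivable (partial i r) x (delta_mx 0 j).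
  by have [_ [_ /(_ j)[+ _]]] := h i; exact.
have cq i j x : O x -> {for x, continuous (partial j (partial i r))}.
  by move=> Ox; have [_ [_ /(_ j)[_ [+ _]]]] := h i; apply; rewrite inE.
exists (fun i => partial i r), (fun i j => partial j (partial i r)).
have sp i x : O x -> sdiff (partial i r) x (fun h => h 0 0 *: partial 0 (partial i r) x +
    h 0 1 *: partial 1 (partial i r) x).
  by move=> Ox; exact (C1_sdiff oO Ox (dp i) (fun j => cq i j x Ox)).
split; [reflexivity|reflexivity| |exact sp|].
  by move=> x Ox; exact (C1_sdiff oO Ox dr (fun j => cp j x Ox)).
move=> x Ox; apply: (@young_vec _ r (fun i => partial i r)
  (fun i j => partial j (partial i r) x) O x oO Ox) => [i z Oz|i].
  by have dfz := dr i z Oz; split.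
exact: sp.
Qed.

(** The chart domain is cut down to the preimage of the interior of the hull, so that the whole cap
    is visible from o and [boundary_plus] does not meet it. *)
Lemma cap_exists (C S : set V) (o : V) : convex_body C -> rel_open (boundary C) S ->
  C2_surface S -> positive_curvature S -> ~ C o -> closure (boundary_minus C o) `<=` S ->
  exists r N B A x0 rho c K, cap_chart C r N B A x0 rho c K /\
    forall x, `|x - x0| < rho -> boundary_minus C o (r x).
Proof.
move=> bodyC [W oW SW] C2S curvS oC visS.
have [z zm] := boundary_minus_nonempty bodyC oC.
have [Om [r [patch [x0 Ox0 rx0]]]] := C2S z (visS _ (subset_closure zm)).
have [oO C2r injr reg relr] := patch.
have curv := curvS Om r patch.
have [p [q [pE qE sr sp sym]]] := C2_sdiff oO C2r.
pose O' := Om `&` r @^-1` (convex_hull (C `|` [set o]))°.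
have oO' : open O'.
  rewrite openE => x [Ox hx]; apply: filterI; first exact: open_nbhs_nbhs.
  apply: (sdiff_continuous (sr x Ox)); apply: open_nbhs_nbhs; split => //.
  exact: open_interior.
have O'O x : O' x -> Om x by case.
have O'x0 : O' x0 by split => //=; rewrite rx0; case: zm.
have relC V' : open V' -> V' `<=` Om -> rel_open (boundary C) (r @` V').
  move=> oV VO; have [W' oW' e] := relr V' oV VO.
  by exists (W `&` W'); [exact: openI|rewrite e SW setIA].
have regp x : O' x -> cross (p 0 x) (p 1 x) != 0 by move=> /O'O; rewrite pE; exact: reg.
have [||||||N [A [rho [c [K [ch chO]]]]]] := @cap_chart_at C bodyC O' r x0 p q oO' O'x0.
- by move=> x /O'O; exact: sr.
- by move=> i x /O'O; exact: sp.
- exact: sym.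
- exact: regp.
- by move=> V' oV VO; apply: relC => // x /VO/O'O.
- apply: gauss_sign; first exact: regp.
  by rewrite pE qE; exact (curv x0 Ox0).
exists r, N, (fun x => rows2 (p 0 x) (p 1 x)), A, x0, rho, c, K.
split; [exact: ch|move=> x /chO[Ox hx]; split; last exact: hx].
have [W' _ e] := relC Om oO (@subset_refl _ Om).
by have : (r @` Om) (r x); [exists x|rewrite e => -[]].
Qed.

End charts.

(** * Radial profiles *)

Section one_variable.
Context {R : realType}.

Lemma C1_sdiff_line (g g' : R -> R) (t : R) :
  (\forall s \near t, is_derive (s : R) 1 g (g' s)) -> {for t, continuous g'} ->
  sdiff g t (fun h => h *: g' t).
Proof.
move=> dg cg; split.
  by exists (`|g' t| + 1); [rewrite ltr_wpDl|move=> h;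
    rewrite normrZ mulrC ler_wpM2r// lerDl].
move=> e e0; have /cvgrPdist_le/(_ _ e0) cge := cg.
have /nbhs_ballP[d /= d0 H] : \forall s \near t, is_derive (s : R) 1 g (g' s) /\ `|g' t - g' s| <= e.
  by apply: filterI.
apply/near_pair; exists d => // y z; rewrite (distrC y) (distrC z) => yt zt /=.
have key (a b : R) : a <= b -> `|t - a| < d -> `|t - b| < d ->
    `|g b - g a - (b - a) * g' t| <= e * `|b - a|.
  move=> ab at_ bt.
  have inb s : s \in `[a, b] -> `|t - s| < d.
    rewrite in_itv /= => /andP[h1 h2]; move: at_ bt; rewrite !ltr_norml => /andP[? ?] /andP[? ?].
    by apply/andP; split; lra.
  have [||s sab ->] := @MVT_segment R g g' a b ab.
  - move=> s /subset_itv_oo_cc sab; have [|+ _] := H s; last exact.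
    by rewrite -ball_normE /=; exact: inb.
  - apply: derivable_within_continuous => s sab; have [|[+ _] _] := H s; last exact.
    by rewrite -ball_normE /=; exact: inb.
  rewrite mulrC -mulrBr normrM mulrC ler_wpM2r// distrC.
  by have [|_ ] := H s; [rewrite -ball_normE /=; exact: inb|].
have [yz|/ltW zy] := leP z y; first exact: key.
rewrite -normrN (_ : - _ = g z - g y - (z - y) * g' t); last first.
  by rewrite -[(y - z) *: _]/((y - z) * g' t); ring.
by rewrite (distrC y) key.
Qed.

(* The radial profile b prescribes the squared dilation factor 1 + b. *)
Record profile (hi eta : R) (b b' : R -> R) : Prop := Profile {
  profile_derive : forall s : R, is_derive s 1 b (b' s);
  profile_cont : continuous b';
  profile_supp : forall s, hi <= s -> b s = 0 /\ b' s = 0;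
  profile_bound : forall s, `|b s| <= eta /\ `|b' s| <= eta }.

Definition dilation (b : R -> R) (s : R) : R := Num.sqrt (1 + b s) - 1.

Definition dilation' (b b' : R -> R) (s : R) : R := b' s / (2 * Num.sqrt (1 + b s)).

(* The primitive of [- s * dilation' s] vanishing beyond hi, by parts. *)
Definition shift_of (hi : R) (b : R -> R) (s : R) : R :=
  let I u := (\int[lebesgue_measure]_(x in `[-1, u]) dilation b x)%R in
  I s - s * dilation b s - I hi.

Section profile.
Variables (hi eta : R) (b b' : R -> R).
Hypotheses (hi0 : 0 < hi) (eta2 : eta <= 1 / 2) (pb : profile hi eta b b').

Lemma profile_eta : 0 <= eta.
Proof. by have [h _] := profile_bound pb 0; exact: le_trans h. Qed.

Lemma profile_pos s : 1 / 2 <= 1 + b s.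
Proof. by have [+ _] := profile_bound pb s; rewrite ler_norml => /andP[h _]; have := eta2; lra. Qed.

Lemma dilation_sqrt s : [/\ 1 / 2 <= Num.sqrt (1 + b s), (1 + dilation b s) ^+ 2 = 1 + b s &
   `|dilation b s| <= eta].
Proof.
have h := profile_pos s; have h0 : 0 <= 1 + b s by lra.
have h1 : 1 / 2 <= Num.sqrt (1 + b s).
  rewrite -ler_sqr ?nnegrE ?sqrtr_ge0// ?sqr_sqrtr//; lra.
have h2 : Num.sqrt (1 + b s) ^+ 2 = 1 + b s by rewrite sqr_sqrtr.
split => //; first by rewrite /dilation addrC subrK.
have [h3 _] := profile_bound pb s.
rewrite (le_trans _ h3)// /dilation; move: h2 h1; move: (Num.sqrt _) => x h2 h1.
have -> : b s = (x - 1) * (x + 1) by rewrite -subr_sqr h2 expr1n addrAC subrr add0r.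
by rewrite normrM ler_peMr// ger0_norm; lra.
Qed.

Lemma dilation'_bound s : `|dilation' b b' s| <= eta.
Proof.
have [h _ _] := dilation_sqrt s; have [_ h'] := profile_bound pb s.
rewrite /dilation' normrM normfV [X in _ / X]ger0_norm; last lra.
rewrite ler_pdivrMr; last lra.
by rewrite (le_trans h')// ler_peMr ?profile_eta//; lra.
Qed.

(** The derivative of the identity (1 + k)^2 = 1 + b. It is what makes the Jacobian affine in the
    profile. *)
Lemma dilation_dilation' s : 2 * (1 + dilation b s) * dilation' b b' s = b' s.
Proof.
have [h _ _] := dilation_sqrt s.
by rewrite /dilation /dilation' addrC subrK mulrCA mulfV ?mulr1//; lra.
Qed.

Lemma dilation_derive (s : R) : is_derive s 1 (dilation b) (dilation' b b' s).
Proof.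
have h := profile_pos s; have db := profile_derive pb s.
have d1 : is_derive s 1 (fun s => 1 + b s) (b' s).
  by rewrite -[b' s]add0r; apply: is_deriveD.
have d2 := @is_derive1_sqrt R (1 + b s) ltac:(lra).
have d3 := @is_derive1_comp R Num.sqrt (fun s => 1 + b s) s _ _ d2 d1.
have := is_deriveB d3 (is_derive_cst (1 : R) s 1).
by rewrite subr0 mulrC.
Qed.

Lemma dilation_cont : continuous (dilation b).
Proof.
by move=> s; apply: differentiable_continuous; apply/derivable1_diffP; have [] := dilation_derive s.
Qed.

Lemma dilation'_cont : continuous (dilation' b b').
Proof.
move=> s; apply: cvgM; first exact: (profile_cont pb).
apply: cvgV; first by have [h _ _] := dilation_sqrt s; lra.
apply: cvgM; first exact: cvg_cst.
have -> : (fun s => Num.sqrt (1 + b s)) = (fun s => dilation b s + 1).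
  by apply/funext => u; rewrite /dilation subrK.
rewrite (_ : Num.sqrt (1 + b s) = dilation b s + 1); last by rewrite /dilation subrK.
by apply: cvgD; [exact: dilation_cont|exact: cvg_cst].
Qed.

Lemma dilation_supp s : hi <= s -> dilation b s = 0 /\ dilation' b b' s = 0.
Proof.
by move=> /(profile_supp pb)[bs b's]; rewrite /dilation /dilation' bs b's addr0 sqrtr1 subrr mul0r.
Qed.

(** In the derivative of the integral minus s k the two terms k cancel. The integral starts at -1 so
    that s = 0, the height at the centre of the cap, is an interior point. *)
Lemma shift_derive (s : R) : -1 < s ->
  is_derive s 1 (shift_of hi b) (- (s * dilation' b b' s)).
Proof.
move=> s1; have su : s < s + 1 by rewrite ltrDl.
have [] := @continuous_FTC1 R (dilation b) (BLeft (-1)) s (s + 1) su.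
- apply: continuous_compact_integrable; first exact: segment_compact.
  exact: continuous_subspaceT dilation_cont.
- by rewrite lte_fin.
- exact: dilation_cont.
rewrite derive1E => dI dIE.
have dI' : is_derive s 1 (fun u => (\int[lebesgue_measure]_(x in `[-1, u]) dilation b x)%R) (dilation b s).
  by split.
have dM := is_deriveM (is_derive_id s 1) (dilation_derive s).
apply: is_derive_eq (is_deriveB (is_deriveB dI' dM) (is_derive_cst _ s 1)) _.
by rewrite subr0 -[(dilation b s)%:A]/(dilation b s * 1) -[s *: _]/(s * _); ring.
Qed.

Lemma shift_supp s : hi <= s -> shift_of hi b s = 0.
Proof.
move=> his.
have hi_1 : -1 < hi by rewrite (lt_trans _ hi0)// oppr_lt0.
have [|| u uin] := @MVT_segment R (shift_of hi b) (fun s => - (s * dilation' b b' s)) hi s his.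
- move=> u; rewrite in_itv /= => /andP[h1 _]; apply: shift_derive; exact: lt_trans h1.
- apply: derivable_within_continuous => u; rewrite in_itv /= => /andP[h1 _].
  by have [|] := shift_derive (s := u) => //; exact: lt_le_trans h1.
have hiu : hi <= u by move: uin; rewrite in_itv /= => /andP[].
have [_ ->] := dilation_supp hiu; rewrite mulr0 oppr0 mul0r => /eqP.
rewrite subr_eq0 => /eqP ->; have [h _] := dilation_supp (lexx hi).
by rewrite /shift_of h mulr0 subr0 subrr.
Qed.

Lemma shift_bound s : 0 <= s -> `|shift_of hi b s| <= hi ^+ 2 * eta.
Proof.
move=> s0; have eta0 := profile_eta.
have [his|/ltW shi] := leP hi s.
  by rewrite shift_supp// normr0 mulr_ge0// sqr_ge0.
have [|| u uin] := @MVT_segment R (shift_of hi b) (fun s => - (s * dilation' b b' s)) s hi shi.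
- move=> u; rewrite in_itv /= => /andP[h1 _]; apply: shift_derive.
  by rewrite (lt_trans _ h1)// (lt_le_trans _ s0)// oppr_lt0.
- apply: derivable_within_continuous => u; rewrite in_itv /= => /andP[h1 _].
  have [|] := shift_derive (s := u) => //.
  by rewrite (lt_le_trans _ h1)// (lt_le_trans _ s0)// oppr_lt0.
rewrite (shift_supp (lexx hi)) sub0r => /eqP; rewrite eqr_oppLR => /eqP ->.
move: uin; rewrite in_itv /= => /andP[su uhi]; have u0 := le_trans s0 su.
rewrite normrN normrM normrN normrM (ger0_norm u0) [`|hi - s|]ger0_norm ?subr_ge0//.
rewrite (_ : hi ^+ 2 * eta = hi * eta * hi); last by ring.
have hi0' := ltW hi0.
rewrite ler_pM ?subr_ge0 ?mulr_ge0//; first by rewrite ler_pM// dilation'_bound.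
by rewrite gerBl.
Qed.

Lemma dilation_sdiff (s : R) : sdiff (dilation b) s (fun h => h *: dilation' b b' s).
Proof.
apply: C1_sdiff_line; last exact: dilation'_cont.
by near=> u; exact: dilation_derive.
Unshelve. all: by end_near. Qed.

Lemma shift_sdiff (s : R) : 0 <= s ->
  sdiff (shift_of hi b) s (fun h => h *: (- (s * dilation' b b' s))).
Proof.
move=> s0; apply: (@C1_sdiff_line _ (fun s => - (s * dilation' b b' s))).
  near=> u; apply: shift_derive; near: u; apply: lt_nbhsr.
  by rewrite (lt_le_trans _ s0)// oppr_lt0.
by apply: cvgN; apply: cvgM; [exact: cvg_id|exact: dilation'_cont].
Unshelve. all: by end_near. Qed.

End profile.

End one_variable.

(** * Deformation of a cap *)

Section cap.
Context {R : realType}.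
Local Notation U := 'rV[R]_2.
Local Notation V := 'rV[R]_3.
Variables (C : set V) (bodyC : convex_body C) (r N : U -> V) (B A : U -> 'M[R]_(2, 3)).
Variables (x0 : U) (rho c K : R) (ch : cap_chart C r N B A x0 rho c K).
Local Notation D := [set x : U | `|x - x0| < rho].
(** Three concentric disks: the deformation is supported in [Q], the patch that is replaced lies
    over [P], and contacts outside [Po] are kept. The margin between [Q] and the complement of [Po]
    yields the uniform gap of [far_slack]. *)
Let P := [set x : U | `|x - x0| <= 3 / 4 * rho].
Let Po := [set x : U | `|x - x0| < 3 / 4 * rho].
Let Q := [set x : U | `|x - x0| <= rho / 2].

Let rho0 : 0 < rho. Proof. exact: cap_rho ch. Qed.
Let c0 : 0 < c. Proof. exact: cap_c ch. Qed.
Let K0 : 0 < K. Proof. exact: cap_K ch. Qed.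

Let PD : P `<=` D. Proof. by move=> x; rewrite /P /=; have := rho0; lra. Qed.
Let PoD : Po `<=` D. Proof. by move=> x; rewrite /Po /=; have := rho0; lra. Qed.
Let QPo : Q `<=` Po. Proof. by move=> x; rewrite /Q /Po /=; have := rho0; lra. Qed.
Let PoP : Po `<=` P. Proof. by move=> x /ltW. Qed.

Lemma cap_near x : D x -> \forall y \near x, D y.
Proof. by move=> Dx; apply: open_nbhs_nbhs; split => //; exact: norm_ball_open. Qed.

Lemma closed_disk d : closed [set x : U | `|x - x0| <= d].
Proof.
apply: (@closed_comp _ _ (fun x : U => `|x - x0|) [set y | y <= d]); last exact: closed_le.
move=> x _; apply: (@lipschitz_continuous _ _ _ _ 1) => // y z; rewrite mul1r.
by rewrite (le_trans (ler_dist_dist _ _))// opprB addrA subrK.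
Qed.

Lemma compact_disk d : compact [set x : U | `|x - x0| <= d].
Proof.
apply: bounded_closed_compact; last exact: closed_disk.
exists (`|x0| + d); split; [exact: num_real|move=> M hM x /= xd]; apply: le_trans (ltW hM).
by rewrite -[x in leLHS](subrK x0) (le_trans (ler_normD _ _))// addrC lerD2l.
Qed.

Lemma cap_N_neq0 x : D x -> N x != 0.
Proof.
move=> /(cap_pos ch) h; apply: contraTneq h => ->.
by rewrite dotp0l -ltNge invr_gt0 K0.
Qed.

Lemma cap_N_gt0 x : D x -> 0 < enorm (N x).
Proof. by move=> Dx; rewrite enorm_gt0 cap_N_neq0. Qed.

Let Nhat x := (enorm (N x))^-1 *: N x.

Lemma cap_le0 x v : D x -> (dotp (Nhat x) v <= 0) = (dotp (N x) v <= 0).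
Proof. by move=> Dx; rewrite dotpZl pmulr_rle0 ?invr_gt0 ?cap_N_gt0. Qed.

Lemma cap_side x z : D x -> C z -> dotp (N x) (z - r x) <= 0.
Proof. by move=> Dx Cz; have [_ _ h] := cap_contact ch Dx; rewrite -cap_le0// h. Qed.

Lemma cap_mem x : D x -> C (r x).
Proof. by move=> Dx; have [] := cap_contact ch Dx. Qed.

Lemma neg_quad (x y : U) a : 0 < a -> 0 <= - a * `|y - x| ^+ 2 -> y = x.
Proof.
move=> a0; rewrite mulNr oppr_ge0 pmulr_rle0// => h; apply/eqP.
by rewrite -subr_eq0 -normr_eq0 -sqrf_eq0 eq_le h sqr_ge0.
Qed.

Lemma cap_inj x y : D x -> D y -> r x = r y -> x = y.
Proof.
move=> Dx Dy e; symmetry; apply: (neg_quad c0).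
by rewrite (le_trans _ (cap_quad ch Dx Dy))// e subrr dotp0r.
Qed.

Lemma cap_normal_inj x y : D x -> D y -> Nhat x = Nhat y -> x = y.
Proof.
move=> Dx Dy e; apply: cap_inj => //.
have h1 := cap_side Dx (cap_mem Dy); have h2 := cap_side Dy (cap_mem Dx).
rewrite -cap_le0// in h1; rewrite -cap_le0// -e -opprB dotpNr in h2.
have h : dotp (Nhat x) (r y - r x) = 0 by apply/eqP; rewrite eq_le h1 -oppr_le0.
move: h => /eqP; rewrite dotpZl mulf_eq0 invr_eq0 gt_eqF ?cap_N_gt0//= => /eqP h.
suff -> : x = y by [].
by symmetry; apply: (neg_quad c0); rewrite (le_trans _ (cap_quad ch Dx Dy))// h.
Qed.

(** Serves for both the original and the deformed patch: a supporting normal annihilates the tangent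
    plane, hence is collinear with N x, and a point strictly below that plane fixes its sign. *)
Lemma patch_normal (f : U -> V) (T : 'M[R]_(2, 3)) (X : set V) (m : V) x :
  D x -> sdiff f x (fun h => h *m T) ->
  (forall k, dotp (N x) k = 0 -> exists h, k = h *m T) ->
  (\forall y \near x, X (f y)) -> enorm m = 1 ->
  (forall z, X z -> dotp m (z - f x) <= 0) ->
  (exists2 z, X z & dotp (N x) (z - f x) < 0) -> m = Nhat x.
Proof.
move=> Dx sf spanT Xf m1 mX [z Xz Nz]; apply: (unit_collinear m1 Nz (mX _ Xz)).
move=> k /spanT[h ->]; apply: (sdiff_unit_normal sf).
by apply: filterS Xf => y; exact: mX.
Qed.

Lemma cap_other x : D x -> exists2 y, D y & y != x.
Proof.
move=> Dx; have [->|xx0] := eqVneq x x0.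
  have e : `|(rho / 2) *: (delta_mx 0 0 : U)| <= rho / 2.
    rewrite normrZ ger0_norm ?ler_piMr ?divr_ge0 ?(ltW rho0)//.
    by apply: norm_rV_le => // i; rewrite mxE /=; case: (i == 0); rewrite ?normr0 ?normr1.
  exists (x0 + (rho / 2) *: delta_mx 0 0).
    by rewrite /= addrAC subrr add0r; have := rho0; lra.
  rewrite -subr_eq0 addrAC subrr add0r scaler_eq0 negb_or gt_eqF ?divr_gt0//=.
  by apply/eqP => /rowP/(_ 0); rewrite !mxE /=; apply/eqP; rewrite oner_eq0.
by exists x0; rewrite /= ?subrr ?normr0// eq_sym.
Qed.

Lemma cap_contact_normal m x : D x -> contact C m (r x) -> m = Nhat x.
Proof.
move=> Dx [m1 _ mC]; apply: (@patch_normal r (B x) C m x Dx) => //.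
- exact: (cap_r ch Dx).
- by move=> k hk; exact: (cap_span ch Dx hk).
- by apply: filterS (cap_near Dx) => y; exact: cap_mem.
have [y Dy yx] := cap_other Dx; exists (r y); first exact: cap_mem.
rewrite (le_lt_trans (cap_quad ch Dx Dy))// mulNr oppr_lt0 mulr_gt0// exprn_gt0//.
by rewrite normr_gt0 subr_eq0.
Qed.

(* A segment of contact points would stay in the patch near r x, contradicting
   the quadratic estimate. *)
Lemma cap_strict x xi : D x -> C xi -> dotp (N x) (xi - r x) = 0 -> xi = r x.
Proof.
move=> Dx Cxi Nxi; have [W oW e] := cap_open ch (@norm_ball_open R x0 rho) (@subset_refl _ _).
have Wrx : W (r x) by have : (r @` D) (r x); [exists x|rewrite e => -[]].
have [convC _ _] := bodyC.
have [d /= d0 dW] : exists2 d : R, 0 < d & forall z, `|z - r x| < d -> W z.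
  have /nbhs_ballP[d /= d0 dW] := open_nbhs_nbhs (conj oW Wrx).
  by exists d => // z zd; apply: dW; rewrite -ball_normE /= distrC.
have n1 : 0 < `|xi - r x| + 1 by rewrite ltr_wpDl.
pose t := Num.min 1 (d / (`|xi - r x| + 1) / 2).
have t0 : 0 < t by rewrite lt_min ltr01 !divr_gt0.
have t1 : t <= 1 by rewrite ge_min lexx.
have td : t * (`|xi - r x| + 1) <= d / 2.
  by rewrite -ler_pdivlMr// mulrAC ge_min lexx orbT.
pose z := r x + t *: (xi - r x).
have Cz : C z by apply: convexP => //; [exact: cap_mem|rewrite (ltW t0)].
have Wz : W z.
  apply: dW; rewrite /z addrAC subrr add0r normrZ gtr0_norm//.
  by have := normr_ge0 (xi - r x); nra.
have Nz : dotp (N x) (z - r x) = 0 by rewrite /z addrAC subrr add0r dotpZr Nxi mulr0.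
have : (r @` D) z.
  rewrite e; split => //; apply/(boundary_contact bodyC); exists (Nhat x).
  by apply: contact_trans (cap_contact ch Dx) Cz _; rewrite dotpZl Nz mulr0.
move=> [y Dy yz]; have yx : y = x.
  by apply: (neg_quad c0); rewrite (le_trans _ (cap_quad ch Dx Dy))// yz Nz.
apply/eqP; rewrite -subr_eq0; have := subrr (r x).
rewrite -{1}yx yz /z addrAC subrr add0r => /eqP.
by rewrite scaler_eq0 gt_eqF.
Qed.

(** The patch over the open disk is removed, which is relatively open in the boundary by [cap_open];
    what is left of the normal bundle is compact. *)
Definition far_contact (m xi : V) := contact C m xi /\ ~ (r @` Po) xi.

Lemma far_compact : compact [set p : V * V | far_contact p.1 p.2].
Proof.
have [W oW e] := cap_open ch (@norm_ball_open R x0 (3 / 4 * rho)) PoD.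
have -> : [set p : V * V | far_contact p.1 p.2] =
    [set p : V * V | contact C p.1 p.2] `&` (fun p : V * V => p.2) @^-1` (~` W).
  apply/seteqP; split => -[m xi] /= [mx h]; split => //.
    move=> Wxi; apply: h; rewrite /Po e; split => //.
    by apply/(boundary_contact bodyC); exists m.
  by rewrite /Po e => -[_ /h].
apply: (subclosed_compact _ (compact_contact bodyC)); last by move=> p [].
apply: closedI; first exact: closed_contact.
by apply: closed_comp; [move=> p _; exact: cvg_snd|exact: open_closedC].
Qed.

Lemma cap_continuous x : D x -> {for x, continuous r} /\ {for x, continuous N}.
Proof.
by move=> Dx; split; [exact: (sdiff_continuous (cap_r ch Dx))|exact: (sdiff_continuous (cap_N ch Dx))].
Qed.

(** Both inequalities are strict: equality would place a cap point and a far point in one supporting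
    plane, which [cap_strict] excludes. Compactness makes the gap uniform. It gives room for moving
    the cap without crossing far planes, and without its planes cutting off far points. *)
Lemma far_slack : exists2 d, 0 < d & forall x m xi, Q x -> far_contact m xi ->
  dotp m (r x - xi) <= - d /\ dotp (N x) (xi - r x) <= - d.
Proof.
pose X := Q `*` [set p : V * V | far_contact p.1 p.2].
have cX : compact X by apply: compact_setX; [exact: compact_disk|exact: far_compact].
have QD : Q `<=` D by move=> x /QPo/PoD.
have cont (f : U * (V * V) -> R) : (forall p, D p.1 -> {for p, continuous f}) ->
    {within X, continuous f}.
  by move=> h; apply: continuous_in_subspaceT => p /set_mem[/QD Dp _]; exact: h.
have cr p : D p.1 -> {for p, continuous (fun p : U * (V * V) => r p.1)}.
  move=> /cap_continuous[h _]; apply: (@continuous_comp _ _ _ fst r p _ h); exact: cvg_fst.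
have cN p : D p.1 -> {for p, continuous (fun p : U * (V * V) => N p.1)}.
  move=> /cap_continuous[_ h]; apply: (@continuous_comp _ _ _ fst N p _ h); exact: cvg_fst.
have cm p : {for p, continuous (fun p : U * (V * V) => p.2.1)}.
  by apply: (@continuous_comp _ _ _ snd fst); [exact: cvg_snd|exact: cvg_fst].
have cx p : {for p, continuous (fun p : U * (V * V) => p.2.2)}.
  by apply: (@continuous_comp _ _ _ snd snd); exact: cvg_snd.
have [|[x [m xi]] [/= Qx [mxi nxi]]|d1 d10 h1] := @compact_slack _ _ X
    (fun p => dotp p.2.1 (r p.1 - p.2.2)) cX.
- apply: cont => p Dp; apply: continuous_dotp; first exact: cm.
  by apply: (@continuousB _ _ _ (fun p : U * (V * V) => r p.1) (fun p => p.2.2)); [exact: cr|exact: cx].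
- have Dx := QD _ Qx; have [_ _ h] := mxi.
  rewrite lt_neqAle (h _ (cap_mem Dx)) andbT; apply/eqP => e; apply: nxi; exists x; first exact: QPo.
  have mE := cap_contact_normal Dx (contact_trans mxi (cap_mem Dx) e).
  symmetry; apply: cap_strict => //; first by have [] := mxi.
  apply/eqP; have := e; rewrite mE dotpZl -opprB dotpNr mulrN => /eqP.
  by rewrite oppr_eq0 mulf_eq0 invr_eq0 gt_eqF ?cap_N_gt0.
have [|[x [m xi]] [/= Qx [mxi nxi]]|d2 d20 h2] := @compact_slack _ _ X
    (fun p => dotp (N p.1) (p.2.2 - r p.1)) cX.
- apply: cont => p Dp; apply: continuous_dotp; first exact: cN.
  by apply: (@continuousB _ _ _ (fun p : U * (V * V) => p.2.2) (fun p => r p.1)); [exact: cx|exact: cr].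
- have Dx := QD _ Qx; have [_ Cxi _] := mxi.
  rewrite lt_neqAle (cap_side Dx Cxi) andbT; apply/eqP => e; apply: nxi; exists x; first exact: QPo.
  by symmetry; exact: cap_strict.
exists (Num.min d1 d2); first by rewrite lt_min d10.
move=> x m xi Qx mxi; have := h1 (x, (m, xi)) (conj Qx mxi); have := h2 (x, (m, xi)) (conj Qx mxi).
by rewrite /= => e2 e1; split; [rewrite (le_trans e1)|rewrite (le_trans e2)];
  rewrite // lerN2 ge_min lexx ?orbT.
Qed.

Lemma sdiff_dir (W : normedModType R) (f : U -> W) l x h e : sdiff f x l ->
  (forall a h, l (a *: h) = a *: l h) -> 0 < e ->
  exists2 d, 0 < d & forall s, 0 < s < d ->
    `|f (x + s *: h) - f x - s *: l h| <= s * e.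
Proof.
move=> [_ sf] lZ e0; have h1 : 0 < `|h| + 1 by rewrite ltr_wpDl.
have /near_pair[d d0 H] := sf _ (divr_gt0 e0 h1).
exists (d / (`|h| + 1)); first by rewrite divr_gt0.
move=> s /andP[s0 sd].
have hs : `|x + s *: h - x| < d.
  rewrite addrAC subrr add0r normrZ gtr0_norm//.
  apply: le_lt_trans (_ : s * (`|h| + 1) < d); last by rewrite -ltr_pdivlMr.
  by rewrite ler_wpM2l ?lerDl// ltW.
have := H _ x hs; rewrite subrr normr0 => /(_ d0) /=; rewrite [x + _ - x]addrAC subrr add0r lZ.
move=> /le_trans; apply; rewrite normrZ gtr0_norm// mulrCA ler_wpM2l ?(ltW s0)//.
by rewrite mulrAC ler_pdivrMr// ler_wpM2l ?(ltW e0)// lerDl.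
Qed.

Lemma dir_small x h d : D x -> 0 < d -> exists2 s, 0 < s < d & D (x + s *: h).
Proof.
move=> Dx d0; have h1 : 0 < `|h| + 1 by rewrite ltr_wpDl.
have g0 : 0 < rho - `|x - x0| by rewrite subr_gt0.
pose s := Num.min d ((rho - `|x - x0|) / (`|h| + 1)) / 2.
have m0 : 0 < Num.min d ((rho - `|x - x0|) / (`|h| + 1)) by rewrite lt_min d0 divr_gt0.
have s0 : 0 < s by rewrite divr_gt0.
have : s < Num.min d ((rho - `|x - x0|) / (`|h| + 1)).
  by rewrite gtr_pMr// invf_lt1// ltr1n.
rewrite lt_min => /andP[sd]; rewrite ltr_pdivlMr// => sr.
exists s; first by rewrite s0.
rewrite /= addrAC (le_lt_trans (ler_normD _ _))// -ltrBrDl normrZ gtr0_norm//.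
by apply: le_lt_trans sr; rewrite ler_wpM2l ?(ltW s0)// lerDl.
Qed.

Lemma sdiff_opnorm (W : normedModType R) (f : U -> W) l x L : sdiff f x l ->
  (forall a h, l (a *: h) = a *: l h) -> D x ->
  (forall y, D y -> `|f y - f x| <= L * `|y - x|) -> forall h, `|l h| <= L * `|h|.
Proof.
move=> sf lZ Dx fL h; apply/ler_addgt0Pl => e e0.
have [d d0 H] := sdiff_dir h sf lZ e0; have [s sd Ds] := dir_small h Dx d0.
have s0 : 0 < s by case/andP : sd.
rewrite -(ler_pM2l s0) -[X in X * `|l h|]gtr0_norm// -normrZ mulrDr.
rewrite -(subrK (f (x + s *: h) - f x) (s *: l h)) (le_trans (ler_normD _ _))//.
rewrite lerD//; first by rewrite distrC H.
by rewrite (le_trans (fL _ Ds))// addrAC subrr add0r normrZ gtr0_norm// mulrCA.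
Qed.

Lemma cap_opnorm x (h : U) : D x -> `|h *m A x| <= K * `|h| /\ `|h *m B x| <= K * `|h|.
Proof.
move=> Dx; split; move: h.
- apply: (sdiff_opnorm (cap_N ch Dx) _ Dx) => [a h|y Dy]; first by rewrite scalemxAl.
  exact: (cap_lipN ch).
- apply: (sdiff_opnorm (cap_r ch Dx) _ Dx) => [a h|y Dy]; first by rewrite scalemxAl.
  exact: (cap_lipr ch).
Qed.

Let bilin_arith (a b u v : V) s : dotp u v = s * s * dotp a b +
  (s * dotp a (v - s *: b) + dotp (u - s *: a) v).
Proof. by rewrite dotpBr dotpBl dotpZr dotpZl; ring. Qed.

Let mono_arith (s e a b dd : R) : 0 < s ->
  s * s * b <= s * s * dd + s * (3 * (a * (s * e))) -> b <= dd + 3 * a * e.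
Proof.
move=> s0 h; rewrite -(ler_pM2l (mulr_gt0 s0 s0)); lra.
Qed.

(** The infinitesimal form of [cap_quad]. Adding the estimates for (x, y) and (y, x) gives a lower
    bound 2 c |y - x|^2 for the product of N y - N x with r y - r x; with y = x + s h, divide by s^2
    and let s be small. *)
Lemma cap_mono x (h : U) : D x -> 2 * c * `|h| ^+ 2 <= dotp (h *m A x) (h *m B x).
Proof.
move=> Dx; apply/ler_addgt0Pl => e e0.
pose a := `|h *m A x| + K * `|h|.
have a0 : 0 <= a by rewrite addr_ge0// mulr_ge0// ltW.
have a1 : 0 < 3 * a + 1 by rewrite ltr_wpDl// mulr_ge0.
have e1 : 0 < e / (3 * a + 1) by rewrite divr_gt0.
have lA k (g : U) : (k *: g) *m A x = k *: (g *m A x) by rewrite scalemxAl.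
have lB k (g : U) : (k *: g) *m B x = k *: (g *m B x) by rewrite scalemxAl.
have [d1 d10 H1] := sdiff_dir h (cap_N ch Dx) lA e1.
have [d2 d20 H2] := sdiff_dir h (cap_r ch Dx) lB e1.
have d0 : 0 < Num.min d1 d2 by rewrite lt_min d10.
have [s] := dir_small h Dx d0; rewrite lt_min => /andP[s0 /andP[sd1 sd2]] Dy.
set y := x + s *: h in Dy; have yx : y - x = s *: h by rewrite /y addrAC subrr add0r.
have {}H1 := H1 s ltac:(by rewrite s0); have {}H2 := H2 s ltac:(by rewrite s0).
rewrite -/y in H1 H2.
have q : 2 * c * (s * s * `|h| ^+ 2) <= dotp (N y - N x) (r y - r x).
  have := cap_quad ch Dx Dy; have := cap_quad ch Dy Dx.
  rewrite -(opprB (r y)) dotpNr (distrC x) dotpBl yx normrZ gtr0_norm// exprMn expr2; lra.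
have dec : dotp (N y - N x) (r y - r x) = s * s * dotp (h *m A x) (h *m B x) +
    (s * dotp (h *m A x) (r y - r x - s *: (h *m B x)) +
     dotp (N y - N x - s *: (h *m A x)) (r y - r x)).
  exact: bilin_arith.
have b1 : `|dotp (h *m A x) (r y - r x - s *: (h *m B x))| <=
    3 * (`|h *m A x| * (s * (e / (3 * a + 1)))).
  by rewrite (le_trans (dotp_norm_le _ _))// ler_wpM2l// ler_wpM2l.
have b2 : `|dotp (N y - N x - s *: (h *m A x)) (r y - r x)| <=
    3 * (s * (e / (3 * a + 1)) * (s * (K * `|h|))).
  rewrite (le_trans (dotp_norm_le _ _))// ler_wpM2l// ler_pM//.
  by rewrite (le_trans (cap_lipr ch Dx Dy))// yx normrZ gtr0_norm// mulrCA.
rewrite addrC; apply: (@le_trans _ _ (dotp (h *m A x) (h *m B x) + 3 * a * (e / (3 * a + 1)))).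
  apply: (mono_arith s0); rewrite mulrCA (le_trans q)// dec lerD2l.
  have c1 := le_trans (ler_norm _) b1; have c2 := le_trans (ler_norm _) b2.
  have := ler_wpM2l (ltW s0) c1; rewrite /a; lra.
rewrite lerD2l mulrA ler_pdivrMr// mulrC ler_wpM2l ?(ltW e0)// lerDl.
exact: ler01.
Qed.

Lemma cap_lower x (h : U) : D x -> 2 * c * `|h| <= 3 * K * `|h *m B x|.
Proof.
move=> Dx; have [->|h0] := eqVneq h 0; first by rewrite mul0mx !normr0 !mulr0.
have hp : 0 < `|h| by rewrite normr_gt0.
rewrite -(ler_pM2r hp) (_ : _ * `|h| * `|h| = 2 * c * `|h| ^+ 2); last by rewrite expr2 mulrA.
rewrite (le_trans (cap_mono h Dx))//.
rewrite (le_trans (ler_norm _))// (le_trans (dotp_norm_le _ _))//.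
have [hA _] := cap_opnorm h Dx; have := ler_wpM2r (normr_ge0 (h *m B x)) hA; lra.
Qed.

(* R1 moves the patch by at most d, keeping the tangent planes and fixing a
   neighbourhood of the rim. *)
Record deformation (d : R) (R1 : U -> V) (M : U -> 'M[R]_2) : Prop := Deformation {
  def_id : forall x, D x -> rho / 2 <= `|x - x0| -> R1 x = r x;
  def_close : forall x, D x -> (enorm (N x) + 1) * enorm (R1 x - r x) <= d;
  def_sdiff : forall x, D x -> sdiff R1 x (fun h => h *m (M x *m B x));
  def_unit : forall x, D x -> M x \in unitmx;
  def_quad : forall x y, D x -> D y ->
    dotp (N x) (R1 y - R1 x) <= - (c / 2) * `|y - x| ^+ 2 }.

(** As an intersection of closed half-spaces this set is closed and convex at once; the work goes
    into identifying its boundary and its normals. *)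
Definition deformed (R1 : U -> V) : set V :=
  [set z | (forall x, P x -> dotp (N x) (z - R1 x) <= 0) /\
    forall m xi, far_contact m xi -> dotp m (z - xi) <= 0].

Lemma rim_far x : D x -> ~ Po x -> far_contact (Nhat x) (r x).
Proof.
move=> Dx nPx; split; first exact: (cap_contact ch Dx).
by move=> [y Py e]; apply: nPx; rewrite -(cap_inj (PoD Py) Dx e).
Qed.

Lemma contact_cases m xi : contact C m xi -> far_contact m xi \/
  exists x, [/\ Po x, xi = r x & m = Nhat x].
Proof.
move=> mxi; have [[x Px xE]|nP] := pselect ((r @` Po) xi); last by left.
right; exists x; split => //; apply: cap_contact_normal; first exact: PoD.
by rewrite xE.
Qed.

(** [insubd] returns the default [point] when its argument is not a unit vector; on the chart this
    does not occur. *)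
Definition gauss_map (x : U) : sphere R := 
  @insubd V _ (set_type [set u : V | enorm u = 1]) (point : sphere R) (Nhat x).

Lemma gauss_mapE x : D x -> set_val (gauss_map x) = Nhat x.
Proof.
move=> Dx; have [m1 _ _] := cap_contact ch Dx.
exact: (@insubdK V _ (set_type [set u : V | enorm u = 1]) _ (Nhat x) (mem_set m1)).
Qed.

Lemma unit_normal_continuous x : D x -> {for x, continuous Nhat}.
Proof.
move=> Dx; have [_ cN] := cap_continuous Dx.
have c1 : {for x, continuous (fun y => (enorm (N y))^-1)}.
  apply: (@continuous_comp _ _ _ (fun y => enorm (N y)) GRing.inv x).
    by apply: (@continuous_comp _ _ _ N (@enorm R 3) x cN); exact: continuous_enorm.
  by apply: inv_continuous; rewrite gt_eqF// cap_N_gt0.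
exact: (@continuousZ R V U (fun y => (enorm (N y))^-1) N x c1 cN).
Qed.

Lemma gauss_map_continuous : {within P, continuous gauss_map}.
Proof.
apply: (@continuous_comp_initial _ (subspace P) V (@set_val _ [set u : V | enorm u = 1]) gauss_map).
apply: (@subspace_eq_continuous U P V Nhat
  (@set_val _ [set u : V | enorm u = 1] \o gauss_map)) => [x /set_mem/PD Dx|].
  by rewrite /= gauss_mapE.
by apply: continuous_in_subspaceT => x /set_mem/PD; exact: unit_normal_continuous.
Qed.

Definition off_patch (X : set (sphere R)) : set V :=
  [set xi | [/\ boundary C xi, ~ (r @` P) xi &
    exists2 n : sphere R, outer_normals C xi = [set n] & X n]].

Section deformed.
Variables (dm : R) (R1 : U -> V) (M : U -> 'M[R]_2).
Hypotheses (dm0 : 0 < dm).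
Hypothesis slack : forall x m xi, Q x -> far_contact m xi ->
  dotp m (r x - xi) <= - (2 * dm) /\ dotp (N x) (xi - r x) <= - (2 * dm).
Variable z0 : V.
Hypothesis z0C : forall m x, contact C m x -> dotp m (z0 - x) <= - (2 * dm).
Hypothesis df : deformation dm R1 M.
Let Cb := deformed R1.

(** The factor [enorm (N x) + 1] in [def_close] bounds the displacement tested against N x as well
    as against any unit vector. *)
Let closeN x : D x -> `|dotp (N x) (R1 x - r x)| <= dm.
Proof.
move=> Dx; apply: le_trans (def_close df Dx); rewrite (le_trans (dotp_abs _ _))//.
by rewrite ler_wpM2r ?enorm_ge0// lerDl.
Qed.

Let close1 m x : D x -> enorm m = 1 -> `|dotp m (R1 x - r x)| <= dm.
Proof.
move=> Dx m1; apply: le_trans (def_close df Dx); rewrite (le_trans (dotp_abs _ _))//.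
by rewrite ler_wpM2r ?enorm_ge0// m1 lerDr enorm_ge0.
Qed.

Let c20 : 0 < c / 2. Proof. by rewrite divr_gt0 ?c0. Qed.

Let nQ x : D x -> ~ Q x -> R1 x = r x.
Proof. by move=> Dx /negP; rewrite -ltNge => /ltW; exact: (def_id df). Qed.

Lemma def_le0 x y : D x -> D y -> dotp (N x) (R1 y - R1 x) <= 0.
Proof.
move=> Dx Dy; rewrite (le_trans (def_quad df Dx Dy))// mulNr oppr_le0.
by rewrite mulr_ge0 ?sqr_ge0// ltW// c20.
Qed.

Lemma def_inj x y : D x -> D y -> R1 x = R1 y -> x = y.
Proof.
move=> Dx Dy e; symmetry; apply: (neg_quad c20).
by rewrite (le_trans _ (def_quad df Dx Dy))// e subrr dotp0r.
Qed.

Lemma def_far x m xi : D x -> far_contact m xi -> dotp m (R1 x - xi) <= 0.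
Proof.
move=> Dx mxi; have [[m1 _ mC] _] := mxi; have [Qx|/(nQ Dx) ->] := pselect (Q x).
  have [h _] := slack Qx mxi; have := close1 Dx m1.
  rewrite (_ : R1 x - xi = (R1 x - r x) + (r x - xi)); last by rewrite addrA subrK.
  by rewrite [dotp m (_ + (_ - _))]dotpDr ler_norml => /andP[_]; have := dm0; lra.
by apply: mC; exact: cap_mem.
Qed.

Lemma def_mem x : D x -> Cb (R1 x).
Proof. by move=> Dx; split=> [y /PD Dy|m xi]; [exact: def_le0|exact: def_far]. Qed.

(** Outside P the map R1 is still r, and the tangent half-space is that of a far contact. *)
Lemma deformed_side x z : Cb z -> D x -> dotp (N x) (z - R1 x) <= 0.
Proof.
move=> [h1 h2] Dx; have [Px|nPx] := pselect (P x); first exact: h1.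
rewrite (nQ Dx) => [|/QPo/PoP//]; rewrite -cap_le0//.
by apply: h2; apply: rim_far => // /PoP.
Qed.

Lemma deformed_convex : convex_set Cb.
Proof.
apply: convexI => x y t [hx1 hx2] [hy1 hy2] /andP[t0 t1].
have h m a : dotp m (x - a) <= 0 -> dotp m (y - a) <= 0 ->
    dotp m (x + t *: (y - x) - a) <= 0 :> R.
  move=> ha hb.
  have -> : x + t *: (y - x) - a = (1 - t) *: (x - a) + t *: (y - a).
    by apply/rowP => i; rewrite !mxE; ring.
  by rewrite dotpDr !dotpZr; rewrite -oppr_ge0 opprD -!mulrN addr_ge0// mulr_ge0 ?oppr_ge0 ?subr_ge0.
by split => [w Pw|m xi mxi]; apply: h; auto.
Qed.

Lemma deformed_closed : closed Cb.
Proof.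
have half m a : closed [set z : V | dotp m (z - a) <= 0].
  have hc : continuous (fun z : V => dotp m (z - a)).
    apply: (@lipschitz_continuous _ _ _ _ (3 * `|m| + 1)) => [|y z].
      by rewrite ltr_wpDl// mulr_ge0.
    rewrite -dotpBr opprB addrA subrK (le_trans (dotp_norm_le _ _))//.
    by rewrite mulrA ler_wpM2r// lerDl.
  apply: (@closed_comp _ _ (fun z : V => dotp m (z - a)) [set y | y <= 0]); last exact: closed_le.
  by move=> z _; exact: hc.
have -> : Cb = \bigcap_(x in P) [set z | dotp (N x) (z - R1 x) <= 0] `&`
    \bigcap_(p in [set p : V * V | far_contact p.1 p.2]) [set z | dotp p.1 (z - p.2) <= 0].
  apply/seteqP; split => z [h1 h2]; split => //.
  - by move=> [m xi] /h2.
  - by move=> m xi mxi; exact: (h2 (m, xi)).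
by apply: closedI; apply: closed_bigI.
Qed.

Lemma def_unit_side x z : D x -> dotp (N x) (z - R1 x) <= 0 ->
  dotp (Nhat x) (z - r x) <= dm.
Proof.
move=> Dx h; have [m1 _ _] := cap_contact ch Dx.
have := close1 Dx m1; rewrite ler_norml => /andP[_].
rewrite (_ : z - r x = (z - R1 x) + (R1 x - r x)); last by rewrite addrA subrK.
by move: h; rewrite -cap_le0// [in X in _ -> _ -> X]dotpDr => h1 h2; rewrite -[leRHS]add0r lerD.
Qed.

(** The contact at the projection of z onto C separates z from C, so it cannot be far. It thus sits
    at a point r x of the moved part, and the constraint at R1 x bounds the distance from z to r x
    by the displacement. *)
Lemma deformed_near z : Cb z -> ~ C z -> exists x, [/\ Po x, Q x,
  0 < enorm (z - r x) <= dm & forall m, enorm m = 1 -> dotp m (z - r x) <= dm].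
Proof.
move=> [h1 h2] nCz; have [p Cp hp] := nearest bodyC z.
have [zp zc ze] := contact_nearest nCz Cp hp.
have [/h2|[x [Px xE mE]]] := contact_cases zc; first by rewrite ze leNgt zp.
have Dx := PoD Px.
have le : enorm (z - r x) <= dm.
  rewrite -xE -ze mE xE; apply: def_unit_side => //; exact: (h1 _ (PoP Px)).
exists x; split => //; last first.
- by move=> m m1; rewrite (le_trans (dotp_le _ _))// m1 mul1r.
- by rewrite -xE zp xE.
apply: contrapT => /(nQ Dx) e; have := h1 _ (PoP Px).
by rewrite e -cap_le0// -mE -xE ze leNgt zp.
Qed.

Lemma deformed_bounded : bounded_set Cb.
Proof.
have [L L0 CL] := body_bounded bodyC.
exists (L + dm); split; first exact: num_real.
move=> T hT z Cz; apply: le_trans (ltW hT).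
have [CCz|/(deformed_near Cz)[x [Px _ /andP[_ h] _]]] := pselect (C z).
  by rewrite (le_trans (ltW (CL _ CCz)))// lerDl ltW.
rewrite -(subrK (r x) z) (le_trans (ler_normD _ _))// addrC lerD//.
  by rewrite ltW// CL//; exact: (cap_mem (PoD Px)).
by rewrite (le_trans (norm_le_enorm _)).
Qed.

Lemma deformed_interior : Cb° !=set0.
Proof.
(* A depth 2 dm below the supporting planes, less the displacement dm, leaves a margin dm; the 3
   passes to the sup norm. *)
exists z0; apply/nbhs_ballP; exists (dm / 3); first by rewrite /= divr_gt0.
move=> z; rewrite -ball_normE /= => zz.
have e m : enorm m = 1 -> dotp m (z - z0) <= dm.
  move=> m1; rewrite (le_trans (dotp_le _ _))// m1 mul1r.
  rewrite (le_trans (enorm_le_norm _))// distrC mulrC -ler_pdivlMr//.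
  exact: ltW.
split => [x /PD Dx|m xi [mxi _]].
  have mc := cap_contact ch Dx; have [m1 _ _] := mc.
  rewrite -cap_le0// (_ : z - R1 x = (z - z0) + (z0 - r x) - (R1 x - r x)); last first.
    by rewrite addrA subrK opprB addrA subrK.
  rewrite dotpBr dotpDr; have := close1 Dx m1; rewrite ler_norml => /andP[h _].
  by have := e _ m1; have := z0C mc; rewrite -/(Nhat x); move: h; rewrite -/(Nhat x); lra.
have [m1 _ _] := mxi; rewrite (_ : z - xi = (z - z0) + (z0 - xi)); last by rewrite addrA subrK.
by rewrite dotpDr; have := e _ m1; have := z0C mxi; have := dm0; lra.
Qed.

Lemma deformed_body : convex_body Cb.
Proof.
split; [exact: deformed_convex| |exact: deformed_interior].
by apply: bounded_closed_compact; [exact: deformed_bounded|exact: deformed_closed].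
Qed.

Lemma def_tangent x k : D x -> dotp (N x) k = 0 -> exists h, k = h *m (M x *m B x).
Proof.
move=> Dx hk; have [h ->] := cap_span ch Dx hk.
by exists (h *m invmx (M x)); rewrite mulmxA mulmxKV// (def_unit df Dx).
Qed.

Lemma def_span0 x h : D x -> dotp (N x) (h *m (M x *m B x)) = 0.
Proof. by move=> Dx; rewrite mulmxA; exact: (cap_ortho ch _ Dx). Qed.

Lemma def_outer_normals x (n : sphere R) : D x ->
  outer_normals Cb (R1 x) n <-> set_val n = Nhat x.
Proof.
move=> Dx; split => [nC|nE z Cz]; last by rewrite nE cap_le0// deformed_side.
apply: (@patch_normal R1 (M x *m B x) Cb _ x Dx) => //.
- exact: (def_sdiff df Dx).
- by move=> k; exact: def_tangent.
- by apply: filterS (cap_near Dx) => y; exact: def_mem.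
- by have := set_valP n.
have [y Dy yx] := cap_other Dx; exists (R1 y); first exact: def_mem.
rewrite (le_lt_trans (def_quad df Dx Dy))// mulNr oppr_lt0 mulr_gt0// exprn_gt0//.
by rewrite normr_gt0 subr_eq0.
Qed.

Lemma mem_deformed xi : C xi -> (forall x, Q x -> dotp (N x) (xi - R1 x) <= 0) -> Cb xi.
Proof.
move=> Cxi h; split => [x /PD Dx|m y [[_ _ mC] _]]; last exact: mC.
by have [/h//|/(nQ Dx) ->] := pselect (Q x); exact: cap_side.
Qed.

Lemma far_mem m xi : far_contact m xi -> Cb xi.
Proof.
move=> mxi; have [[_ Cxi _] _] := mxi; apply: mem_deformed => // x Qx.
have Dx := PoD (QPo Qx); have [_ h] := slack Qx mxi; have := closeN Dx.
rewrite (_ : xi - R1 x = (xi - r x) - (R1 x - r x)); last by rewrite opprB addrA subrK.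
by rewrite [dotp _ (_ - (_ - _))]dotpBr ler_norml => /andP[+ _]; have := dm0; lra.
Qed.

(** The constraints of the moved cap hold at xi with margin dm. Hence a point of C, drawn towards xi
    along a segment, enters the deformed body, and the normal inequality is insensitive to this
    scaling. Conversely, an outer normal of C at xi is itself one of the far constraints. *)
Lemma far_outer_normals m xi : far_contact m xi ->
  outer_normals Cb xi = outer_normals C xi.
Proof.
move=> mxi; have [[_ Cxi _] nxi] := mxi; apply/seteqP; split => n /= nC z.
  move=> Cz; have [convC _ _] := bodyC.
  pose W := 3 * (K * `|z - xi|) + 1; have W0 : 0 < W by rewrite ltr_wpDl// !mulr_ge0// ltW.
  pose t := Num.min 1 (dm / W); have t0 : 0 < t by rewrite lt_min ltr01 divr_gt0.
  have tW : t * W <= dm by rewrite -ler_pdivlMr// ge_min lexx orbT.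
  suff /nC : Cb (xi + t *: (z - xi)) by rewrite addrAC subrr add0r dotpZr pmulr_rle0.
  apply: mem_deformed => [|x Qx].
    by apply: convexP => //; rewrite (ltW t0) ge_min lexx.
  have Dx := PoD (QPo Qx); have [_ h] := slack Qx mxi; have := closeN Dx.
  rewrite (_ : _ - R1 x = (xi - r x) - (R1 x - r x) + t *: (z - xi)); last first.
    by rewrite opprB addrA subrK addrAC.
  have : t * dotp (N x) (z - xi) <= dm.
    apply: le_trans tW; rewrite ler_wpM2l ?(ltW t0)// (le_trans (ler_norm _))//.
    rewrite (le_trans (dotp_norm_le _ _))// (_ : W = 3 * (K * `|z - xi|) + 1)// -[leLHS]addr0 lerD//.
    by rewrite ler_wpM2l// ler_wpM2r// (cap_boundN ch Dx).
  rewrite [dotp _ (_ + t *: _)]dotpDr dotpZr [dotp _ (_ - (_ - _))]dotpBr ler_norml.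
  by move=> + /andP[+ _]; lra.
move=> [_ h]; apply: h; split => //; split => //.
by have := set_valP n.
Qed.

Lemma def_disjoint x m : D x -> ~ far_contact m (R1 x) \/ (~ Q x /\ R1 x = r x).
Proof.
move=> Dx; have [Qx|nq] := pselect (Q x); last by right; split => //; exact: nQ.
left=> mx; have [h _] := slack Qx mx; have [[m1 _ _] _] := mx.
by have := close1 Dx m1; rewrite -opprB dotpNr in h; rewrite ler_norml => /andP[_ +]; have := dm0; lra.
Qed.

(* The constraint N y . (z - R1 y) <= 0 is active at y = x, so its differential
   vanishes there; since N x and the image of dN span the space, z = R1 x. *)
Lemma def_active z x : Cb z -> D x -> dotp (N x) (z - R1 x) = 0 -> z = R1 x.
Proof.
move=> Cz Dx e.
have s1 := sdiff_dotp (cap_N ch Dx) (sdiffB (sdiff_cst z x) (def_sdiff df Dx)).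
have {}s1 := sdiff_max s1.
have key h : dotp (h *m A x) (z - R1 x) = 0.
  have : dotp (N x) (0 - h *m (M x *m B x)) + dotp (h *m A x) (z - R1 x) = 0.
    move: h; apply: s1 => [a h|].
      by rewrite -!scalemxAl !sub0r -scalerN dotpZr dotpZl mulrDr.
    by apply: filterS (cap_near Dx) => y Dy; rewrite e; exact: deformed_side.
  by rewrite sub0r dotpNr def_span0// oppr0 add0r.
have [h hE] := cap_span ch Dx e.
have := cap_mono h Dx; rewrite -hE key => h0.
apply/eqP; rewrite -subr_eq0 hE; suff -> : h = 0 by rewrite mul0mx.
apply/eqP; rewrite -normr_eq0 -sqrf_eq0 eq_le sqr_ge0 andbT.
by rewrite -(pmulr_rle0 _ (mulr_gt0 (ltr0n _ 2) c0)).
Qed.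

Lemma def_contact x : D x -> contact Cb (Nhat x) (R1 x).
Proof.
move=> Dx; have [m1 _ _] := cap_contact ch Dx; split => //; first exact: def_mem.
by move=> z Cz; rewrite cap_le0// deformed_side.
Qed.

Lemma far_contact_deformed m xi : far_contact m xi -> contact Cb m xi.
Proof.
move=> mxi; have [[m1 _ _] _] := mxi; split => //; first exact: far_mem mxi.
by move=> z [_]; apply.
Qed.

Lemma def_continuous x : D x -> {for x, continuous R1}.
Proof. by move=> Dx; exact: (sdiff_continuous (def_sdiff df Dx)). Qed.

(** If no constraint were active, both families, being indexed by compact sets, would have a uniform
    slack and a ball around z would stay in the body. *)
Lemma deformed_active z : boundary Cb z ->
  (exists2 x, P x & dotp (N x) (z - R1 x) = 0) \/
  (exists m xi, far_contact m xi /\ dotp m (z - xi) = 0).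
Proof.
move=> bz; have Cz := boundary_sub deformed_body bz; have [_ niz] := bz; have [z1 z2] := Cz.
apply: contrapT => /not_orP[nx nm]; apply: niz.
have [|x Px|d1 d10 h1] := @compact_slack _ _ P (fun x => dotp (N x) (z - R1 x)) (@compact_disk _).
- apply: continuous_in_subspaceT => x /set_mem/PD Dx.
  apply: (@continuous_dotp _ _ _ N (fun x => z - R1 x)); first by have [] := cap_continuous Dx.
  by apply: (@continuousB _ _ _ (fun=> z) R1); [exact: cst_continuous|exact: def_continuous].
- by rewrite lt_neqAle z1// andbT; apply/eqP => e; apply: nx; exists x.
have [|[m xi] mxi|d2 d20 h2] := @compact_slack _ _ _ (fun p : V * V => dotp p.1 (z - p.2)) far_compact.
- exact: continuous_subspaceT (@continuous_dotp_pair _ z).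
- by rewrite lt_neqAle z2// andbT; apply/eqP => e; apply: nm; exists m, xi.
pose d := Num.min (d1 / (3 * K)) (d2 / 3).
have K3 : 0 < 3 * K by rewrite mulr_gt0// K0.
apply/nbhs_ballP; exists d; first by rewrite /= lt_min !divr_gt0.
move=> y; rewrite -ball_normE /= lt_min distrC => /andP[/ltW y1 /ltW y2].
rewrite ler_pdivlMr// in y1; rewrite ler_pdivlMr// in y2.
split => [x Px|m xi mxi].
  rewrite (_ : y - R1 x = (y - z) + (z - R1 x)); last by rewrite addrA subrK.
  rewrite [dotp _ (_ + (_ - _))]dotpDr; have := h1 x Px.
  have := le_trans (ler_norm _) (dotp_norm_le (N x) (y - z)).
  have := ler_wpM2r (normr_ge0 (y - z)) (cap_boundN ch (PD Px)); move: y1.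
  by move: (`|N x| * _) => u; lra.
rewrite (_ : y - xi = (y - z) + (z - xi)); last by rewrite addrA subrK.
rewrite [dotp _ (_ + (_ - _))]dotpDr; have /= := h2 (m, xi) mxi.
have [[m1 _ _] _] := mxi.
have := le_trans (ler_norm _) (dotp_norm_le m (y - z)).
have : `|m| * `|y - z| <= `|y - z| by rewrite ler_piMl// -m1 norm_le_enorm.
by move: y2; move: (`|m| * _) => u; lra.
Qed.

(** An active constraint of the moved patch forces z = R1 x. If a far constraint is active at z,
    then z lies in C, since otherwise [deformed_near] places it near a moved cap point, strictly
    below all far planes; so z is an old boundary point, and by [cap_strict] it is not over the open
    disk. Rim points are counted with the patch, where R1 = r. *)
Lemma boundary_deformed z :
  boundary Cb z <-> (R1 @` P) z \/ (boundary C z /\ ~ (r @` P) z).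
Proof.
have rim x : P x -> ~ Po x -> R1 x = r x by move=> Px nPo; apply: nQ => [|/QPo//]; exact: PD.
split; last first.
  move=> [[x Px <-]|[/(boundary_contact bodyC)[m mz] nP]]; apply/(boundary_contact deformed_body).
    by exists (Nhat x); apply: def_contact; exact: PD.
  exists m; apply: far_contact_deformed; split => // -[x Px xz]; apply: nP; exists x => //.
  exact: PoP.
move=> bz; have Cz := boundary_sub deformed_body bz.
have [[x Px e]|[m [xi [mxi e]]]] := deformed_active bz.
  by left; exists x => //; symmetry; apply: def_active => //; exact: PD.
have [[m1 Cxi mC] nxi] := mxi.
have [CCz|nCz] := pselect (C z); last first.
  have [x [Px Qx _ /(_ m m1)]] := deformed_near Cz nCz; have [h _] := slack Qx mxi.
  move: e; rewrite (_ : z - xi = (z - r x) + (r x - xi)); last by rewrite addrA subrK.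
  by rewrite [dotp _ (_ + (_ - _))]dotpDr; have := dm0; lra.
have mz := contact_trans (proj1 mxi) CCz e.
have bCz : boundary C z by apply/(boundary_contact bodyC); exists m.
have [[_ nPo]|[x [Px zE mE]]] := contact_cases mz.
  have [[x Px xz]|nP] := pselect ((r @` P) z); last by right.
  left; exists x => //; rewrite rim// => Pox; apply: nPo; by exists x.
exfalso; apply: nxi; exists x => //; symmetry; apply: cap_strict => //; first exact: PoD.
have Dx := PoD Px; apply/eqP; move: e; rewrite mE zE dotpZl -opprB dotpNr mulrN => /eqP.
by rewrite oppr_eq0 mulf_eq0 invr_eq0 gt_eqF ?cap_N_gt0.
Qed.

Lemma def_off_patch x : P x -> boundary C (R1 x) -> (r @` P) (R1 x).
Proof.
move=> Px /(boundary_contact bodyC)[m mx]; apply: contrapT => nP.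
have fm : far_contact m (R1 x).
  by split => // -[y Py e]; apply: nP; exists y => //; exact: PoP.
by have [//|[_ e]] := def_disjoint m (PD Px); apply: nP; rewrite e; exists x.
Qed.

Lemma def_normals x : D x -> outer_normals Cb (R1 x) = [set gauss_map x].
Proof.
move=> Dx; apply/seteqP; split => n.
  by move=> /(def_outer_normals n Dx) e; apply/val_inj; rewrite [RHS]gauss_mapE.
by move=> ->; apply/def_outer_normals => //; exact: gauss_mapE.
Qed.

Lemma def_surface_map : surface_map R1 P.
Proof.
split; first exact: closed_disk.
  by apply: continuous_in_subspaceT => x /set_mem/PD Dx; exact: def_continuous.
by move=> x y /set_mem/PD Dx /set_mem/PD Dy; exact: def_inj.
Qed.

Lemma deformed_surface_measure X : surface_measure Cb X =
  (hausdorff2 (R1 @` (gauss_map @^-1` X `&` P)) + hausdorff2 (off_patch X))%E.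
Proof.
have [cP cR _] := def_surface_map.
have bP : <<s @open V >> (R1 @` P).
  apply: closed_borel; apply: compact_closed; first exact: norm_hausdorff.
  exact: (continuous_compact cR (@compact_disk _)).
rewrite /surface_measure [LHS](borel_caratheodory bP).
congr (hausdorff2 _ + hausdorff2 _)%E; apply/seteqP; split => z.
- move=> [[bz [n nz Xn]] [x Px xz]]; exists x => //; split => //=.
  by move: nz; rewrite -xz def_normals; [move=> /seteqP[/(_ _ erefl) -> _]|exact: PD].
- move=> [x [Xx Px] <-]; split; last by exists x.
  split; first by apply/boundary_deformed; left; exists x.
  by exists (gauss_map x) => //; apply: def_normals; exact: PD.
- move=> [[/boundary_deformed[//|[bz nP]] [n nz Xn]] nR]; split => //; exists n => //.
  move: bz => /(boundary_contact bodyC)[m mz]; rewrite -(@far_outer_normals m)//.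
  by split => // -[x /PoP Px xz]; apply: nP; exists x.
- move=> [bz nP [n nz Xn]]; split; last first.
    by move=> [x Px xz]; apply: nP; rewrite -xz; apply: def_off_patch => //; rewrite xz.
  split; first by apply/boundary_deformed; right.
  exists n => //; move: bz => /(boundary_contact bodyC)[m mz]; rewrite (@far_outer_normals m)//.
  by split => // -[x /PoP Px xz]; apply: nP; exists x.
Qed.

End deformed.

End cap.

(** * The dilated patch and its Jacobian *)

Section dilated_patch.
Context {R : realType}.
Local Notation U := 'rV[R]_2.
Local Notation V := 'rV[R]_3.
Variables (C : set V) (bodyC : convex_body C) (r N : U -> V) (B A : U -> 'M[R]_(2, 3)).
Variables (x0 : U) (rho c K : R) (ch : cap_chart C r N B A x0 rho c K).
Local Notation D := [set x : U | `|x - x0| < rho].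

Let rho0 : 0 < rho. Proof. exact: cap_rho ch. Qed.
Let c0 : 0 < c. Proof. exact: cap_c ch. Qed.
Let K0 : 0 < K. Proof. exact: cap_K ch. Qed.
Let Dx0 : D x0. Proof. by rewrite /= subrr normr0. Qed.

Let p x := dotp (N x) (N x0).

(* The tangent plane at r x meets the line through r x0 in the direction N x0 at
   the point r x0 + height x *: N x0, and lever x joins this point to r x. *)
Definition height x : R := dotp (N x) (r x - r x0) / p x.

Definition lever x : V := r x - r x0 - height x *: N x0.

Definition dheight x (h : U) : R := dotp (h *m A x) (lever x) / p x.

(** The lever is tangent at r x, so coordinates exist on the chart; 0 is a default elsewhere. *)
Definition lever_coord x : U := xget 0 [set h | lever x = h *m B x].

Let K3_gt0 : 0 < 3 * K ^+ 2. Proof. by rewrite mulr_gt0// exprn_gt0// K0. Qed.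

Let coef_gt0 : 0 < c / (3 * K ^+ 2). Proof. by rewrite divr_gt0 ?c0 ?K3_gt0. Qed.

Let p_gt0 x : D x -> 0 < p x.
Proof. by move=> Dx; rewrite (lt_le_trans _ (cap_pos ch Dx))// invr_gt0 K0. Qed.

Lemma lever_ortho x : D x -> dotp (N x) (lever x) = 0.
Proof. by move=> Dx; rewrite dotpBr dotpZr divfK ?subrr// gt_eqF// p_gt0. Qed.

Lemma lever_coordE x : D x -> lever x = lever_coord x *m B x.
Proof.
move=> Dx; apply: (@xgetPex _ 0 [set h | lever x = h *m B x]).
exact: (cap_span ch Dx (lever_ortho Dx)).
Qed.

(** Differentiate [height x * p x = dotp (N x) (r x - r x0)]: the term with dr vanishes since N x is
    normal, and the terms with dN combine into the lever. *)
Lemma height_sdiff x : D x -> sdiff height x (dheight x).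
Proof.
move=> Dx; have px := p_gt0 Dx.
have sq : sdiff (fun y => dotp (N y) (r y - r x0)) x (fun h => dotp (h *m A x) (r x - r x0)).
  apply: sdiff_ext (sdiff_dotp (cap_N ch Dx) (sdiffB (cap_r ch Dx) (sdiff_cst _ _))) _ => h.
  by rewrite subr0 (cap_ortho ch) ?add0r.
have spp : sdiff p x (fun h => dotp (h *m A x) (N x0)).
  apply: sdiff_ext (sdiff_dotp (cap_N ch Dx) (sdiff_cst _ _)) _ => h.
  by rewrite dotp0r add0r.
have sv : sdiff (fun y => (p y)^-1) x (fun h => dotp (h *m A x) (N x0) *: (- (p x) ^- 2)).
  apply: (sdiff_comp (g := GRing.inv) spp).
  apply: (@C1_sdiff_line _ _ (fun s => - s ^- 2)).
    have : \forall s \near p x, 0 < s by exact: lt_nbhsr.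
    by apply: filterS => s /gt_eqF/negbT s0; apply: is_derive_eq (is_deriveV _ (is_derive_id s 1)) _ => //; rewrite -[LHS]/(_ * 1) mulr1.
  apply: cvgN; apply: cvgV; first by rewrite expf_neq0// gt_eqF.
  by apply: exprn_continuous.
apply: sdiff_ext (sdiffM sq sv) _ => h.
rewrite /dheight /lever [dotp _ (_ - _ *: _)]dotpBr dotpZr /height -[_ *: _]/(_ * _).
by field; rewrite gt_eqF.
Qed.

Lemma height_ge x : D x -> c / (3 * K ^+ 2) * `|x - x0| ^+ 2 <= height x.
Proof.
move=> Dx; have px := p_gt0 Dx.
have pK : p x <= 3 * K ^+ 2.
  rewrite (le_trans (ler_norm _))// (le_trans (dotp_norm_le _ _))// ler_wpM2l// expr2.
  by rewrite ler_pM// (cap_boundN ch).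
rewrite /height ler_pdivlMr// mulrAC mulrAC -mulrA mulrAC ler_pdivrMr ?K3_gt0//.
have := cap_quad ch Dx Dx0; rewrite distrC -opprB dotpNr => h.
have c1 : 0 <= c * `|x - x0| ^+ 2 by rewrite mulr_ge0 ?sqr_ge0// ltW// c0.
have K1 := ltW K3_gt0.
have := ler_wpM2l c1 pK; have := ler_wpM2r K1 h; lra.
Qed.

Lemma height0 : height x0 = 0.
Proof. by rewrite /height subrr dotp0r mul0r. Qed.

Lemma height_ge0 x : D x -> 0 <= height x.
Proof.
by move=> /height_ge; apply: le_trans; rewrite mulr_ge0 ?sqr_ge0// ltW// coef_gt0.
Qed.

(** By [height_ge], a lower bound for the height outside the disk of radius rho / 2; a profile that
    vanishes above it moves only points over that disk. *)
Definition rim_height : R := c / (3 * K ^+ 2) * (rho / 2) ^+ 2.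

Let hi := rim_height.

Lemma rim_height_gt0 : 0 < hi.
Proof. by rewrite mulr_gt0 ?coef_gt0// exprn_gt0// divr_gt0// rho0. Qed.

Lemma height_rim x : D x -> rho / 2 <= `|x - x0| -> hi <= height x.
Proof.
move=> Dx h; apply: le_trans (height_ge Dx).
rewrite ler_wpM2l ?(ltW coef_gt0)//.
by rewrite ler_sqr ?nnegrE// divr_ge0// ltW// rho0.
Qed.

Lemma dheightZ x a h : dheight x (a *: h) = a * dheight x h.
Proof. by rewrite /dheight -scalemxAl dotpZl mulrA. Qed.

Lemma dheightD x h h' : dheight x (h + h') = dheight x h + dheight x h'.
Proof. by rewrite /dheight mulmxDl dotpDl mulrDl. Qed.

Lemma dheightE x h : dheight x h =
  h 0 0 * dheight x (delta_mx 0 0) + h 0 1 * dheight x (delta_mx 0 1).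
Proof. by rewrite {1}(vec2E h) dheightD !dheightZ. Qed.

Lemma patch_bounds : exists2 L, 0 < L & forall x, D x ->
  [/\ `|r x - r x0| <= L, `|N x0| <= L, `|lever x| <= L,
      forall h, `|dheight x h| <= L * `|h| & `|lever_coord x| <= L].
Proof.
pose L1 := K * rho; pose L2 := 3 * (K * L1) * K.
pose L3 := L1 + L2 * K; pose L4 := 3 * (K * L3) * K; pose L5 := 3 * K * L3 / (2 * c).
have K0' := K0; have L10 : 0 < L1 by rewrite mulr_gt0 ?rho0.
have L20 : 0 < L2 by rewrite !mulr_gt0.
have L30 : 0 < L3 by rewrite addr_gt0// mulr_gt0.
have L40 : 0 < L4 by rewrite !mulr_gt0.
have L50 : 0 < L5 by rewrite divr_gt0 ?mulr_gt0 ?c0.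
exists (L1 + K + L3 + L4 + L5) => [|x Dx].
  exact: (addr_gt0 (addr_gt0 (addr_gt0 (addr_gt0 L10 K0') L30) L40) L50).
have px := p_gt0 Dx.
have pK : (p x)^-1 <= K by rewrite invf_ple ?posrE// (cap_pos ch Dx).
have pV : 0 <= (p x)^-1 by rewrite invr_ge0 ltW.
have N0 : `|N x0| <= K by exact: (cap_boundN ch Dx0).
have Nx : `|N x| <= K by exact: (cap_boundN ch Dx).
have h1 : `|r x - r x0| <= L1.
  by rewrite (le_trans (cap_lipr ch Dx0 Dx))// ler_wpM2l ?(ltW K0)// ltW.
have h2 : `|height x| <= L2.
  rewrite /height normrM [X in _ * X]ger0_norm// ler_pM//.
  by rewrite (le_trans (dotp_norm_le _ _))// ler_wpM2l// ler_pM.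
have h3 : `|lever x| <= L3.
  by rewrite (le_trans (ler_normB _ _))// lerD// normrZ ler_pM.
have h4 h : `|dheight x h| <= L4 * `|h|.
  rewrite /dheight normrM [X in _ * X]ger0_norm//.
  rewrite (_ : L4 * `|h| = 3 * (K * `|h| * L3) * K); last by rewrite /L4; ring.
  rewrite ler_pM// (le_trans (dotp_norm_le _ _))// ler_wpM2l// ler_pM//.
  by have [] := cap_opnorm ch h Dx.
have h5 : `|lever_coord x| <= L5.
  rewrite /L5 ler_pdivlMr ?mulr_gt0 ?c0// mulrC (le_trans (cap_lower ch _ Dx))//.
  by rewrite -lever_coordE// ler_wpM2l// mulr_ge0// ltW.
clearbody L1 L2 L3 L4 L5; split; [lra|lra|lra| |lra].
by move=> h; rewrite (le_trans (h4 h))// ler_wpM2r//; lra.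
Qed.

Variables (b b' : R -> R).

Definition patch_map x : V :=
  r x + (dilation b (height x) *: (r x - r x0) + shift_of hi b (height x) *: N x0).

(** The differential of [patch_map] in the basis B x: a multiple of the identity plus the rank-one
    matrix of dheight and the lever. *)
Definition jac x (i j : 'I_2) : R := (1 + dilation b (height x)) * (i == j)%:R +
  dilation' b b' (height x) * dheight x (delta_mx 0 i) * lever_coord x 0 j.

Definition jac_mx x : 'M[R]_2 := mx2 (jac x 0 0) (jac x 0 1) (jac x 1 0) (jac x 1 1).

(** The trace of that rank-one matrix without its factor k', that is, dheight applied to the
    coordinates of the lever. *)
Definition divergence x : R := dheight x (delta_mx 0 0) * lever_coord x 0 0 +
  dheight x (delta_mx 0 1) * lever_coord x 0 1.

Variable eta : R.
Hypotheses (eta2 : eta <= 1 / 2) (pb : profile hi eta b b').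

(** A rank-one perturbation contributes only its trace: the determinant is (1 + k)^2 + (1 + k) k'
    times the divergence. *)
Lemma jac_det x : jac x 0 0 * jac x 1 1 - jac x 0 1 * jac x 1 0 =
  1 + b (height x) + b' (height x) * (divergence x / 2).
Proof.
have [_ e _] := dilation_sqrt eta2 pb (height x).
have e' := dilation_dilation' eta2 pb (height x).
rewrite -[1 + b _]e -e' /jac /divergence /= !mulr1 !mulr0 !add0r.
by field.
Qed.

Let shift' s := - (s * dilation' b b' s).

Lemma dilation_height_sdiff x : D x -> sdiff (fun y => dilation b (height y)) x
  (fun h => dheight x h * dilation' b b' (height x)).
Proof.
move=> Dx; exact (sdiff_comp (height_sdiff Dx) (dilation_sdiff eta2 pb (height x))).
Qed.

Lemma shift_height_sdiff x : D x -> sdiff (fun y => shift_of hi b (height y)) x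
  (fun h => dheight x h * shift' (height x)).
Proof.
move=> Dx.
exact (sdiff_comp (height_sdiff Dx) (shift_sdiff eta2 pb (height_ge0 Dx))).
Qed.

Definition displacement' x (h : U) : V := dilation b (height x) *: (h *m B x) +
  (dheight x h * dilation' b b' (height x)) *: lever x.

(** Here the choice G' = - t k' acts: the derivatives of k and G add up to k' dheight times the
    lever, so the displacement has a tangent differential. *)
Lemma displacement_sdiff x : D x ->
  sdiff (fun x => dilation b (height x) *: (r x - r x0) + shift_of hi b (height x) *: N x0) x
    (displacement' x).
Proof.
move=> Dx; have s1 := sdiffZ (dilation_height_sdiff Dx) (sdiffB (cap_r ch Dx) (sdiff_cst (r x0) x)).
have s2 := sdiffZ (shift_height_sdiff Dx) (sdiff_cst (N x0) x).
apply: sdiff_ext (sdiffD s1 s2) _ => h.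
rewrite /displacement' /lever subr0 scaler0 add0r -addrA; congr (_ + _).
rewrite [RHS]scalerBr scalerA; congr (_ + _).
by rewrite /shift' -scaleNr; congr (_ *: _); ring.
Qed.

Lemma patch_map_sdiff x : D x -> sdiff patch_map x (fun h => h *m (jac_mx x *m B x)).
Proof.
move=> Dx; apply: sdiff_ext (sdiffD (cap_r ch Dx) (displacement_sdiff Dx)) _ => h.
rewrite /displacement' (lever_coordE Dx) mulmxA mul_rV_mx2 addrA.
rewrite -[X in X + _ + _]scale1r -scalerDl !scalemxAl -mulmxDl; congr (_ *m _).
rewrite (dheightE x h); apply: rV2P; rewrite !mxE /= /jac /= ?mulr1 ?mulr0 ?add0r; ring.
Qed.

End dilated_patch.

Section small_profiles.
Context {R : realType}.
Local Notation U := 'rV[R]_2.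
Local Notation V := 'rV[R]_3.
Variables (C : set V) (r N : U -> V) (B A : U -> 'M[R]_(2, 3)).
Variables (x0 : U) (rho c K : R) (ch : cap_chart C r N B A x0 rho c K).
Local Notation D := [set x : U | `|x - x0| < rho].
Local Notation hi := (rim_height rho c K).
Local Notation height := (height r N x0).

Let rho0 : 0 < rho. Proof. exact: cap_rho ch. Qed.
Let c0 : 0 < c. Proof. exact: cap_c ch. Qed.
Let K0 : 0 < K. Proof. exact: cap_K ch. Qed.

Let norm3 (a b d : R) : `|a * b * d| = `|a| * `|b| * `|d|.
Proof. by rewrite !normrM. Qed.

Lemma displacement'_ortho b b' x h : D x ->
  dotp (N x) (displacement' r N B A x0 b b' x h) = 0.
Proof.
move=> Dx; rewrite dotpDr !dotpZr (cap_ortho ch)// (lever_ortho ch)//.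
by rewrite !mulr0 addr0.
Qed.

(** The convexity estimate [def_quad] survives because the differential of the displacement is
    tangent: integrated from x to y, its product with N x is of second order in y - x, with a
    coefficient proportional to eta. *)
Lemma deformation_exists d : 0 < d -> exists2 eta, 0 < eta <= 1 / 2 & forall b b',
  profile hi eta b b' ->
  [/\ deformation r N B x0 rho c d (patch_map r N x0 rho c K b) (jac_mx r N B A x0 b b'),
   forall x, D x -> 0 < jac r N B A x0 b b' x 0 0 &
   forall x, D x -> 0 < jac r N B A x0 b b' x 0 0 * jac r N B A x0 b b' x 1 1 -
     jac r N B A x0 b b' x 0 1 * jac r N B A x0 b b' x 1 0].
Proof.
move=> d0; have [L L0 HL] := patch_bounds ch.
have hi0 : 0 < hi := rim_height_gt0 ch.
(* The three bounds keep the displacement within d ([e1]), half of the quadratic estimate ([e2]),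
   and the first entry and the determinant of the Jacobian positive ([e3]). *)
pose e1 := d / ((3 * K + 1) * (3 * ((1 + hi ^+ 2) * L))).
pose e2 := (c / 2) / (3 * (K * (K + L ^+ 2))).
pose e3 := 1 / (4 * L ^+ 2).
have q0 : 0 < 1 + hi ^+ 2 by rewrite ltr_pwDl// sqr_ge0.
have p1 : 0 < (3 * K + 1) * (3 * ((1 + hi ^+ 2) * L)).
  by rewrite mulr_gt0 ?mulr_gt0// ltr_pwDr// mulr_ge0// ltW// K0.
have p2 : 0 < 3 * (K * (K + L ^+ 2)).
  by rewrite mulr_gt0// mulr_gt0 ?K0// ltr_pwDl ?K0// sqr_ge0.
have p3 : 0 < 4 * L ^+ 2 by rewrite mulr_gt0// exprn_gt0.
pose eta := Num.min (1 / 2) (Num.min e1 (Num.min e2 e3)).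
have eta0 : 0 < eta by rewrite !lt_min !divr_gt0// c0.
have eta2 : eta <= 1 / 2 by rewrite ge_min lexx.
have h1 : eta * ((3 * K + 1) * (3 * ((1 + hi ^+ 2) * L))) <= d.
  by rewrite -ler_pdivlMr// !ge_min lexx !orbT.
have h2 : eta * (3 * (K * (K + L ^+ 2))) <= c / 2.
  by rewrite -ler_pdivlMr// !ge_min lexx !orbT.
have h3 : eta * (4 * L ^+ 2) <= 1 by rewrite -ler_pdivlMr// !ge_min lexx !orbT.
exists eta; first by rewrite eta0.
clearbody eta; clear e1 e2 e3 => b b' pb.
have kb x := dilation_sqrt eta2 pb (height x).
have kb' x : `|dilation' b b' (height x)| <= eta := dilation'_bound eta2 pb _.
have gb x : D x -> `|shift_of hi b (height x)| <= hi ^+ 2 * eta.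
  by move=> Dx; apply: (shift_bound hi0 eta2 pb); exact: (height_ge0 ch).
have small x i j : D x ->
    `|dilation' b b' (height x) * dheight r N A x0 x (delta_mx 0 i) * lever_coord r N B x0 x 0 j| <= 1 / 4.
  move=> Dx; have [_ _ _ hd hc] := HL x Dx.
  have : `|dheight r N A x0 x (delta_mx 0 i)| <= L.
    rewrite (le_trans (hd _))// ler_piMr ?(ltW L0)//.
    by apply: norm_rV_le => // k; rewrite mxE /=; case: (k == i); rewrite ?normr0 ?normr1.
  have : `|lever_coord r N B x0 x 0 j| <= L by rewrite (le_trans (coord_le_norm _ _)).
  rewrite norm3 => g1 g2; apply: (@le_trans _ _ (eta * L * L)).
    by rewrite ler_pM ?mulr_ge0// ler_pM.
  by move: h3; rewrite expr2; lra.
have J0 x : D x -> 0 < jac r N B A x0 b b' x 0 0.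
  move=> Dx; rewrite /jac /= mulr1; have := small x 0 0 Dx; rewrite ler_norml => /andP[h _].
  by have [k1 _ _] := kb x; move: k1; rewrite -{1}(subrK 1 (Num.sqrt _)) -/(dilation b _); lra.
have Jd x : D x -> 0 < jac r N B A x0 b b' x 0 0 * jac r N B A x0 b b' x 1 1 -
     jac r N B A x0 b b' x 0 1 * jac r N B A x0 b b' x 1 0.
  move=> Dx; rewrite (jac_det _ _ _ _ _ eta2 pb).
  have [bb bb'] := profile_bound pb (height x).
  have [_ _ _ hd hc] := HL x Dx.
  have hdi i : `|dheight r N A x0 x (delta_mx 0 i)| <= L.
    rewrite (le_trans (hd _))// ler_piMr ?(ltW L0)//.
    by apply: norm_rV_le => // k; rewrite mxE /=; case: (k == i); rewrite ?normr0 ?normr1.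
  have hci j : `|lever_coord r N B x0 x 0 j| <= L by rewrite (le_trans (coord_le_norm _ _)).
  have hw : `|b' (height x) * (divergence r N B A x0 x / 2)| <= eta * (L ^+ 2).
    rewrite normrM ler_pM// normrM [`|2^-1|]ger0_norm// ler_pdivrMr// expr2.
    by rewrite (le_trans (ler_normD _ _))// mulr_natr mulr2n lerD// normrM ler_pM.
  move: bb hw; rewrite !ler_norml => /andP[bb _] /andP[hw _].
  by move: h3 eta2 bb hw; move: (b _) (b' _ * _) (L ^+ 2) => u v w *; nra.
split => //; split.
- move=> x Dx /(height_rim ch Dx) h; rewrite /patch_map (shift_supp hi0 eta2 pb)//.
  by have [-> _] := dilation_supp pb h; rewrite !scale0r !addr0.
- move=> x Dx; have [hr hN _ _ _] := HL x Dx.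
  rewrite /patch_map addrAC subrr add0r; set F := (X in _ * enorm X).
  have NK : enorm (N x) <= 3 * K.
    by rewrite (le_trans (enorm_le_norm _))// ler_wpM2l// (cap_boundN ch).
  have FL : `|F| <= eta * ((1 + hi ^+ 2) * L).
    rewrite (le_trans (ler_normD _ _))// !normrZ.
    rewrite (_ : _ * (_ * L) = eta * L + hi ^+ 2 * eta * L); last by ring.
    by have [_ _ k3] := kb x; rewrite lerD// ler_pM// gb.
  have FE : enorm F <= 3 * (eta * ((1 + hi ^+ 2) * L)).
    by rewrite (le_trans (enorm_le_norm _))// ler_wpM2l.
  apply: le_trans h1; rewrite (_ : eta * _ = (3 * K + 1) * (3 * (eta * ((1 + hi ^+ 2) * L)))).
    by rewrite ler_pM ?addr_ge0 ?enorm_ge0// lerD2r.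
  by ring.
- by move=> x Dx; exact: (patch_map_sdiff ch eta2 pb).
- by move=> x Dx; apply: unit_mx2; rewrite gt_eqF// Jd.
- move=> x y Dx Dy; pose F z := dilation b (height z) *: (r z - r x0) +
    shift_of hi b (height z) *: N x0.
  pose w := y - x; pose dF := displacement' r N B A x0 b b'.
  have Dz t : 0 <= t <= 1 -> D (x + t *: w) by move=> t01; exact: ball_segment.
  have [||t t01 e] := @mvt_segment _ (fun z => dotp (N x) (F z)) (fun z h => dotp (N x) (dF z h)) x w.
  - move=> t /Dz Dt.
    apply: sdiff_ext (sdiff_dotp (sdiff_cst (N x) _) (displacement_sdiff ch eta2 pb Dt)) _ => h.
    by rewrite dotp0l addr0.
  - move=> z a h; rewrite /dF /displacement' dheightZ -scalemxAl -dotpZr; congr dotp.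
    by rewrite [RHS]scalerDr !scalerA (mulrC a (dilation _ _)) mulrA.
  rewrite (_ : x + w = y) in e; last by rewrite /w subrKC.
  have -> : patch_map r N x0 rho c K b y - patch_map r N x0 rho c K b x =
      (r y - r x) + (F y - F x) by rewrite /patch_map -/(F x) -/(F y) opprD addrACA.
  rewrite [dotp _ (_ + (_ - _))]dotpDr [dotp _ (F y - F x)]dotpBr e.
  set z := x + t *: w in e *; have {}Dz : D z by exact: Dz.
  have Wge : 0 <= `|w| by [].
  have b1 : dotp (N x) (dF z w) <= c / 2 * `|w| ^+ 2.
    (* [dF z w] is orthogonal to N z, so N x may be replaced by N x - N z, which supplies the second
       factor |w|. *)
    rewrite -[leLHS]subr0 -(displacement'_ortho b b' w Dz) -dotpBl.
    rewrite (le_trans (ler_norm _))// (le_trans (dotp_norm_le _ _))//.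
    have zx : `|N x - N z| <= K * `|w|.
      rewrite (le_trans (cap_lipN ch Dz Dx))// ler_wpM2l ?(ltW K0)//.
      rewrite /z opprD addNKr normrN normrZ ger0_norm; last by case/andP : t01.
      by rewrite ler_piMl//; case/andP : t01.
    have [_ _ hl hd _] := HL z Dz.
    have dz : `|dF z w| <= eta * ((K + L ^+ 2) * `|w|).
      rewrite (le_trans (ler_normD _ _))//.
      rewrite (_ : _ * (_ * `|w|) = eta * (K * `|w|) + L * `|w| * eta * L); last by ring.
      have [_ _ k3] := kb z; have [_ hB] := cap_opnorm ch w Dz.
      rewrite lerD//; first by rewrite normrZ ler_pM.
      by rewrite normrZ ler_pM// normrM ler_pM.
    apply: (@le_trans _ _ (3 * (K * `|w| * (eta * ((K + L ^+ 2) * `|w|))))).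
      by rewrite ler_wpM2l// ler_pM.
    rewrite (_ : 3 * _ = eta * (3 * (K * (K + L ^+ 2))) * `|w| ^+ 2); last by ring.
    by rewrite ler_wpM2r ?sqr_ge0.
  have := cap_quad ch Dx Dy; rewrite -/w; move: b1.
  by move: (`|w| ^+ 2) (dotp _ (dF z w)) (dotp _ (r y - r x)) => u v u'; lra.
Qed.

End small_profiles.

(** * Families of deformations *)

Section plateau.
Context {R : realType}.

Lemma sdiff_id (x : R) : sdiff (fun y : R => y) x (fun h => h).
Proof.
split; first by exists 1 => // h; rewrite mul1r.
by move=> e e0; near=> p; rewrite subrr normr0 mulr_ge0// ltW.
Unshelve. all: by end_near. Qed.

Lemma pos_lipschitz (y z : R) : `|Num.max 0 y - Num.max 0 z| <= `|y - z|.
Proof.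
have := ler_norm (y - z); have := ler_norm (z - y); rewrite (distrC z) ler_norml.
by case: (leP 0 y) => y0; case: (leP 0 z) => z0 h1 h2; lra.
Qed.

Definition sqr_pos (x : R) : R := Num.max 0 x * Num.max 0 x.

Lemma sqr_pos_derive (x : R) : is_derive x 1 sqr_pos (2 * Num.max 0 x).
Proof.
have pos (y : R) : 0 < y -> sqr_pos y = y * y by move=> /ltW y0; rewrite /sqr_pos max_r.
have neg (y : R) : y < 0 -> sqr_pos y = 0 by move=> /ltW y0; rewrite /sqr_pos max_l// mulr0.
apply: sdiff_is_derive; have [x0|x0|<-] := ltgtP 0 x.
- apply: (@sdiff_near R R R (fun y => y * y)).
    by have := lt_nbhsr x0; apply: filterS => y /pos.
  apply: sdiff_ext (sdiffM (sdiff_id x) (sdiff_id x)) _ => h.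
  by ring.
- apply: (@sdiff_near R R R (fun=> 0)).
    by have := lt_nbhsl x0; apply: filterS => y /neg.
  apply: sdiff_ext (sdiff_cst _ _) _ => h.
  by rewrite !mulr0.
split; first by exists 1 => // h; rewrite !mulr0 normr0 mul1r.
move=> e e0; apply/near_pair; exists (e / 2); first by rewrite divr_gt0.
move=> y z; rewrite !subr0 /= !mulr0 subr0 /sqr_pos => ye ze.
have -> : Num.max 0 y * Num.max 0 y - Num.max 0 z * Num.max 0 z =
  (Num.max 0 y + Num.max 0 z) * (Num.max 0 y - Num.max 0 z) by ring.
have m (u : R) : 0 <= Num.max 0 u <= `|u|.
  by rewrite le_max lexx /= ge_max normr_ge0 ler_norm.
rewrite normrM ler_pM//; last exact: pos_lipschitz.
by rewrite ger0_norm; have := m y; have := m z; lra.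
Qed.

(** Half the jumps, at the knots 0 to 5, of a second derivative equal to 1, -1, 0, -1, 1 on the
    successive unit intervals. *)
Definition plateau_coef (k : nat) : R := nth 0 [:: 1 / 2; -1; 1 / 2; - (1 / 2); 1; - (1 / 2)] k.

(* A quadratic spline rising on [0, 2], equal to 1 on [2, 3] and falling on
   [3, 5]. *)
Definition plateau (x : R) : R := \sum_(k < 6) plateau_coef k *: sqr_pos (x - k%:R).

Definition plateau' (x : R) : R := \sum_(k < 6) plateau_coef k *: (2 * Num.max 0 (x - k%:R)).

Lemma plateau_derive (x : R) : is_derive x 1 plateau (plateau' x).
Proof.
have -> : plateau = \sum_(k < 6) (fun x => plateau_coef k *: sqr_pos (x - k%:R)).
  by apply/funext => y; rewrite fct_sumE.
apply: is_derive_sum => k; apply: is_deriveZ.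
have d1 : is_derive x 1 (fun y : R => y - (k : nat)%:R) 1.
  by rewrite -[X in is_derive _ _ _ X]subr0; apply: is_deriveB.
have := @is_derive1_comp R sqr_pos (fun y => y - (k : nat)%:R) x _ _ (sqr_pos_derive _) d1.
by rewrite mulr1.
Qed.

Lemma plateau'_continuous : continuous plateau'.
Proof.
apply: (@lipschitz_continuous _ _ _ _ (1 + \sum_(k < 6) `|plateau_coef k| * 2)) => [|x y].
  by rewrite ltr_pwDl// sumr_ge0// => k _; rewrite mulr_ge0.
rewrite /plateau' -sumrB (le_trans (ler_norm_sum _ _ _))//.
rewrite mulrDl mul1r mulr_suml -[leLHS]add0r lerD//.
apply: ler_sum => k _; rewrite -scalerBr normrZ -mulrA ler_wpM2l// -mulrBr normrM.
rewrite ger0_norm// ler_wpM2l// (le_trans (pos_lipschitz _ _))//.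
by rewrite opprB addrA subrK.
Qed.

Let pos_r (x : R) : 0 <= x -> Num.max 0 x = x. Proof. exact: max_r. Qed.
Let pos_l (x : R) : x <= 0 -> Num.max 0 x = 0. Proof. exact: max_l. Qed.

Let expand (F : nat -> R) : \sum_(k < 6) plateau_coef k *: F k =
  1 / 2 * F 0%N - F 1%N + 1 / 2 * F 2 - 1 / 2 * F 3 + F 4 - 1 / 2 * F 5.
Proof.
rewrite !big_ord_recl big_ord0 /plateau_coef /= /bump /= -![_ *: _]/(_ * _).
by ring.
Qed.

Let plateauE x : plateau x = 1 / 2 * sqr_pos (x - 0) - sqr_pos (x - 1) +
  1 / 2 * sqr_pos (x - 2) - 1 / 2 * sqr_pos (x - 3) + sqr_pos (x - 4) - 1 / 2 * sqr_pos (x - 5).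
Proof. exact: (expand (fun k => sqr_pos (x - k%:R))). Qed.

Let plateau'E x : plateau' x = 2 * (1 / 2 * Num.max 0 (x - 0) - Num.max 0 (x - 1) +
  1 / 2 * Num.max 0 (x - 2) - 1 / 2 * Num.max 0 (x - 3) + Num.max 0 (x - 4)
  - 1 / 2 * Num.max 0 (x - 5)).
Proof. by rewrite [LHS](expand (fun k => 2 * Num.max 0 (x - k%:R))); ring. Qed.

Lemma plateau_off (x : R) : x <= 0 \/ 5 <= x -> plateau x = 0 /\ plateau' x = 0.
Proof.
rewrite plateauE plateau'E /sqr_pos => h.
have [p pE] : exists p : bool, forall k, 0 <= k <= 5 -> Num.max 0 (x - k) = if p then x - k else 0.
  case: h => hx; [exists false|exists true] => k /andP[k0 k5]; [apply: pos_l|apply: pos_r]; lra.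
rewrite !pE; try by apply/andP; split; lra.
by case: p {pE}; split; lra.
Qed.

Lemma plateau_on (x : R) : 2 <= x <= 3 -> plateau x = 1 /\ plateau' x = 0.
Proof.
rewrite plateauE plateau'E /sqr_pos => /andP[x2 x3].
have e0 : Num.max 0 (x - 0) = x - 0 by apply: pos_r; lra.
have e1 : Num.max 0 (x - 1) = x - 1 by apply: pos_r; lra.
have e2 : Num.max 0 (x - 2) = x - 2 by apply: pos_r; lra.
have e3 : Num.max 0 (x - 3) = 0 by apply: pos_l; lra.
have e4 : Num.max 0 (x - 4) = 0 by apply: pos_l; lra.
have e5 : Num.max 0 (x - 5) = 0 by apply: pos_l; lra.
by rewrite e0 e1 e2 e3 e4 e5; split; lra.
Qed.

Lemma plateau_bound (x : R) : `|plateau x| <= 100 /\ `|plateau' x| <= 100.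
Proof.
have [x0|x0] := leP x 0.
  by have [-> ->] := plateau_off (or_introl x0); rewrite normr0.
have [x5|/ltW x5] := leP 5 x.
  by have [-> ->] := plateau_off (or_intror x5); rewrite normr0.
have m k : 0 <= k -> 0 <= Num.max 0 (x - k) <= 5.
  by move=> k0; rewrite le_max lexx /= ge_max ler0n /=; lra.
have s k : 0 <= k -> 0 <= sqr_pos (x - k) <= 25.
  by move=> /m/andP[]; rewrite /sqr_pos; move: (Num.max _ _) => u h1 h2; apply/andP; split; nra.
rewrite plateauE plateau'E !ler_norml; split.
  have /andP[? ?] := s 0 (ler0n _ 0); have /andP[? ?] := s 1 (ler0n _ 1).
  have /andP[? ?] := s 2 (ler0n _ 2); have /andP[? ?] := s 3 (ler0n _ 3).
  have /andP[? ?] := s 4 (ler0n _ 4); have /andP[? ?] := s 5 (ler0n _ 5).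
  by apply/andP; split; lra.
have /andP[? ?] := m 0 (ler0n _ 0); have /andP[? ?] := m 1 (ler0n _ 1).
have /andP[? ?] := m 2 (ler0n _ 2); have /andP[? ?] := m 3 (ler0n _ 3).
have /andP[? ?] := m 4 (ler0n _ 4); have /andP[? ?] := m 5 (ler0n _ 5).
by apply/andP; split; lra.
Qed.

(** The interval from 0 to hi is cut into n + 1 windows of width 5 w, each carrying a rescaled
    plateau; [lo] and [up] bound the flat part of each. *)
Lemma plateau_profiles (hi eta : R) n : 0 < hi -> 0 < eta ->
  exists (b b' : 'I_n.+1 -> R -> R) (lo up : 'I_n.+1 -> R) (delta : R),
  [/\ 0 < delta, forall i, profile hi eta (b i) (b' i),
    forall i, 0 < lo i < up i /\ up i < hi &
    forall i j u, lo i <= u <= up i -> b j u = delta *+ (i == j) /\ b' j u = 0].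
Proof.
move=> hi0 eta0; pose w := hi / (5 * n.+1%:R).
have n0 : 0 < n.+1%:R :> R by rewrite ltr0n.
have w0 : 0 < w by rewrite divr_gt0// mulr_gt0.
(* 100 is the bound of [plateau_bound]; rescaling by w divides the derivative by w, hence the second
   term. *)
pose delta := Num.min (eta / 100) (eta * w / 100).
have d0 : 0 < delta by rewrite lt_min !divr_gt0// mulr_gt0.
pose a (i : 'I_n.+1) : R := 5 * w * (i : nat)%:R.
pose pos i u := (u - a i) / w.
exists (fun i u => delta * plateau (pos i u)), (fun i u => delta / w * plateau' (pos i u)).
exists (fun i => a i + 2 * w), (fun i => a i + 3 * w), delta.
have a0 i : 0 <= a i by rewrite !mulr_ge0// ltW.
have hE : hi = 5 * w * n.+1%:R by rewrite /w; field; rewrite gt_eqF.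
clearbody w.
have step i j : (i <= j)%N -> 5 * w * i%:R <= 5 * w * j%:R.
  by move=> ij; rewrite ler_wpM2l ?ler_nat// mulr_ge0// ltW.
have aS i : a i + 5 * w = 5 * w * i.+1%:R 
  by rewrite (_ : i.+1%:R = (i : nat)%:R + 1) ?mulrDr ?mulr1// natr1.
have ahi i : a i + 5 * w <= hi by rewrite aS hE step.
have dp i (u : R) : is_derive u 1 (pos i) w^-1.
  have d1 : is_derive u 1 (fun y : R => y - a i) 1.
    by rewrite -[X in is_derive _ _ _ X]subr0; apply: is_deriveB.
  have := is_deriveM d1 (is_derive_cst (w^-1 : R) u 1).
  by rewrite scaler0 add0r -[w^-1 *: 1]/(w^-1 * 1) mulr1.
have e1 : delta * 100 <= eta by rewrite -ler_pdivlMr// ge_min lexx.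
have e2 : delta / w * 100 <= eta.
  by rewrite mulrAC ler_pdivrMr// -ler_pdivlMr// ge_min lexx orbT.
split => //.
- move=> i; split.
  + move=> s; have := is_deriveZ delta (is_derive1_comp (plateau_derive _) (dp i s)).
    by rewrite -[delta *: _]/(delta * _) mulrCA mulrC.
  + move=> s; apply: (@cvgM _ _ (nbhs s)); first exact: cvg_cst.
    apply: (@continuous_comp _ _ _ (pos i) plateau'); last exact: plateau'_continuous.
    by apply: differentiable_continuous; apply/derivable1_diffP; have [] := dp i s.
  + move=> s his; have [|-> ->] := @plateau_off (pos i s); last by rewrite !mulr0.
    by right; rewrite ler_pdivlMr//; have := ahi i; lra.
  + move=> s; have [h h'] := plateau_bound (pos i s).
    rewrite !normrM; split.
      by apply: le_trans e1; rewrite gtr0_norm// ler_wpM2l// ltW.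
    apply: le_trans e2; rewrite -normrM gtr0_norm ?divr_gt0// ler_wpM2l//.
    by rewrite divr_ge0 ?ltW.
- by move=> i; have := a0 i; have := ahi i; split; [apply/andP; split|]; lra.
move=> i j u /andP[u1 u2]; have [eij|ij] := eqVneq i j.
  rewrite eij in u1 u2.
  have [|-> ->] := @plateau_on (pos j u); last by rewrite mulr0 mulr1.
  by rewrite /pos ler_pdivlMr// ler_pdivrMr//; apply/andP; split; lra.
have [|-> ->] := @plateau_off (pos j u); last by rewrite !mulr0.
have [lt|lt|eq] := ltngtP i j; last by move: ij; rewrite (val_inj eq) eqxx.
- left; rewrite /pos mulr_le0_ge0 ?invr_ge0 ?(ltW w0)// subr_le0.
  by have := step _ _ lt; rewrite -aS -/(a j); lra.
right; rewrite /pos ler_pdivlMr//.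
by have := step _ _ lt; rewrite -aS -/(a i); lra.
Qed.

End plateau.

Section profiles.
Context {R : realType}.
Variables (hi eta : R).
Hypothesis eta0 : 0 <= eta.

(** Because of the bound eta, profiles form only a symmetric convex set and not a vector space;
    linear combinations are rescaled to fit. *)
Lemma profile_comb a1 a2 b1 b1' b2 b2' : `|a1| + `|a2| <= 1 ->
  profile hi eta b1 b1' -> profile hi eta b2 b2' ->
  profile hi eta (fun u => a1 * b1 u + a2 * b2 u) (fun u => a1 * b1' u + a2 * b2' u).
Proof.
move=> a12 p1 p2.
have bnd (u v : R) : `|u| <= eta -> `|v| <= eta -> `|a1 * u + a2 * v| <= eta.
  move=> hu hv; rewrite (le_trans (ler_normD _ _))// !normrM.
  apply: (@le_trans _ _ ((`|a1| + `|a2|) * eta)); last by rewrite ler_piMl.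
  by rewrite mulrDl lerD// ler_wpM2l.
split.
- move=> s; have d1 := profile_derive p1 s; have d2 := profile_derive p2 s.
  exact: (is_deriveD (is_deriveZ a1 d1) (is_deriveZ a2 d2)).
- move=> s; apply: (@cvgD _ _ _ (nbhs s)); apply: (@cvgM _ _ (nbhs s));
    [exact: cvg_cst|exact: (profile_cont p1)|exact: cvg_cst|exact: (profile_cont p2)].
- move=> s hs; have [-> ->] := profile_supp p1 hs; have [-> ->] := profile_supp p2 hs.
  by rewrite !mulr0 addr0.
- move=> s; have [h1 h1'] := profile_bound p1 s; have [h2 h2'] := profile_bound p2 s.
  by split; apply: bnd.
Qed.

Lemma profile_scale a b b' : `|a| <= 1 -> profile hi eta b b' ->
  profile hi eta (fun u => a * b u) (fun u => a * b' u).
Proof.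
move=> a1 pb; have := @profile_comb a 0 _ _ _ _ _ pb pb; rewrite normr0 addr0 => /(_ a1).
by under eq_fun do rewrite mul0r addr0; under [X in profile _ _ _ X]eq_fun do rewrite mul0r addr0.
Qed.

Lemma profile0 : profile hi eta (fun=> 0) (fun=> 0).
Proof.
split => [s|s|//|s].
- exact: is_derive_cst.
- exact: cvg_cst.
- by rewrite normr0.
Qed.

End profiles.

Section pushed_area.
Context {R : realType}.
Local Notation U := 'rV[R]_2.
Local Notation V := 'rV[R]_3.
Variables (f : U -> V) (P : set U) (g : U -> sphere R).
Variables (fP : surface_map f P) (gP : {within P, continuous g}).
Hypothesis ffin : (hausdorff2 (f @` P) < +oo)%E.

(** The push-forward by g of the area of f over P. The three proofs are arguments so that the charge
    structure below can be attached: they give additivity, Borel preimages and finiteness. *)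
Definition pushed_area of surface_map f P & {within P, continuous g} &
    (hausdorff2 (f @` P) < +oo)%E :=
  fun X : set (borel_sphere R) => hausdorff2 (f @` (g @^-1` X `&` P)).

Let nu := pushed_area fP gP ffin.

Let nu0 : nu set0 = 0%E.
Proof. by rewrite /nu /pushed_area preimage_set0 set0I image_set0 outer_measure0. Qed.

Let nu_fin : fin_num_fun nu.
Proof.
move=> X _; rewrite ge0_fin_numE ?outer_measure_ge0//; apply: le_lt_trans ffin.
by apply: le_outer_measure; apply: image_subset; exact: subIsetr.
Qed.

Let nu_sigma : semi_sigma_additive nu.
Proof.
move=> F mF tF mUF.
have clP : closed P by have [] := fP.
have mG (X : set (borel_sphere R)) : measurable X -> <<s @open U >> (P `&` g @^-1` X).
  by move=> mX; apply: preimage_borel => //; exact: closed_borel.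
have nuE X : nu X = area fP (P `&` g @^-1` X).
  by rewrite /nu /pushed_area /area setIC -setIA [_ `&` P]setIC setIA setIid.
rewrite (_ : (fun n => _) = (fun n => \sum_(0 <= i < n) area fP (P `&` g @^-1` F i)))%E; last first.
  by apply/funext => n; apply: eq_bigr => i _; rewrite nuE.
rewrite nuE preimage_bigcup setI_bigcupr; apply: measure_semi_sigma_additive.
- by move=> i; exact: mG.
- apply/trivIsetP => i j _ _ ij; have /trivIsetP/(_ i j I I ij) h := tF.
  by rewrite setIACA setIid -preimage_setI h preimage_set0 setI0.
- by rewrite -setI_bigcupr -preimage_bigcup; exact: mG.
Qed.

HB.instance Definition _ := isCharge.Build _ _ _ nu nu0 nu_fin nu_sigma.

End pushed_area.

(** * The family of bodies and the space of differences *)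

Section family.
Context {R : realType}.
Local Notation U := 'rV[R]_2.
Local Notation V := 'rV[R]_3.
Variables (C : set V) (bodyC : convex_body C) (o : V) (r N : U -> V) (B A : U -> 'M[R]_(2, 3)).
Variables (x0 : U) (rho c K : R) (ch : cap_chart C r N B A x0 rho c K).
Local Notation D := [set x : U | `|x - x0| < rho].
Local Notation P := [set x : U | `|x - x0| <= 3 / 4 * rho].
Hypothesis minus : forall x, D x -> boundary_minus C o (r x).
Variables (dm : R) (dm0 : 0 < dm) (z0 : V).
Hypothesis slack : forall x m xi, `|x - x0| <= rho / 2 -> far_contact C r x0 rho m xi ->
  dotp m (r x - xi) <= - (2 * dm) /\ dotp (N x) (xi - r x) <= - (2 * dm).
Hypothesis z0C : forall m x, contact C m x -> dotp m (z0 - x) <= - (2 * dm).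
Local Notation hi := (rim_height rho c K).
Local Notation height := (height r N x0).
Local Notation J := (jac r N B A x0).
Local Notation H := (@hausdorff2 R).
Let Rb b := patch_map r N x0 rho c K b.
Variables (eta : R) (eta0 : 0 < eta) (eta2 : eta <= 1 / 2).
Hypothesis HE : forall b b', profile hi eta b b' ->
  [/\ deformation r N B x0 rho c dm (Rb b) (jac_mx r N B A x0 b b'),
   forall x, D x -> 0 < J b b' x 0 0 &
   forall x, D x -> 0 < J b b' x 0 0 * J b b' x 1 1 - J b b' x 0 1 * J b b' x 1 0].

Let hi0 : 0 < hi. Proof. exact: (rim_height_gt0 ch). Qed.
Let rho0 : 0 < rho. Proof. exact: (cap_rho ch). Qed.
Let PD : P `<=` D. Proof. by move=> x; rewrite /=; have := rho0; lra. Qed.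

Let Cb b := deformed C r N x0 rho (Rb b).

(** The zero profile is a profile for the bound 0, and the estimates on the dilation and the shift
    then force both to vanish. *)
Lemma patch_map0 x : D x -> Rb (fun=> 0) x = r x.
Proof.
move=> Dx; have p0 : profile hi 0 (fun=> 0) (fun=> 0) by exact: (profile0 hi (lexx 0)).
have e2 : 0 <= 1 / 2 :> R by [].
have := shift_bound hi0 e2 p0 (height_ge0 ch Dx); rewrite mulr0 normr_le0 => /eqP sh.
have [_ _] := dilation_sqrt e2 p0 (height x); rewrite normr_le0 => /eqP di.
by rewrite /Rb /patch_map sh di !scale0r !addr0.
Qed.

Lemma deformed0 : Cb (fun=> 0) = C.
Proof.
apply/seteqP; split => z.
  move=> [h1 h2]; apply: (mem_contact bodyC) => m xi mxi.
  have [/h2//|[x [Px -> ->]]] := contact_cases ch mxi.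
  have Dx : D x by apply: PD; exact: ltW.
  by rewrite (cap_le0 ch)// -(patch_map0 Dx) h1//; exact: ltW.
move=> Cz; split => [x /PD Dx|m xi [[_ _ h] _]]; last exact: h.
by rewrite (patch_map0 Dx) (cap_side ch).
Qed.

Lemma cap_row_free x : D x -> row_free (B x).
Proof.
move=> Dx; apply: inj_row_free => v v0; have := cap_lower ch v Dx.
rewrite v0 normr0 mulr0 pmulr_rle0 ?mulr_gt0 ?(cap_c ch)// normr_le0.
by move/eqP.
Qed.

Lemma cap_boundary x : D x -> boundary C (r x).
Proof. by case/minus. Qed.

Lemma sub_surface_map (f : U -> V) (X Y : set U) : closed X -> X `<=` Y ->
  surface_map f Y -> surface_map f X.
Proof.
move=> cX XY [_ cf inj]; split => //; first exact: continuous_subspaceW cf.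
by move=> x y /set_mem/XY Yx /set_mem/XY Yy; apply: inj; rewrite inE.
Qed.

Lemma profile_surface_map b b' : profile hi eta b b' -> surface_map (Rb b) P.
Proof. by move=> /HE[df _ _]; exact: (def_surface_map ch df). Qed.

Lemma cap_surface_map : surface_map r P.
Proof.
split; first exact: closed_disk.
  by apply: continuous_in_subspaceT => x /set_mem/PD Dx; have [] := cap_continuous ch Dx.
by move=> x y /set_mem/PD Dx /set_mem/PD Dy; exact: (cap_inj ch).
Qed.

Lemma boundary_sub_fin X : X `<=` boundary C -> (H X < +oo)%E.
Proof.
by move=> XC; apply: le_lt_trans (boundary_area_fin bodyC); exact: le_outer_measure.
Qed.

(* The Jacobian determinant is affine in the profile, so linear relations between
   profiles give linear relations between areas. *)
Lemma profile_area n (b b' : 'I_n -> R -> R) (cf : 'I_n -> R) (Q E : set U) :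
  compact Q -> Q `<=` P -> (forall i, profile hi eta (b i) (b' i)) ->
  (forall x, Q x -> \sum_i cf i * (1 + b i (height x) +
     b' i (height x) * (divergence r N B A x0 x / 2)) = 0) ->
  <<s @open U >> E ->
  (forall i, H (Rb (b i) @` (E `&` Q)) \is a fin_num) /\
  \sum_i cf i * fine (H (Rb (b i) @` (E `&` Q))) = 0.
Proof.
move=> cQ QP pb sumD; have QD := subset_trans QP PD.
have clQ : closed Q by apply: compact_closed => //; exact: norm_hausdorff.
apply: (@area_combination R n (fun i => Rb (b i)) r cf Q B
  (fun i x => J (b i) (b' i) x 0 0) (fun i x => J (b i) (b' i) x 0 1)
  (fun i x => J (b i) (b' i) x 1 0) (fun i x => J (b i) (b' i) x 1 1)) => //.
- by move=> i; apply: sub_surface_map (profile_surface_map (pb i)).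
- by apply: sub_surface_map cap_surface_map.
- by move=> x /QD; exact: cap_row_free.
- by move=> x /QD Dx; exact: (cap_r ch Dx).
- by move=> i x /QD Dx; have [df _ _] := HE (pb i); exact: (def_sdiff df Dx).
- by move=> i x /QD Dx; have [_ h _] := HE (pb i); exact: h.
- by move=> i x /QD Dx; have [_ _ h] := HE (pb i); exact: h.
- move=> x Qx; rewrite -[RHS](sumD x Qx); apply: eq_bigr => i _.
  by rewrite (jac_det _ _ _ _ _ eta2 (pb i)).
by apply: boundary_sub_fin => _ [x /QD Dx <-]; exact: cap_boundary.
Qed.

Let preim X := gauss_map N @^-1` X `&` P.

Definition patch_area (b : R -> R) (X : set (borel_sphere R)) : R :=
  fine (H (Rb b @` preim X)).

Lemma preim_borel (X : set (borel_sphere R)) : measurable X -> <<s @open U >> (preim X).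
Proof.
move=> mX; rewrite /preim setIC; apply: preimage_borel => //; last exact: (gauss_map_continuous ch).
by apply: closed_borel; exact: closed_disk.
Qed.

Lemma patch_area_comb n (b b' : 'I_n -> R -> R) (cf : 'I_n -> R) (X : set (borel_sphere R)) :
  measurable X -> (forall i, profile hi eta (b i) (b' i)) ->
  \sum_i cf i = 0 -> (forall u, \sum_i cf i * b i u = 0) ->
  (forall u, \sum_i cf i * b' i u = 0) -> \sum_i cf i * patch_area (b i) X = 0.
Proof.
move=> mX pb s0 s1 s2.
have [x _|_ ] := @profile_area n b b' cf P (preim X) (@compact_disk R x0 _) (@subset_refl _ _) pb _ (preim_borel mX).
  under eq_bigr do rewrite mulrDr mulrDr mulr1 mulrA.
  by rewrite big_split/= big_split/= s0 s1 -mulr_suml s2 mul0r !addr0.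
by rewrite /preim -setIA setIid.
Qed.

Lemma patch_area_fin b b' (X : set (borel_sphere R)) : measurable X -> profile hi eta b b' ->
  H (Rb b @` preim X) = (patch_area b X)%:E.
Proof.
(* A single profile with coefficient 0: the relation is trivial, and the finiteness part of
   [profile_area] is what is wanted. *)
move=> mX pb; have [x _|h _ ] := @profile_area 1 (fun=> b) (fun=> b') (fun=> 0) P (preim X)
  (@compact_disk R x0 _) (@subset_refl _ _) (fun=> pb) _ (preim_borel mX).
  by rewrite big1// => i _; rewrite mul0r.
by rewrite /patch_area fineK//; have := h 0; rewrite /preim -setIA setIid.
Qed.

Lemma deformed_measureE b b' (X : set (borel_sphere R)) : measurable X -> profile hi eta b b' ->
  surface_measure (Cb b) X = (patch_area b X + fine (H (off_patch C r x0 rho X)))%:E.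
Proof.
move=> mX pb; have [df _ _] := HE pb.
rewrite (deformed_surface_measure bodyC ch dm0 slack z0C df) EFinD -(patch_area_fin mX pb).
congr (_ + _)%E; rewrite fineK// ge0_fin_numE ?outer_measure_ge0//.
by apply: boundary_sub_fin => z [].
Qed.

Let affine_eq (s a d e : R) (x y z : \bar R) : x = a%:E -> y = d%:E -> z = e%:E ->
  a = d + s * (e - d) -> (x = y + s%:E * (z - y))%E.
Proof. by move=> -> -> -> ->. Qed.

Let affine_arith (s a0 as_ a1 y : R) : 1 * as_ + ((s - 1) * a0 + (- s * a1 + 0)) = 0 ->
  as_ + y = a0 + y + s * (a1 + y - (a0 + y)).
Proof. by move=> *; lra. Qed.

(** For (b), the cap is visible from o, so points of [boundary_plus] are off the patch, where the
    boundary is unchanged. For (c), the part off the patch is common to all s, and the patch areas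
    are related by [patch_area_comb]. *)
Lemma deformed_family b b' : profile hi eta b b' ->
  family_abc C o (fun s => Cb (fun u => s * b u)).
Proof.
move=> pb.
have ps s : s \in `[-1, 1] -> profile hi eta (fun u => s * b u) (fun u => s * b' u).
  by rewrite in_itv /= => s1; apply: profile_scale => //; [exact: ltW|rewrite ler_norml].
split.
- by move=> s /ps/HE[df _ _]; exact: (deformed_body bodyC ch dm0 z0C df).
- by rewrite -[RHS]deformed0; congr Cb; apply/funext => u; rewrite mul0r.
- move=> s /ps/HE[df _ _] z [bz nz]; apply/(boundary_deformed bodyC ch dm0 slack z0C df).
  by right; split => // -[x /PD Dx xz]; apply: nz; rewrite -xz; exact: minus.
move=> s s1 X mX; have p0 := profile0 hi (ltW eta0).
have p1 : profile hi eta (fun u => 1 * b u) (fun u => 1 * b' u).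
  by apply: ps; rewrite in_itv /=; lra.
have -> : surface_measure C X = surface_measure (Cb (fun=> 0)) X by rewrite deformed0.
apply: (affine_eq (deformed_measureE mX (ps s s1)) (deformed_measureE mX p0)
  (deformed_measureE mX p1)).
pose bb (i : 'I_3) := nth (fun=> 0) [:: fun u => s * b u; fun=> 0; fun u => 1 * b u] i.
pose bb' (i : 'I_3) := nth (fun=> 0) [:: fun u => s * b' u; fun=> 0; fun u => 1 * b' u] i.
(* For the profiles s b, 0 and b these coefficients have sum 0 and cancel both b and b'. *)
pose cf (i : 'I_3) := nth 0 [:: 1; s - 1; - s] i.
have : \sum_i cf i * patch_area (bb i) X = 0.
  apply: (@patch_area_comb 3 bb bb' cf X mX) => [||u|u].
  - by case=> -[|[|[|//]]] ? /=; [exact: ps|exact: p0|exact: p1].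
  - by rewrite !big_ord_recl big_ord0 /cf /bb /bb' /=; ring.
  - by rewrite !big_ord_recl big_ord0 /cf /bb /bb' /=; ring.
  - by rewrite !big_ord_recl big_ord0 /cf /bb /bb' /=; ring.
rewrite !big_ord_recl big_ord0 /cf /bb /=.
exact: affine_arith.
Qed.

Let line b lambda (X : set (borel_sphere R)) : \bar R :=
  (lambda%:E * (surface_measure (Cb (fun u => (1 * b u)%R)) X - surface_measure C X))%E.

Lemma lineE b b' lambda (X : set (borel_sphere R)) : measurable X -> profile hi eta b b' ->
  line b lambda X = (lambda * (patch_area b X - patch_area (fun=> 0) X))%:E.
Proof.
move=> mX pb; have p0 := profile0 hi (ltW eta0).
have b1 : (fun u => 1 * b u) = b by apply/funext => u; rewrite mul1r.
have := deformed_measureE mX p0; rewrite deformed0 /line b1 => ->.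
rewrite (deformed_measureE mX pb) -EFinB -EFinM; congr EFin.
generalize (patch_area b X) (patch_area (fun=> 0) X)
  (fine (H (off_patch C r x0 rho X))) => *; ring.
Qed.

Lemma line_charge b b' lambda : profile hi eta b b' ->
  exists m : signed_measure R, is_charge_of (line b lambda) m.
Proof.
have ch_of b1 b1' : profile hi eta b1 b1' -> exists m : signed_measure R,
    forall X : set (borel_sphere R), measurable X -> m X = (patch_area b1 X)%:E.
  move=> p1; have fin1 : (H (Rb b1 @` P) < +oo)%E.
    have := patch_area_fin (@measurableT _ (borel_sphere R)) p1.
    by rewrite /preim preimage_setT setTI => ->; exact: ltry.
  exists (pushed_area (profile_surface_map p1) (gauss_map_continuous ch) fin1).
  by move=> X mX; exact: patch_area_fin p1.
move=> pb; have [m1 m1E] := ch_of _ _ pb; have [m0 m0E] := ch_of _ _ (profile0 hi (ltW eta0)).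
exists (cscale lambda (cadd m1 (cscale (-1) m0))) => X mX.
rewrite (lineE lambda mX pb) -[LHS]/(lambda%:E * (m1 X + (-1)%:E * m0 X))%E.
rewrite m1E// m0E// EFinM EFinB; congr (_ * (_ + _))%E.
by rewrite -EFinM mulN1r.
Qed.

Definition theta : Type := {bb : (R -> R) * (R -> R) | profile hi eta bb.1 bb.2}.

Let V0 := [set m : signed_measure R | exists (t : theta) lambda,
  is_charge_of (line (sval t).1 lambda) m].

(** The real factor lambda compensates for the bound on profiles: l1 b1 + l2 b2 is divided by [l],
    which exceeds |l1| + |l2|, to become a profile, and the line is then taken with factor [l]. *)
Lemma line_subspace : subspace_of_charges V0.
Proof.
have p0 := profile0 hi (ltW eta0).
have mk b b' (pb : profile hi eta b b') : exists t : theta, (sval t).1 = b.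
  by exists (exist _ (b, b') pb).
split.
- have [t tE] := mk _ _ p0; exists t, 0 => X mX.
  by rewrite /line mul0e.
- move=> m1 m2 [[[b1 b1'] /= p1] [l1 h1]] [[[b2 b2'] /= p2] [l2 h2]].
  pose l := `|l1| + `|l2| + 1; have l0 : 0 < l by rewrite ltr_wpDl// addr_ge0.
  have p12 : profile hi eta (fun u => l1 / l * b1 u + l2 / l * b2 u)
      (fun u => l1 / l * b1' u + l2 / l * b2' u).
    apply: profile_comb => //; first exact: ltW.
    by rewrite !normrM !normfV (gtr0_norm l0) -mulrDl ler_pdivrMr// mul1r /l lerDl.
  have [t tE] := mk _ _ p12; exists t, l => X mX; rewrite tE.
  rewrite -[LHS]/(m1 X + m2 X)%E h1// h2// (lineE l mX p12) (lineE l1 mX p1) (lineE l2 mX p2) -EFinD.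
  congr EFin.
  pose bb (i : 'I_4) := nth (fun=> 0) [:: fun u => l1 / l * b1 u + l2 / l * b2 u; b1; b2; fun=> 0] i.
  pose bb' (i : 'I_4) := nth (fun=> 0) [:: fun u => l1 / l * b1' u + l2 / l * b2' u; b1'; b2'; fun=> 0] i.
  pose cf (i : 'I_4) := nth 0 [:: l; - l1; - l2; - l + l1 + l2] i.
  have : \sum_i cf i * patch_area (bb i) X = 0.
    apply: (@patch_area_comb 4 bb bb' cf X mX) => [||u|u].
    + by case=> -[|[|[|[|//]]]] ? /=; [exact: p12|exact: p1|exact: p2|exact: p0].
    + by rewrite !big_ord_recl big_ord0 /cf /bb /bb' /=; ring.
    + by rewrite !big_ord_recl big_ord0 /cf /bb /bb' /=; field; rewrite gt_eqF.
    + by rewrite !big_ord_recl big_ord0 /cf /bb /bb' /=; field; rewrite gt_eqF.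
  rewrite !big_ord_recl big_ord0 /cf /bb /=.
  generalize (patch_area (fun u => l1 / l * b1 u + l2 / l * b2 u) X) (patch_area b1 X)
    (patch_area b2 X) (patch_area (fun=> 0) X) => *; lra.
move=> a m [t [l h]]; exists t, (a * l) => X mX.
by rewrite -[LHS]/(a%:E * m X)%E h// /line muleA -EFinM.
Qed.

Let dist_arith (k a e m w t u : R) : a <= - k * (w * w) -> - e <= - k * (w * w) ->
  m <= u * w * t -> e - a <= 3 * m -> 2 * k * w * w <= 3 * u * t * w.
Proof. by move=> *; lra. Qed.

Lemma cap_dist_lower x y : D x -> D y -> 2 * c * `|y - x| <= 3 * K * `|r y - r x|.
Proof.
move=> Dx Dy; have [->|yx] := eqVneq y x; first by rewrite !subrr !normr0 !mulr0.
have hp : 0 < `|y - x| by rewrite normr_gt0 subr_eq0.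
have q1 := cap_quad ch Dx Dy; have q2 := cap_quad ch Dy Dx.
rewrite -(opprB (r y)) dotpNr (distrC x) in q2.
rewrite -(ler_pM2r hp).
have := le_trans (ler_norm _) (dotp_norm_le (N y - N x) (r y - r x)).
have := ler_wpM2r (normr_ge0 (r y - r x)) (cap_lipN ch Dx Dy).
rewrite [dotp (_ - _) _]dotpBl; move: q1 q2; rewrite expr2.
exact: dist_arith.
Qed.

Lemma disk_area_gt0 x1 s : 0 < s -> [set x : U | `|x - x1| <= s] `<=` D ->
  (0 < H (r @` [set x : U | (`|x - x1| <= s)%R]))%E.
Proof.
move=> s0 QD; have K3 : 0 < 3 * K by rewrite mulr_gt0// (cap_K ch).
have inQ (u : U) : box 0 1 0 1 u -> `|x1 + s *: u - x1| <= s.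
  move=> [/andP[h1 h2] /andP[h3 h4]]; rewrite addrAC subrr add0r normrZ gtr0_norm// ler_piMr ?(ltW s0)//.
  apply: norm_rV_le => // i; have [->|->] : i = 0 \/ i = 1.
    by case: i => -[|[|//]] ?; [left|right]; exact: val_inj.
  - by rewrite ger0_norm// ltW.
  - by rewrite ger0_norm// ltW.
apply: (lt_le_trans (y := H ((fun u => r (x1 + s *: u)) @` box 0 1 0 1))).
  apply: (@area_positive R _ (s * (2 * c) / (3 * K))).
    by rewrite divr_gt0// mulr_gt0// mulr_gt0// (cap_c ch).
  move=> u v bu bv; apply: le_trans (norm_le_enorm _).
  rewrite mulrAC ler_pdivrMr// [leRHS]mulrC.
  have := cap_dist_lower (QD _ (inQ _ bv)) (QD _ (inQ _ bu)).
  rewrite opprD addrACA subrr add0r -scalerBr normrZ gtr0_norm//.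
  by move: (`|_ - _|) (`|_ - _|) => *; lra.
by apply: le_outer_measure => _ [u bu <-]; exists (x1 + s *: u) => //; exact: inQ.
Qed.

Lemma height_onto u : 0 < u < hi -> exists2 x, `|x - x0| <= rho / 2 & height x = u.
Proof.
move=> /andP[u0 uhi]; pose w : U := (rho / 2) *: delta_mx 0 0.
have e1 : `|delta_mx 0 0 : U| = 1.
  apply/eqP; rewrite eq_le; apply/andP; split.
    by apply: norm_rV_le => // i; rewrite mxE /=; case: (i == 0); rewrite ?normr0 ?normr1.
  by have := coord_le_norm (delta_mx 0 0 : U) 0; rewrite mxE /= normr1.
have rho2 : 0 < rho / 2 by rewrite divr_gt0.
have wE : `|w| = rho / 2 by rewrite normrZ e1 mulr1 gtr0_norm.
have seg t : 0 <= t <= 1 -> `|x0 + t *: w - x0| <= rho / 2.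
  by move=> /andP[t0 t1]; rewrite addrAC subrr add0r normrZ wE ger0_norm// ler_piMl// ltW.
have segD t : 0 <= t <= 1 -> D (x0 + t *: w) by move=> /seg/=; have := rho0; lra.
pose g t := height (x0 + t *: w).
have cg : {within `[0, 1], continuous g}.
  apply: derivable_within_continuous => t; rewrite in_itv /= => /segD Dt.
  have := sdiff_segment (dheightZ r N A x0 _) (height_sdiff ch Dt).
  by case.
have g0 : g 0 = 0.
  by rewrite /g scale0r addr0 height0.
have g1 : hi <= g 1.
  apply: (height_rim ch); first by apply: segD; rewrite ler01 lexx.
  by rewrite scale1r addrAC subrr add0r wE.
have [|t] := @IVT R g 0 1 u ler01 cg.
  rewrite g0 (min_l (le_trans (ltW hi0) g1)) (max_r (le_trans (ltW hi0) g1)).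
  by rewrite (ltW u0) (le_trans (ltW uhi) g1).
rewrite in_itv /= => t01 tu; exists (x0 + t *: w) => //; exact: seg.
Qed.

Lemma height_disk lo up : 0 < lo < up -> up < hi -> exists x1 s, [/\ 0 < s,
  [set x : U | `|x - x1| <= s] `<=` P &
  forall x, `|x - x1| <= s -> lo <= height x <= up].
Proof.
move=> /andP[lo0 loup] uphi.
have [|x1 x1r hx1] := @height_onto ((lo + up) / 2); first by lra.
have Dx1 : D x1 by rewrite /=; have := rho0; lra.
have ch1 : {for x1, continuous height} by exact: sdiff_continuous (height_sdiff ch Dx1).
have e0 : 0 < (up - lo) / 2 by lra.
have /cvgrPdist_lt/(_ _ e0)/nbhs_ballP[d /= d0 hd] := ch1.
exists x1, (Num.min (d / 2) (rho / 4)); split.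
- by rewrite lt_min !divr_gt0.
- move=> x /=; rewrite le_min => /andP[_ h].
  have := ler_distD x1 x x0; lra.
move=> x; rewrite le_min => /andP[h _].
have := hd x; rewrite -ball_normE /= distrC hx1 => /(_ _)/ltW; rewrite ler_norml.
by move=> H0; have /andP[] := H0 ltac:(lra); move=> *; apply/andP; split; lra.
Qed.

(** Where the profile is constant in the height, the Jacobian is the constant 1 + d, and the area is
    compared with that of the zero profile. *)
Lemma disk_patch_area x1 s b b' d : let Q := [set x : U | `|x - x1| <= s] in
  Q `<=` P -> profile hi eta b b' ->
  (forall x, Q x -> b (height x) = d /\ b' (height x) = 0) ->
  fine (H (Rb b @` Q)) = (1 + d) * fine (H (r @` Q)).
Proof.
move=> Q QP pb hb; have p0 := profile0 hi (ltW eta0).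
pose bb (i : 'I_2) := nth (fun=> 0) [:: b; fun=> 0] i.
pose bb' (i : 'I_2) := nth (fun=> 0) [:: b'; fun=> 0] i.
pose cf (i : 'I_2) := nth 0 [:: 1; - (1 + d)] i.
have [|x Qx||_] := @profile_area 2 bb bb' cf Q setT (@compact_disk R x1 s) QP.
- by case=> -[|[|//]] ? /=; [exact: pb|exact: p0].
- rewrite !big_ord_recl big_ord0 /cf /bb /bb' /=; have [-> ->] := hb x Qx; ring.
- exact: (@measurableT _ (g_sigma_algebraType (@open U))).
rewrite setTI !big_ord_recl big_ord0 /cf /bb /=.
have -> : Rb (fun=> 0) @` Q = r @` Q.
  by apply: eq_imagel => x /QP/PD; exact: patch_map0.
by move: (fine _) (fine _) => *; lra.
Qed.

(** The normals over a closed disk form a compact set of vectors, and the Gauss map is injective on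
    the cap by strict convexity, so no other point of P has a normal in this set. *)
Lemma disk_normals x1 s : let Q := [set x : U | `|x - x1| <= s] in Q `<=` P ->
  exists2 X : set (borel_sphere R), measurable X & preim X = Q.
Proof.
move=> Q QP; pose Nh x := (enorm (N x))^-1 *: N x.
have cN : {within Q, continuous Nh}.
  by apply: continuous_in_subspaceT => x /set_mem/QP/PD; exact: (unit_normal_continuous ch).
exists (@set_val _ [set u : V | enorm u = 1] @^-1` (Nh @` Q)).
  apply: (@closed_borel (sphere R)).
  apply: closed_comp; first by move=> z _; exact: initial_continuous.
  apply: compact_closed; first exact: norm_hausdorff.
  exact: (continuous_compact cN (@compact_disk R x1 s)).
apply/seteqP; split => x; last first.
  by move=> Qx; split; [exists x => //; rewrite (gauss_mapE ch)//; exact: PD (QP _ Qx)|exact: QP].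
move=> [[y Qy e] /PD Dx]; rewrite (gauss_mapE ch)// in e.
by rewrite -(cap_normal_inj ch (PD (QP _ Qy)) Dx e).
Qed.

Let disk_arith (x y z d : R) : x = (1 + d) * z -> y = (1 + 0) * z -> x - y = d * z.
Proof. by move=> -> ->; rewrite addr0 -mulrBl addrAC subrr add0r. Qed.

(** Disk i lies where the height is in the flat window i: there profile i equals delta, the others
    vanish, and all derivatives are zero. The normals over this disk therefore detect profile i
    alone. *)
Lemma disk_values n : exists (b b' : 'I_n.+1 -> R -> R) (X : 'I_n.+1 -> set (borel_sphere R))
    (w : 'I_n.+1 -> R), [/\ forall i, profile hi eta (b i) (b' i), forall i, measurable (X i),
  forall i, 0 < w i &
  forall i j, patch_area (b j) (X i) - patch_area (fun=> 0) (X i) = w i *+ (i == j)].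
Proof.
have [b [b' [lo [up [delta [d0 pb bnd val]]]]]] := plateau_profiles n hi0 eta0.
have /choice[x1 /choice[s disk]] : forall i, exists x1 s, [/\ 0 < s,
    [set x : U | `|x - x1| <= s] `<=` P & forall x, `|x - x1| <= s -> lo i <= height x <= up i].
  by move=> i; have [h1 h2] := bnd i; exact: height_disk h1 h2.
pose Q i := [set x : U | `|x - x1 i| <= s i].
have QP i : Q i `<=` P by have [] := disk i.
have /choice[X XE] : forall i, exists X : set (borel_sphere R), measurable X /\ preim X = Q i.
  by move=> i; have [X mX e] := disk_normals (QP i); exists X.
have p0 := profile0 hi (ltW eta0).
exists b, b', X, (fun i => delta * fine (H (r @` Q i))); split => //.
- by move=> i; have [] := XE i.
- move=> i; rewrite mulr_gt0// fine_gt0//; have [s0 _ _] := disk i.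
  rewrite disk_area_gt0//=; last exact: subset_trans (QP i) PD.
  by apply: boundary_sub_fin => _ [x /QP/PD Dx <-]; exact: cap_boundary.
move=> i j; rewrite /patch_area; have [_ ->] := XE i; have [_ _ hh] := disk i.
have e1 := disk_patch_area (d := delta *+ (i == j)) (QP i) (pb j) (fun x hx => val i j _ (hh x hx)).
have e0 := disk_patch_area (d := 0) (QP i) p0 (fun _ _ => conj erefl erefl).
by apply: etrans (disk_arith e1 e0) _; rewrite mulrnAl.
Qed.

(** A rank argument: n + 1 differences evaluated on n + 1 Borel sets form an invertible diagonal
    matrix. If n charges generated them, this matrix would factor through dimension n. *)
Lemma line_not_finite : ~ finite_dimensional V0.
Proof.
move=> [n [v [vV gen]]]; have [b [b' [X [w [pb mX w0 val]]]]] := disk_values n.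
have /choice[m mE] : forall i, exists m : signed_measure R, is_charge_of (line (b i) 1) m.
  by move=> i; exact: line_charge (pb i).
have mV i : V0 (m i) by exists (exist _ (b i, b' i) (pb i)), 1; exact: mE.
have /choice[a aE] : forall i, exists a : 'I_n -> R,
    is_charge_of (fun A => \sum_(k < n) ((a k)%:E * v k A))%E (m i).
  by move=> i; exact: gen (mV i).
pose M1 : 'M[R]_(n.+1, n) := \matrix_(i, k) a i k.
pose M2 : 'M[R]_(n, n.+1) := \matrix_(k, j) fine (v k (X j)).
have M12 : M1 *m M2 = diag_mx (\row_j w j).
  apply/matrixP => i j; rewrite !mxE; apply: EFin_inj.
  have := aE i (X j) (mX j); rewrite (mE i (X j) (mX j)) (lineE 1 (mX j) (pb i)) mul1r val.
  have -> : w j *+ (j == i) = w i *+ (i == j) by rewrite eq_sym; case: eqVneq => [->|].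
  move=> e; rewrite e -sumEFin; apply: eq_bigr => k _.
  by rewrite !mxE EFinM fineK// fin_num_measure.
have : M1 *m M2 \in unitmx.
  rewrite M12 unitmxE det_diag unitfE; apply/prodf_neq0 => i _.
  by rewrite mxE gt_eqF.
move=> /mxrank_unit rk; have := leq_trans (mxrankM_maxl M1 M2) (rank_leq_col M1).
by rewrite rk ltnn.
Qed.

End family.

Theorem corollary1 (R : realType) (C S : set 'rV[R]_3) (o : 'rV[R]_3)
    (bodyC : convex_body C)
    (openS : rel_open (boundary C) S)
    (C2S : C2_surface S)
    (curvS : positive_curvature S)
    (oC : ~ C o)
    (visS : closure (boundary_minus C o) `<=` S) :
  (exists Cs : R -> set 'rV[R]_3, family_abc C o Cs) /\
  (exists (Theta : Type) (Cth : Theta -> R -> set 'rV[R]_3),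
    (forall theta, family_abc C o (Cth theta)) /\
    let line (theta : Theta) (lambda : R) (A : set (borel_sphere R)) :=
      (lambda%:E *
        (surface_measure (Cth theta 1%R) A - surface_measure C A))%E in
    let V := [set m : signed_measure R |
      exists theta lambda, is_charge_of (line theta lambda) m] in
    [/\ forall theta lambda, exists m : signed_measure R,
          is_charge_of (line theta lambda) m,
        subspace_of_charges V &
        ~ finite_dimensional V]).
Proof.
have [r [N [B [A [x0 [rho [c [K [ch minus]]]]]]]]] := cap_exists bodyC openS C2S curvS oC visS.
have [d1 d10 slack1] := far_slack bodyC ch.
have [_ _ [z0 z0C]] := bodyC; have [d2 d20 slack2] := interior_slack z0C.
(* Half of the common slack is spent on the displacement; the other half remains as a margin. *)
pose dm := Num.min d1 d2 / 2.
have m0 : 0 < Num.min d1 d2 by rewrite lt_min d10.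
have dm0 : 0 < dm by rewrite divr_gt0.
have dm2 : 2 * dm = Num.min d1 d2 by rewrite mulrC divfK// pnatr_eq0.
have slack x m xi : `|x - x0| <= rho / 2 -> far_contact C r x0 rho m xi ->
    dotp m (r x - xi) <= - (2 * dm) /\ dotp (N x) (xi - r x) <= - (2 * dm).
  move=> xr mxi; have [h1 h2] := slack1 x m xi xr mxi; rewrite dm2.
  by split; [rewrite (le_trans h1)|rewrite (le_trans h2)]; rewrite // lerN2 ge_min lexx.
have z0S m x : contact C m x -> dotp m (z0 - x) <= - (2 * dm).
  by move=> /slack2 h; rewrite dm2 (le_trans h)// lerN2 ge_min lexx orbT.
have [eta /andP[eta0 eta2] HE] := deformation_exists ch dm0.
pose hi := rim_height rho c K.
have fam (t : theta rho c K eta) := deformed_family bodyC ch minus dm0 slack z0S eta0 eta2 HE (proj2_sig t).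
have p0 := profile0 hi (ltW eta0).
split.
  (* The zero profile is the witness here; the index type below ranges over all profiles. *)
  by eexists; exact: (fam (exist _ (fun=> 0, fun=> 0) p0)).
exists (theta rho c K eta), (fun t s => deformed C r N x0 rho
  (patch_map r N x0 rho c K (fun u => s * (sval t).1 u))); split; first exact: fam.
move=> line V; split.
- move=> t lambda.
  exact: (line_charge bodyC ch minus dm0 slack z0S eta0 eta2 HE lambda (proj2_sig t)).
- exact: (line_subspace bodyC ch minus dm0 slack z0S eta0 eta2 HE).
- exact: (line_not_finite bodyC ch minus dm0 slack z0S eta0 eta2 HE).
Qed.
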